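(* Let $h<h_\star$. For all $\delta_0>0$ small enough (depending only on $d$ and $h$), there exists $\varepsilon>0$ such that for every $\delta\in(0,\delta_0)$ and every $a\ge h$, $$q_{h,\delta}(a)<1-\varepsilon .$$
   Context: Fix an integer $d\ge 3$. $\mathbb T_d$ is the infinite $d$-regular tree rooted at a vertex $\circ$. The Gaussian Free Field (GFF) $\varphi=(\varphi(x))_{x\in\mathbb T_d}$ is the centred Gaussian field with $\mathrm{Cov}(\varphi(x),\varphi(y))=G(x,y)$, where $G(x,y)$ is the expected number of visits to $y$ (time $0$ included) of the discrete-time simple random walk on $\mathbb T_d$ started at $x$. Its law is $\mathbb P^{\mathbb T_d}$. For $a\in\mathbb R$, $\mathbb P^{\mathbb T_d}_a$ is $\mathbb P^{\mathbb T_d}$ conditioned on $\varphi(\circ)=a$; concretely, under $\mathbb P_a^{\mathbb T_d}$, $\varphi(\circ)=a$ and recursively $\varphi(y)=\frac{1}{d-1}\varphi(\overline y)+\sqrt{\tfrac{d}{d-1}}\,\zeta_y$ for $y\ne\circ$, with $\overline y$ the parent of $y$ and $(\zeta_y)$ i.i.d. $\mathcal N(0,1)$. For $h\in\mathbb R$, $\mathcal C_\circ^h$ is the connected component of $\circ$ in the level set $\{x\in\mathbb T_d:\varphi(x)\ge h\}$. There is a critical value $h_\star=h_\star(d)\in(0,\infty)$ such that $\mathbb P^{\mathbb T_d}(|\mathcal C_\circ^h|=\infty)>0$ for $h<h_\star$ and $=0$ for $h>h_\star$. Let $\overline\circ$ be a fixed neighbour of $\circ$, let $\mathbb T_d^+$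 be the largest subtree of $\mathbb T_d$ containing $\circ$ but not $\overline\circ$ (so every vertex of $\mathbb T_d^+$ has $d-1$ children in it), and let $\mathcal C_\circ^{h,+}:=\mathcal C_\circ^h\cap\mathbb T_d^+$, rooted at $\circ$. For $\delta>0$, a rooted tree $T$ with root $r$ is $\delta$-transient if the simple random walk $(X_k)$ on $T$ started at $r$ satisfies $\mathbf P_r^T(\forall k>0,\ X_k\ne r)\ge\delta$ (a finite tree, in particular a single vertex, is not $\delta$-transient). Set $$q_{h,\delta}(a):=\mathbb P_a^{\mathbb T_d}(\mathcal C_\circ^{h,+}\text{ is not }\delta\text{-transient}).$$ *)

(* Defs.v *)
From HB Require Import structures.
From mathcomp Require Import all_boot all_order all_algebra.
From mathcomp Require Import finmap.
From mathcomp Require Import all_classical all_reals all_analysis.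

Set Implicit Arguments.
Unset Strict Implicit.
Unset Printing Implicit Defensive.

Import Order.TTheory GRing.Theory Num.Theory.
Import numFieldNormedType.Exports.

Local Open Scope classical_set_scope.
Local Open Scope ring_scope.

(** * Graphs and simple random walk *)

Definition component (V : eqType) (adj : rel V) (A : set V) (r : V) : set V :=
  [set y | exists p : seq V,
     [/\ path adj r p, last r p = y & forall z, z \in r :: p -> A z]].

Definition nbrs (V : eqType) (adj : rel V) (A : set V) (x : V) : set V :=
  [set y | A y /\ adj x y].

Definition degree (V : choiceType) (adj : rel V) (A : set V) (x : V) : nat :=
  #|` fset_set (nbrs adj A x)|%fset.

(* Transition probabilities of the simple random walk on the subgraph induced
   by [A]. An isolated vertex is made absorbing, so that the walk is defined on
   the one-vertex graph as well. *)
Definition srw_step (R : realType) (V : choiceType) (adj : rel V) (A : set V)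
    (x y : V) : R :=
  if degree adj A x == 0%N then (y == x)%:R
  else (y \in nbrs adj A x)%:R / (degree adj A x)%:R.

Definition is_srw (R : realType) (V : countType) (adj : rel V) (A : set V)
    (r : V) (disp : measure_display) (Omega : measurableType disp)
    (Q : probability Omega R) (X : nat -> Omega -> V) : Prop :=
  (forall n x, measurable (X n @^-1` [set x])) /\
  (forall (n : nat) (p : nat -> V),
     Q [set w | forall k, (k <= n)%N -> X k w = p k] =
     ((p 0%N == r)%:R * \prod_(k < n) srw_step R adj A (p k) (p k.+1))%:E).

(* Two realizations of the walk have the same law, so the choice of the
   realization is immaterial here and in [delta_transient]. *)
Definition is_green (R : realType) (V : countType) (adj : rel V) (x y : V)
    (g : \bar R) : Prop :=
  exists (disp : measure_display) (Omega : measurableType disp)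
         (Q : probability Omega R) (X : nat -> Omega -> V),
    is_srw adj setT x Q X /\
    g = (\int[Q]_w \sum_(0 <= n <oo) ((X n w == y)%:R)%:E)%E.

Definition delta_transient (R : realType) (V : countType) (adj : rel V)
    (A : set V) (r : V) (delta : R) : Prop :=
  exists (disp : measure_display) (Omega : measurableType disp)
         (Q : probability Omega R) (X : nat -> Omega -> V),
    is_srw adj A r Q X /\
    (delta%:E <= Q [set w | forall k, (0 < k)%N -> X k w <> r])%E.

(** * The regular tree *)

(* Ulam-Harris coding, read from the vertex up to the root: the children of
   [s] are the sequences [i :: s], with [i < d] if [s] is the root [[::]] and
   [i < d.-1] otherwise. *)
Fixpoint tree_code (d : nat) (s : seq nat) : bool :=
  if s is i :: s' then
    (i < (if s' is [::] then d else d.-1))%N && tree_code d s'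
  else true.

Definition tree (d : nat) : Type := {s : seq nat | tree_code d s}.
HB.instance Definition _ (d : nat) := Countable.on (tree d).

Definition tree_root (d : nat) : tree d := exist _ [::] isT.

Lemma tree_code_behead (d : nat) (s : seq nat) :
  tree_code d s -> tree_code d (behead s).
Proof. by case: s => [|i s] //= /andP[]. Qed.

(* The root is its own parent. *)
Definition parent (d : nat) (x : tree d) : tree d :=
  exist _ (behead (sval x)) (tree_code_behead (svalP x)).

Definition tree_adj (d : nat) : rel (tree d) := fun x y =>
  (y != tree_root d) && (parent y == x) || (x != tree_root d) && (parent x == y).

Definition tree_plus (d : nat) (obar : tree d) : set (tree d) :=
  component (@tree_adj d) (~` [set obar]) (tree_root d).

Definition level_cluster (R : realType) (d : nat) (h : R) (f : tree d -> R) :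
    set (tree d) :=
  component (@tree_adj d) [set x | h <= f x] (tree_root d).

(** * Gaussian free field *)

(* [normal_prob] is parametrized by the standard deviation, and is the uniform
   law on [0, 1] when that parameter vanishes. *)
Definition has_normal_law (R : realType) (disp : measure_display)
    (Omega : measurableType disp) (P : probability Omega R) (X : Omega -> R)
    (m sigma : R) : Prop :=
  forall B : set R, measurable B ->
    P (X @^-1` B) = if sigma == 0 then \d_m B else normal_prob m sigma B.

Definition centred_gaussian_field (R : realType) (V : eqType)
    (disp : measure_display) (Omega : measurableType disp)
    (P : probability Omega R) (phi : V -> {RV P >-> R}) : Prop :=
  forall (s : seq V) (c : V -> R),
    exists sigma : R,
      has_normal_law P (fun w => \sum_(x <- s) c x * phi x w) 0 sigma.

Definition is_gff (R : realType) (d : nat) (disp : measure_display)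
    (Omega : measurableType disp) (P : probability Omega R)
    (phi : tree d -> {RV P >-> R}) : Prop :=
  centred_gaussian_field phi /\
  forall x y, is_green (@tree_adj d) x y (covariance P (phi x) (phi y)).

(* The law of the field is determined by [is_gff], so quantifying over its
   realizations amounts to picking any one of them. *)
Definition percolates (R : realType) (d : nat) (h : R) : Prop :=
  forall (disp : measure_display) (Omega : measurableType disp)
         (P : probability Omega R) (phi : tree d -> {RV P >-> R}),
    is_gff phi ->
    (0 < P [set w | infinite_set (level_cluster h (fun x => phi x w))])%E.

Definition hstar (R : realType) (d : nat) : \bar R :=
  ereal_sup [set h%:E | h in [set h : R | percolates d h]].

Definition independent_on (R : realType) (I : eqType) (D : set I)
    (disp : measure_display) (Omega : measurableType disp)
    (P : probability Omega R) (X : I -> {RV P >-> R}) : Prop :=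
  forall (s : seq I) (B : I -> set R),
    uniq s -> (forall i, i \in s -> D i) -> (forall i, measurable (B i)) ->
    P [set w | forall i, i \in s -> B i (X i w)] =
    (\prod_(i <- s) P (X i @^-1` B i))%E.

Definition is_gff_at (R : realType) (d : nat) (a : R) (disp : measure_display)
    (Omega : measurableType disp) (P : probability Omega R)
    (phi : tree d -> {RV P >-> R}) : Prop :=
  exists zeta : tree d -> {RV P >-> R},
    [/\ independent_on (~` [set tree_root d]) zeta,
        forall y, y != tree_root d -> has_normal_law P (zeta y) 0 1,
        forall w, phi (tree_root d) w = a &
        forall w y, y != tree_root d ->
          phi y w = (d%:R - 1)^-1 * phi (parent y) w
                    + Num.sqrt (d%:R / (d%:R - 1)) * zeta y w].

Definition q_prob (R : realType) (d : nat) (obar : tree d) (h delta : R)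
    (disp : measure_display) (Omega : measurableType disp)
    (P : probability Omega R) (phi : tree d -> {RV P >-> R}) : \bar R :=
  P [set w | ~ delta_transient (@tree_adj d)
                 (level_cluster h (fun x => phi x w) `&` tree_plus obar)
                 (tree_root d) delta].

(* Main.v *)
Require Import Defs.
From HB Require Import structures.
From mathcomp Require Import all_boot all_order all_algebra.
From mathcomp Require Import finmap.
From mathcomp Require Import all_classical all_reals all_analysis.
From mathcomp Require Import measurable_realfun.
From mathcomp Require Import ring lra zify.

Set Implicit Arguments.
Unset Strict Implicit.
Unset Printing Implicit Defensive.

Import Order.TTheory GRing.Theory Num.Theory.
Import numFieldNormedType.Exports.

Local Open Scope classical_set_scope.
Local Open Scope ring_scope.

(* Along the tree the field is a Markov chain, so the mean number of descendants
   of generation n joined to the root by values above h is an iterate u_n of the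
   operator f |-> (d - 1) E[f(X) ; X >= h], where X is the value of a child.

   If u_n(h) <= 1 for every n, then the branching process dies out: a second-moment
   correction, bounded below while survival has positive probability, would make
   u_n(h) grow linearly. Then no level above h percolates, which contradicts
   h < h_star.

   Otherwise some u_n(h) exceeds 1, and by supermultiplicativity some u_n(h)
   exceeds 2(n + 1). Looking at the tree in blocks of n generations, the mean
   conductance from the root to generation kn is then bounded below uniformly in k
   and in the starting value a >= h: the series resistance of a block costs at most a
   factor n + 1, and pairs of branches are controlled by thinning. Since conductances
   are at most 1, the conductance to infinity is bounded below with probability
   bounded below, and it bounds the escape probability from below. *)

(** * Independent normal noise *)

(** Conductance is not additive over branches, so its mean cannot be iterated like the mean size.
    Over one block it is compared with a linear count minus a contribution of pairs. That
    contribution is quadratic in the mean conductance of a branch, which varies with the starting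
    value; thinning fixes it at the bound [t]. Since [cross_const n * t <= 1], the pairs then cost
    at most [t], the factor 2 in [2 * n.+1%:R] absorbs them, and the same [t] comes out of each
    block.

    Two kinds of quantification over realizations force constructions. [percolates] speaks of all
    free fields, so contradicting it requires that a free field exist: one is built by the recursion
    along the tree, and its covariance is identified with the Green function through the one-step
    equation of the walk. [delta_transient] and [is_green] ask for some walk; it is driven by normal
    variables transformed into uniform indices. All this randomness is taken from the noise that
    comes with the given field, so no further probability space is constructed. *)

Definition cylinder (R : realType) (J : eqType) : set (set (J -> R)) :=
  [set C | exists (s : seq J) (B : J -> set R), (forall j, measurable (B j)) /\
    C = [set z | forall j, j \in s -> B j (z j)]].

Definition noise (R : realType) (J : eqType) : Type :=
  g_sigma_algebraType (@cylinder R J).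
HB.instance Definition _ (R : realType) (J : eqType) :=
  Measurable.on (@noise R J).

Definition iid_normal (R : realType) (J : eqType) (disp : measure_display)
    (Omega : measurableType disp) (P : probability Omega R)
    (zeta : J -> {RV P >-> R}) : Prop :=
  independent_on setT zeta /\ forall j, has_normal_law P (zeta j) 0 1.

Section noise_measurability.
Context (R : realType) (J : eqType).

Lemma measurable_noise (disp : measure_display) (T : measurableType disp)
    (f : T -> noise R J) :
  (forall j, measurable_fun setT (fun x => f x j)) -> measurable_fun setT f.
Proof.
move=> mf; refine (@measurability _ _ T (noise R J) setT f (@cylinder R J) _ _) => //.
move=> _ [_ [s [B [mB ->]] <-]]; rewrite setTI.
have -> : f @^-1` [set z | forall j, j \in s -> B j (z j)] =
    \bigcap_(j in [set` s]) ((fun x => f x j) @^-1` B j).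
  by apply/seteqP; split => x /= H j js; exact: (H j js).
apply: fin_bigcap_measurable => // j _.
by rewrite -[X in measurable X]setTI; exact: mf.
Qed.

Lemma measurable_coord (j : J) :
  measurable_fun setT (fun z : noise R J => z j : R).
Proof.
move=> _ B mB; rewrite setTI; apply: sub_sigma_algebra.
exists [:: j], (fun _ => B); split => //.
by apply/seteqP; split => z /= H; [move=> i; rewrite inE => /eqP ->|apply: H; rewrite inE].
Qed.

Lemma cylinder_setI_closed : setI_closed (@cylinder R J).
Proof.
move=> _ _ [s [B [mB ->]]] [t [D [mD ->]]].
exists (s ++ t), (fun j => (if j \in s then B j else setT) `&`
                          (if j \in t then D j else setT)); split.
  by move=> j; apply: measurableI; case: ifP.
apply/seteqP; split => z /=.
  move=> [Hs Ht] j _; split; case: ifP => //; [exact: Hs|exact: Ht].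
move=> H; split => j js; have := H j; rewrite mem_cat js ?orbT => /(_ isT) [];
  by [].
Qed.

Lemma cylinderT : @cylinder R J setT.
Proof.
by exists [::], (fun _ => setT); split => //; apply/seteqP; split => z.
Qed.

(** Cylinders are stable under intersection and include the whole space, so they determine a finite
    measure. *)
Lemma noise_measure_unique (m1 m2 : {measure set (noise R J) -> \bar R}) :
  (m1 setT < +oo)%E ->
  (forall C, cylinder C -> m1 C = m2 C) ->
  forall C, measurable C -> m1 C = m2 C.
Proof.
move=> m1oo m12 C mC.
refine (@measure_unique _ R (noise R J) (@cylinder R J) (fun _ => setT) _ _ _ _ m1 m2 m12 _ C mC) => //.
- exact: cylinder_setI_closed.
- by move=> _; exact: cylinderT.
- by apply/seteqP; split => // x _; exists 0%N.
Qed.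

End noise_measurability.

Section restricted_law.
Context (R : realType) (disp disp' : measure_display)
  (Omega : measurableType disp) (T : measurableType disp').
Variables (P : probability Omega R) (Y : {mfun Omega >-> T}) (E : set Omega).
Hypothesis mE : measurable E.

(** Fixing the event [E] turns a joint probability into a measure in [C], to which uniqueness on
    cylinders applies. *)
Definition restricted_law (mE : measurable E) (C : set T) : \bar R :=
  P (Y @^-1` C `&` E).

Let restricted_law0 : restricted_law mE set0 = 0%E.
Proof. by rewrite /restricted_law preimage_set0 set0I measure0. Qed.

Let restricted_law_ge0 C : (0 <= restricted_law mE C)%E.
Proof. exact: (measure_ge0 (mrestr P mE)). Qed.

Let restricted_law_sigma_additive : semi_sigma_additive (restricted_law mE).
Proof.
exact: (@measure_semi_sigma_additive _ _ _ (pushforward (mrestr P mE) Y)).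
Qed.

HB.instance Definition _ := isMeasure.Build _ _ _ (restricted_law mE)
  restricted_law0 restricted_law_ge0 restricted_law_sigma_additive.

Lemma restricted_law_lty : (restricted_law mE setT < +oo)%E.
Proof.
by rewrite /restricted_law preimage_setT setTI (le_lt_trans (probability_le1 _ mE)) ?ltry.
Qed.

End restricted_law.

Section noise_of_rvs.
Context (R : realType) (disp : measure_display) (Omega : measurableType disp).
Context (P : probability Omega R).

Definition noise_of (J : eqType) (zeta : J -> {RV P >-> R}) (w : Omega) :
  noise R J := fun j => zeta j w.

Let measurable_noise_of (J : eqType) (zeta : J -> {RV P >-> R}) :
  measurable_fun setT (noise_of zeta).
Proof. by apply: measurable_noise => j; exact: measurable_funPT. Qed.

HB.instance Definition _ (J : eqType) (zeta : J -> {RV P >-> R}) :=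
  isMeasurableFun.Build _ _ _ _ (noise_of zeta) (measurable_noise_of zeta).

Lemma independent_on_comp (J I : eqType) (D : set I) (zeta : I -> {RV P >-> R})
    (iota : J -> I) :
  injective iota -> (forall j, D (iota j)) -> independent_on D zeta ->
  independent_on setT (zeta \o iota).
Proof.
move=> iI Di ind s B us _ mB.
(* [B'] prescribes [B j] at [iota j] and is the whole line off the image of [iota]; injectivity
   makes this consistent. *)
pose B' i := [set y | forall j, iota j = i -> B j y].
have B'E j : B' (iota j) = B j.
  by apply/seteqP; split => y /=; [exact|move=> By k /iI ->].
have mB' i : measurable (B' i).
  have [[j <-]|ni] := pselect (exists j, iota j = i); first by rewrite B'E.
  rewrite [B' i](_ : _ = setT)//; apply/seteqP; split => // y _ j ji.
  by exfalso; apply: ni; exists j.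
have := ind (map iota s) B'; rewrite map_inj_uniq// us => /(_ isT).
have H i : i \in map iota s -> D i by move=> /mapP[j _ ->].
move=> /(_ H mB'); rewrite big_map => E.
transitivity (P [set w | forall i, i \in map iota s -> B' i (zeta i w)]).
  congr (P _); apply/seteqP; split => w /=.
    by move=> Hw i /mapP[j js ->]; rewrite B'E; exact: Hw.
  by move=> Hw j js; rewrite -B'E; apply: Hw; exact: map_f.
by rewrite E; apply: eq_bigr => j _; rewrite B'E.
Qed.

Lemma iid_normal_comp (J I : eqType) (zeta : I -> {RV P >-> R}) (iota : J -> I) :
  injective iota -> iid_normal zeta -> iid_normal (zeta \o iota).
Proof.
move=> iI [ind law]; split; last by move=> j; exact: law.
exact: (independent_on_comp iI _ ind).
Qed.

(** The indices of a cylinder may repeat, whereas independence is stated for distinct ones, hence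
    [undup]. *)
Lemma independent_on_cylinder (J : eqType) (zeta : J -> {RV P >-> R})
    (s : seq J) (B : J -> set R) :
  independent_on setT zeta -> (forall j, measurable (B j)) ->
  P (noise_of zeta @^-1` [set z | forall j, j \in s -> B j (z j)]) =
  (\prod_(j <- undup s) P (zeta j @^-1` B j))%E.
Proof.
move=> ind mB; rewrite -ind ?undup_uniq//; congr (P _).
by apply/seteqP; split => w /= H j; have := H j; rewrite mem_undup.
Qed.

Let mnoise (J : eqType) (zeta : J -> {RV P >-> R}) C : measurable C ->
  measurable (noise_of zeta @^-1` C).
Proof.
by move=> mC; rewrite -[X in measurable X]setTI; exact: measurable_noise_of.
Qed.

(* Dynkin's argument, run once on each factor. *)
Lemma noise_independent (J1 J2 : eqType) (zeta : J1 + J2 -> {RV P >-> R})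
    (C1 : set (noise R J1)) (C2 : set (noise R J2)) :
  independent_on setT zeta -> measurable C1 -> measurable C2 ->
  P (noise_of (zeta \o inl) @^-1` C1 `&` noise_of (zeta \o inr) @^-1` C2) =
  (P (noise_of (zeta \o inl) @^-1` C1) * P (noise_of (zeta \o inr) @^-1` C2))%E.
Proof.
move=> ind mC1 mC2.
have indl : independent_on setT (zeta \o inl).
  by apply: (independent_on_comp _ _ ind) => // x y [].
have indr : independent_on setT (zeta \o inr).
  by apply: (independent_on_comp _ _ ind) => // x y [].
have key D1 D2 : cylinder D1 -> cylinder D2 ->
  P (noise_of (zeta \o inl) @^-1` D1 `&` noise_of (zeta \o inr) @^-1` D2) =
  (P (noise_of (zeta \o inl) @^-1` D1) * P (noise_of (zeta \o inr) @^-1` D2))%E.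
  move=> [s1 [B1 [mB1 ->]]] [s2 [B2 [mB2 ->]]].
  rewrite !independent_on_cylinder//.
  pose s := map inl (undup s1) ++ map inr (undup s2) : seq (J1 + J2).
  pose B (j : J1 + J2) := match j with inl a => B1 a | inr b => B2 b end.
  have us : uniq s.
    have il : injective (@inl J1 J2) by move=> ? ? [].
    have ir : injective (@inr J1 J2) by move=> ? ? [].
    rewrite cat_uniq !map_inj_uniq// !undup_uniq andbT/=.
    by apply/hasP => -[_ /mapP[b _ ->] /mapP[a _]].
  have mB j : measurable (B j) by case: j.
  have := ind s B us (fun _ _ => I) mB; rewrite big_cat !big_map => <-.
  congr (P _); apply/seteqP; split => w /=.
    move=> [H1 H2] j; rewrite mem_cat => /orP[] /mapP[i].
      by rewrite mem_undup => /H1 ? ->.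
    by rewrite mem_undup => /H2 ? ->.
  move=> H; split => j js.
    by apply: (H (inl j)); rewrite mem_cat map_f ?mem_undup.
  by apply: (H (inr j)); rewrite mem_cat map_f ?mem_undup ?orbT.
pose E2 := noise_of (zeta \o inr) @^-1` C2.
have mE2 : measurable E2 by exact: mnoise.
pose m1 := restricted_law P (noise_of (zeta \o inl)) mE2.
pose m2 := mscale (NngNum (fine_ge0 (measure_ge0 P E2)))
             (distribution P (noise_of (zeta \o inl))).
have m2E D : m2 D = (P E2 * P (noise_of (zeta \o inl) @^-1` D))%E.
  by rewrite /m2 /mscale/= fineK// fin_num_measure.
suff : m1 C1 = m2 C1 by rewrite m2E muleC.
apply: noise_measure_unique => //.
  exact: restricted_law_lty.
move=> D1 cD1; rewrite -[RHS]/(m2 D1) m2E muleC {C1 mC1 m1 m2 m2E}.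
have mD1 : measurable (D1 : set (noise R J1)) by exact: sub_sigma_algebra.
pose E1 := noise_of (zeta \o inl) @^-1` D1.
have mE1 : measurable E1 by exact: mnoise.
pose m1 := restricted_law P (noise_of (zeta \o inr)) mE1.
pose m2 := mscale (NngNum (fine_ge0 (measure_ge0 P E1)))
             (distribution P (noise_of (zeta \o inr))).
have m2E D : m2 D = (P E1 * P (noise_of (zeta \o inr) @^-1` D))%E.
  by rewrite /m2 /mscale/= fineK// fin_num_measure.
suff : m1 C2 = m2 C2.
  by rewrite m2E /m1 /restricted_law setIC.
apply: noise_measure_unique => //.
  exact: restricted_law_lty.
move=> D2 cD2; rewrite -[RHS]/(m2 D2) m2E -[LHS]/(m1 D2) /m1 /restricted_law setIC.
exact: key.
Qed.

End noise_of_rvs.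

Lemma noise_law_unique (R : realType) (J : eqType)
    (disp disp' : measure_display) (Omega : measurableType disp)
    (Omega' : measurableType disp')
    (P : probability Omega R) (P' : probability Omega' R)
    (zeta : J -> {RV P >-> R}) (zeta' : J -> {RV P' >-> R}) (C : set (noise R J)) :
  iid_normal zeta -> iid_normal zeta' -> measurable C ->
  P (noise_of zeta @^-1` C) = P' (noise_of zeta' @^-1` C).
Proof.
move=> [ind law] [ind' law'] mC.
apply: (@noise_measure_unique _ _ (distribution P (noise_of zeta))
                           (distribution P' (noise_of zeta'))) => //.
  by rewrite /= /distribution /pushforward preimage_setT probability_setT ltry.
move=> _ [s [B [mB ->]]].
apply: etrans (independent_on_cylinder s ind mB) _.
apply: etrans (esym (independent_on_cylinder s ind' mB)).
by apply: eq_bigr => j _; rewrite law// law'.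
Qed.

(** * Integration against two independent maps *)

Section independent_maps.
Context (R : realType) (disp d1 d2 : measure_display)
  (Omega : measurableType disp) (T1 : measurableType d1)
  (T2 : measurableType d2).
Variables (P : probability Omega R) (Y1 : {mfun Omega >-> T1})
  (Y2 : {mfun Omega >-> T2}).
Hypothesis ind12 : forall C1 C2, measurable C1 -> measurable C2 ->
  P (Y1 @^-1` C1 `&` Y2 @^-1` C2) = (P (Y1 @^-1` C1) * P (Y2 @^-1` C2))%E.

Let Y (w : Omega) := (Y1 w, Y2 w).

Let mY : measurable_fun setT Y.
Proof. by apply: measurable_fun_pair; exact: measurable_funPT. Qed.

HB.instance Definition _ := isMeasurableFun.Build _ _ _ _ Y mY.

(** Independence identifies the joint law with the product of the two laws, and Tonelli gives the
    iterated integral. *)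
Lemma ge0_integral_independent (F : T1 * T2 -> \bar R) :
  measurable_fun setT F -> (forall x, 0 <= F x)%E ->
  (\int[P]_w F (Y1 w, Y2 w) =
   \int[P]_w \int[P]_w' F (Y1 w, Y2 w'))%E.
Proof.
move=> mF F0.
transitivity (\int[distribution P Y]_y F y)%E.
  by rewrite ge0_integral_distribution.
transitivity (\int[distribution P Y1 \x distribution P Y2]_y F y)%E.
  apply: eq_measure_integral => A mA _; apply/esym.
  exact: product_measure_unique.
rewrite fubini_tonelli1//.
rewrite ge0_integral_distribution//=.
- apply: eq_integral => w _; rewrite /fubini_F ge0_integral_distribution//.
  exact: measurableT_comp.
- exact: measurable_fun_fubini_tonelli_F.
- by move=> x; exact: integral_ge0.
Qed.

End independent_maps.

(** * The standard normal law *)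

Section std_normal.
Context (R : realType).

(* [normal_prob] lives on the copy [measurableTypeR R] of [R]; this is the same
   measure on [R] itself. *)
Definition std_normal : set R -> \bar R := normal_prob 0 1.

Let std_normal0 : std_normal set0 = 0%E. Proof. exact: measure0. Qed.

Let std_normal_ge0 A : (0 <= std_normal A)%E. Proof. exact: measure_ge0. Qed.

Let std_normal_sigma_additive : semi_sigma_additive std_normal.
Proof.
move=> F mF tF mU.
exact: (@measure_semi_sigma_additive _ _ _ (normal_prob 0 1)).
Qed.

HB.instance Definition _ := isMeasure.Build _ R R std_normal
  std_normal0 std_normal_ge0 std_normal_sigma_additive.

Let std_normalT : std_normal setT = 1%E. Proof. exact: probability_setT. Qed.

HB.instance Definition _ :=
  @Measure_isProbability.Build _ R R std_normal std_normalT.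

Lemma ge0_integral_std_normal (disp : measure_display)
    (Omega : measurableType disp) (P : probability Omega R)
    (X : {RV P >-> R}) (f : R -> \bar R) :
  has_normal_law P X 0 1 -> measurable_fun setT f -> (forall y, 0 <= f y)%E ->
  (\int[P]_w f (X w) = \int[std_normal]_y f y)%E.
Proof.
move=> XN mf f0.
rewrite -[LHS](@ge0_integral_distribution _ _ _ _ _ P X f)//.
apply: eq_measure_integral => A mA _.
by have := XN A mA; rewrite oner_eq0.
Qed.

End std_normal.

(** * The branching Markov chain of field values *)

Section offspring_operator.
Context (R : realType) (rho c h : R).

(** Mean of [f] at one child of a vertex of value [a], counted when the child's value is at least
    [h]. The number of children is not included. *)
Definition offspring (f : R -> \bar R) (a : R) : \bar R :=
  (\int[@std_normal R]_y
     (if (h <= rho * a + c * y)%R then f (rho * a + c * y)%R else 0))%E.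

End offspring_operator.

Section branching.
Context (R : realType) (b : nat) (rho c h : R).
Context (disp : measure_display) (Omega : measurableType disp).
Variables (P : probability Omega R) (zeta : seq 'I_b -> {RV P >-> R}).
Hypothesis iid : iid_normal zeta.

Local Notation words := (seq 'I_b).
Local Notation N := (noise R words).

(** A state [(a, z)] consists of the value [a] at the parent of the root and the noise [z] of the
    whole subtree: given [a], the root itself is still random. *)
Definition root_value (a : R) (z : N) : R := rho * a + c * z [::].

(** Words are read from the vertex up to the root, so the branch taken at the root is the last
    letter. *)
Definition subnoise (i : 'I_b) (z : N) : N := fun u => z (rcons u i).

Definition averaged (F : R * N -> \bar R) (a : R) : \bar R :=
  (\int[P]_w F (a, noise_of zeta w))%E.

Lemma measurable_reindex (J K : eqType) (g : J -> K) :
  measurable_fun setT (fun z : noise R K => (fun j => z (g j)) : noise R J).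
Proof. by apply: measurable_noise => j; exact: measurable_coord. Qed.

Lemma measurable_root_value :
  measurable_fun setT (fun x : R * N => root_value x.1 x.2).
Proof.
apply: measurable_funD; apply: measurable_funM => //.
by apply: measurableT_comp (measurable_coord _) _.
Qed.

Lemma measurable_averaged F : measurable_fun setT F -> (forall x, 0 <= F x)%E ->
  measurable_fun setT (averaged F).
Proof.
move=> mF F0.
rewrite (_ : averaged F = fubini_F (distribution P (noise_of zeta)) F).
  exact: measurable_fun_fubini_tonelli_F.
apply/funext => a; rewrite /averaged /fubini_F ge0_integral_distribution//.
exact: measurableT_comp.
Qed.

Lemma measurable_at (F : R * N -> \bar R) a : measurable_fun setT F ->
  measurable_fun setT (fun w => F (a, noise_of zeta w)).
Proof.
move=> mF; apply: (measurableT_comp mF); exact: measurable_fun_pair.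
Qed.

Lemma averaged_le (F G : R * N -> \bar R) a a' :
  measurable_fun setT F -> (forall x, 0 <= F x)%E -> measurable_fun setT G ->
  (forall z, F (a, z) <= G (a', z))%E -> (averaged F a <= averaged G a')%E.
Proof.
by move=> mF F0 mG FG; apply: ge0_le_integral => //; exact: measurable_at.
Qed.

Lemma averagedD (F G : R * N -> \bar R) a :
  measurable_fun setT F -> (forall x, 0 <= F x)%E ->
  measurable_fun setT G -> (forall x, 0 <= G x)%E ->
  (averaged (fun x => F x + G x) a = averaged F a + averaged G a)%E.
Proof.
by move=> mF F0 mG G0; rewrite /averaged ge0_integralD//; exact: measurable_at.
Qed.

Lemma averagedZl k (F : R * N -> \bar R) a : (0 <= k)%E ->
  measurable_fun setT F -> (forall x, 0 <= F x)%E ->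
  (averaged (fun x => k * F x) a = k * averaged F a)%E.
Proof.
by move=> k0 mF F0; rewrite /averaged ge0_integralZl//; exact: measurable_at.
Qed.

Lemma averaged_sum (I : Type) (s : seq I) (F : I -> R * N -> \bar R) a :
  (forall i, measurable_fun setT (F i)) -> (forall i x, 0 <= F i x)%E ->
  (averaged (fun x => \sum_(i <- s) F i x) a = \sum_(i <- s) averaged (F i) a)%E.
Proof.
move=> mF F0; rewrite /averaged ge0_integral_sum// => i; exact: measurable_at.
Qed.

Lemma averaged_cst k a : averaged (cst k) a = k.
Proof.
rewrite [LHS](integral_cst P measurableT k) -[RHS]mule1.
by congr (_ * _)%E; exact: probability_setT.
Qed.

Lemma averaged_ge0 F a : (forall x, 0 <= F x)%E -> (0 <= averaged F a)%E.
Proof. by move=> F0; exact: integral_ge0. Qed.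

(** The noise off the root, indexed by the branch at the root and the word inside it. *)
Let rest (p : 'I_b * words) : {RV P >-> R} := zeta (rcons p.2 p.1).

Let subrest (i : 'I_b) (y : noise R ('I_b * words)%type) : N := fun u => y (i, u).

Let integral_root_rest (H : R * noise R ('I_b * words)%type -> \bar R) :
  measurable_fun setT H -> (forall x, 0 <= H x)%E ->
  (\int[P]_w H (zeta [::] w, noise_of rest w) =
   \int[@std_normal R]_y \int[P]_w H (y, noise_of rest w))%E.
Proof.
move=> mH H0.
pose iota (j : unit + 'I_b * words) : words :=
  match j with inl _ => [::] | inr p => rcons p.2 p.1 end.
have iI : injective iota.
  move=> [[]|[i u]] [[]|[l v]]//=.
  - by move=> /(congr1 size); rewrite size_rcons.
  - by move=> /(congr1 size); rewrite size_rcons.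
  - by move=> /rcons_inj[-> ->].
have [ind _] := iid_normal_comp iI iid.
rewrite (@ge0_integral_independent _ _ _ _ _ _ _ P (zeta [::]) (noise_of rest))//; last first.
  move=> C1 C2 mC1 mC2.
  have := @noise_independent _ _ _ P _ _ _ [set z | C1 (z tt)] C2 ind _ mC2.
  apply; rewrite -[X in measurable X]setTI; exact: measurable_coord.
rewrite (ge0_integral_std_normal (iid.2 [::]) (f := fun y => \int[P]_w H (y, noise_of rest w))%E)//.
- rewrite (_ : (fun y => _) = fubini_F (distribution P (noise_of rest)) H).
    exact: measurable_fun_fubini_tonelli_F.
  apply/funext => a; rewrite /fubini_F ge0_integral_distribution//.
  exact: measurableT_comp.
- by move=> y; exact: integral_ge0.
Qed.

(** The words ending in [i] carry again a family of independent normal variables, so the noise of a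
    branch has the law of the full noise. *)
Lemma averaged_subnoise F i x : measurable_fun setT F -> (forall y, 0 <= F y)%E ->
  (\int[P]_w F (x, subnoise i (noise_of zeta w)) = averaged F x)%E.
Proof.
move=> mF F0.
have iI : injective (fun u : words => rcons u i) by move=> u v /rcons_inj[].
pose zeta' u := zeta (rcons u i).
have iid' : iid_normal zeta' by exact: (iid_normal_comp iI iid).
rewrite /averaged.
have mFx : measurable_fun setT (fun z : N => F (x, z)) by exact: measurableT_comp.
rewrite -(@ge0_integral_distribution _ _ _ _ _ P (noise_of zeta) (fun z => F (x, z)))//.
rewrite -[LHS](@ge0_integral_distribution _ _ _ _ _ P (noise_of zeta') (fun z => F (x, z)))//.
by apply: eq_measure_integral => A mA _; exact: (noise_law_unique iid' iid mA).
Qed.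

(** Words ending in [i] and words ending in [l] are disjoint, so the noises of the two branches are
    independent. *)
Lemma averaged_subnoise2 F G i l x : i != l ->
  measurable_fun setT F -> (forall y, 0 <= F y)%E ->
  measurable_fun setT G -> (forall y, 0 <= G y)%E ->
  (\int[P]_w (F (x, subnoise i (noise_of zeta w)) *
              G (x, subnoise l (noise_of zeta w))) =
   averaged F x * averaged G x)%E.
Proof.
move=> il mF F0 mG G0.
pose iota (j : words + words) : words :=
  match j with inl u => rcons u i | inr u => rcons u l end.
have iI : injective iota.
  move=> [u|u] [v|v]//= /rcons_inj[-> // e].
  - by rewrite e eqxx in il.
  - by rewrite e eqxx in il.
have [ind _] := iid_normal_comp iI iid.
pose zi u := zeta (rcons u i); pose zl u := zeta (rcons u l).
have mF1 : measurable_fun setT (fun z : N => F (x, z)) by exact: measurableT_comp.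
have mG1 : measurable_fun setT (fun z : N => G (x, z)) by exact: measurableT_comp.
pose H (y : N * N) := (F (x, y.1) * G (x, y.2))%E.
have mH : measurable_fun setT H.
  apply: emeasurable_funM.
    exact: (measurableT_comp mF1 measurable_fst).
  exact: (measurableT_comp mG1 measurable_snd).
rewrite [LHS](@ge0_integral_independent _ _ _ _ _ _ _ P (noise_of zi) (noise_of zl) _ H mH)//.
- transitivity (\int[P]_w (F (x, noise_of zi w) * averaged G x))%E.
    apply: eq_integral => w _; rewrite /H/= ge0_integralZl//.
    + by congr (_ * _)%E; exact: averaged_subnoise.
    + exact: (measurableT_comp mG1).
  rewrite ge0_integralZr ?averaged_ge0//.
  + by congr (_ * _)%E; exact: averaged_subnoise.
  + exact: (measurableT_comp mF1).
- by move=> C1 C2 mC1 mC2; exact: (@noise_independent _ _ _ P _ _ (zeta \o iota)).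
- by move=> y; rewrite mule_ge0.
Qed.

Definition child (i : 'I_b) (x : R * N) : R * N :=
  (root_value x.1 x.2, subnoise i x.2).

Lemma measurable_child i : measurable_fun setT (child i).
Proof.
apply: measurable_fun_pair; first exact: measurable_root_value.
exact: (measurableT_comp (measurable_reindex _)).
Qed.

(** Branching property: given the value at the root, two distinct branches are independent copies
    started from that value. *)
Lemma averaged_child2 F G i l a : i != l ->
  measurable_fun setT F -> (forall y, 0 <= F y)%E ->
  measurable_fun setT G -> (forall y, 0 <= G y)%E ->
  averaged (fun x => if (h <= root_value x.1 x.2)%R
                     then F (child i x) * G (child l x) else 0)%E a =
  offspring rho c h (fun x => averaged F x * averaged G x)%E a.
Proof.
move=> il mF F0 mG G0.
pose H (x : R * noise R ('I_b * words)%type) :=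
  (if (h <= rho * a + c * x.1)%R then F (rho * a + c * x.1, subrest i x.2)%R *
     G (rho * a + c * x.1, subrest l x.2)%R else 0)%E.
have mx : measurable_fun setT
    (fun x : R * noise R ('I_b * words)%type => rho * a + c * x.1).
  by apply: measurable_funD => //; apply: measurable_funM.
have mH : measurable_fun setT H.
  apply: measurable_fun_ifT => //; first exact: measurable_fun_ler.
  apply: emeasurable_funM.
    apply: (measurableT_comp mF); apply: measurable_fun_pair => //.
    exact: (measurableT_comp (measurable_reindex _)).
  apply: (measurableT_comp mG); apply: measurable_fun_pair => //.
  exact: (measurableT_comp (measurable_reindex _)).
have H0 x : (0 <= H x)%E by rewrite /H; case: ifP => // _; rewrite mule_ge0.
rewrite /averaged [LHS](integral_root_rest mH H0) /offspring.
apply: eq_integral => y _; rewrite /H/=; case: ifP => _; last by rewrite integral0.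
exact: averaged_subnoise2.
Qed.

Lemma averaged_child F i a :
  measurable_fun setT F -> (forall y, 0 <= F y)%E ->
  averaged (fun x => if (h <= root_value x.1 x.2)%R
                     then F (child i x) else 0)%E a =
  offspring rho c h (averaged F) a.
Proof.
move=> mF F0.
pose H (x : R * noise R ('I_b * words)%type) :=
  (if (h <= rho * a + c * x.1)%R then F (rho * a + c * x.1, subrest i x.2)%R
   else 0)%E.
have mx : measurable_fun setT
    (fun x : R * noise R ('I_b * words)%type => rho * a + c * x.1).
  by apply: measurable_funD => //; apply: measurable_funM.
have mH : measurable_fun setT H.
  apply: measurable_fun_ifT => //; first exact: measurable_fun_ler.
  apply: (measurableT_comp mF); apply: measurable_fun_pair => //.
  exact: (measurableT_comp (measurable_reindex _)).
have H0 x : (0 <= H x)%E by rewrite /H; case: ifP.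
rewrite /averaged [LHS](integral_root_rest mH H0) /offspring.
apply: eq_integral => y _; rewrite /H/=; case: ifP => _; last by rewrite integral0.
exact: averaged_subnoise.
Qed.

End branching.

(** * Linearity, monotonicity and positivity of the offspring operator *)

Section offspring_theory.
Context (R : realType) (rho c h : R).
Hypotheses (rho0 : 0 < rho) (c0 : 0 < c).
Implicit Types f g : R -> \bar R.

Local Notation Q := (offspring rho c h).

Let integrand f a y : \bar R :=
  if (h <= rho * a + c * y)%R then f (rho * a + c * y) else 0%E.

Let integrand_ge0 f a y : (forall x, 0 <= f x)%E -> (0 <= integrand f a y)%E.
Proof. by move=> f0; rewrite /integrand; case: ifP. Qed.

Let measurable_integrand f : measurable_fun setT f ->
  measurable_fun setT (fun x : R * R => integrand f x.1 x.2).
Proof.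
move=> mf.
have mx : measurable_fun setT (fun x : R * R => rho * x.1 + c * x.2).
  by apply: measurable_funD; apply: measurable_funM.
apply: measurable_fun_ifT => //; first exact: measurable_fun_ler.
exact: (measurableT_comp mf mx).
Qed.

Let measurable_integrand1 f a : measurable_fun setT f ->
  measurable_fun setT (integrand f a).
Proof.
move=> mf; have mx : measurable_fun setT (fun y : R => rho * a + c * y).
  by apply: measurable_funD => //; exact: measurable_funM.
apply: measurable_fun_ifT => //; first exact: measurable_fun_ler.
exact: (measurableT_comp mf mx).
Qed.

Lemma offspring_ge0 f a : (forall x, 0 <= f x)%E -> (0 <= Q f a)%E.
Proof. by move=> f0; apply: integral_ge0 => y _; exact: integrand_ge0. Qed.

Lemma measurable_offspring f : measurable_fun setT f -> (forall x, 0 <= f x)%E ->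
  measurable_fun setT (Q f).
Proof.
move=> mf f0.
apply: (measurable_fun_fubini_tonelli_F (m2 := @std_normal R)
  (fun x : R * R => integrand f x.1 x.2)).
  exact: measurable_integrand.
by move=> x; exact: integrand_ge0.
Qed.

Lemma offspring_le f g a : measurable_fun setT f -> (forall x, 0 <= f x)%E ->
  measurable_fun setT g ->
  (forall x, (h <= x)%R -> f x <= g x)%E -> (Q f a <= Q g a)%E.
Proof.
move=> mf f0 mg fg; apply: ge0_le_integral => //.
- by move=> y _; exact: integrand_ge0.
- exact: measurable_integrand1.
- exact: measurable_integrand1.
- by move=> y _; case: ifP => // /fg.
Qed.

(** Raising [a] moves every child value upwards: the event of reaching [h] grows, and so does [f] on
    it. Only the values of [f] above [h] enter. *)
Lemma offspring_nondecreasing f a a' :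
  measurable_fun setT f -> (forall x, 0 <= f x)%E ->
  (forall x x', (h <= x)%R -> (x <= x')%R -> f x <= f x')%E ->
  (a <= a')%R -> (Q f a <= Q f a')%E.
Proof.
move=> mf f0 nf aa'; apply: ge0_le_integral => //.
- by move=> y _; exact: integrand_ge0.
- exact: measurable_integrand1.
- exact: measurable_integrand1.
- move=> y _.
  have le : rho * a + c * y <= rho * a' + c * y.
    by rewrite lerD2r ler_wpM2l// ltW.
  case: ifP => [hy|_]; last exact: integrand_ge0.
  by rewrite (le_trans hy le) nf.
Qed.

Lemma offspringD f g a : measurable_fun setT f -> (forall x, 0 <= f x)%E ->
  measurable_fun setT g -> (forall x, 0 <= g x)%E ->
  (Q (fun x => f x + g x) a = Q f a + Q g a)%E.
Proof.
move=> mf f0 mg g0; rewrite /offspring -ge0_integralD//.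
- by apply: eq_integral => y _; case: ifP; rewrite ?adde0.
- by move=> y _; exact: integrand_ge0.
- exact: measurable_integrand1.
- by move=> y _; exact: integrand_ge0.
- exact: measurable_integrand1.
Qed.

Lemma offspringZl k f a : (0 <= k)%E -> measurable_fun setT f ->
  (forall x, 0 <= f x)%E -> (Q (fun x => k * f x) a = k * Q f a)%E.
Proof.
move=> k0 mf f0; rewrite /offspring -ge0_integralZl//.
- by apply: eq_integral => y _; case: ifP; rewrite ?mule0.
- exact: measurable_integrand1.
- by move=> y _; exact: integrand_ge0.
Qed.

Lemma offspring_sum (I : Type) (s : seq I) (f : I -> R -> \bar R) a :
  (forall i, measurable_fun setT (f i)) -> (forall i x, 0 <= f i x)%E ->
  (Q (fun x => \sum_(i <- s) f i x) a = \sum_(i <- s) Q (f i) a)%E.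
Proof.
move=> mf f0; rewrite /offspring -ge0_integral_sum//.
- apply: eq_integral => y _; case: ifP => // _.
  by rewrite big1.
- by move=> i; exact: measurable_integrand1.
- by move=> i y _; exact: integrand_ge0.
Qed.

Lemma measurable_set_ge (x : R) (a : R) : measurable [set y : R | x <= rho * a + c * y].
Proof.
rewrite (_ : [set y | _] = `[(x - rho * a) / c, +oo[%classic)//.
apply/seteqP; split => y /=; rewrite in_itv/= andbT ler_pdivrMr// lerBlDl;
  by rewrite (mulrC y).
Qed.

Lemma offspring_cst r a : (0 <= r)%E ->
  (Q (cst r) a = r * @std_normal R [set y | h <= rho * a + c * y]%R)%E.
Proof.
move=> r0.
rewrite -(integral_cst (@std_normal R) (measurable_set_ge h a)) /offspring.
rewrite [RHS]integral_mkcond.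
apply: eq_integral => y _; rewrite /patch; case: ifP => hy.
  by rewrite mem_set.
by rewrite memNset//= hy.
Qed.

Lemma std_normal_interval_gt0 (x y : R) : x < y ->
  (0 < @std_normal R `[x, y])%E.
Proof.
(* [M] bounds the absolute value of every point of the interval, so the density there is at least
   its value at [M]. *)
move=> xy; pose M := `|x| + `|y|.
pose e := @normal_pdf R 0 1 M.
have e0 : 0 < e.
  rewrite /e normal_pdfE ?oner_eq0// mulr_gt0 ?expR_gt0//.
  by rewrite normal_peak_gt0 ?oner_eq0.
apply: (@lt_le_trans _ _ (\int[lebesgue_measure]_(z in `[x, y]) e%:E)%E).
  rewrite integral_cst//= lebesgue_measure_itv/= lte_fin xy.
  by rewrite -EFinD -EFinM lte_fin mulr_gt0// subr_gt0.
rewrite /std_normal /normal_prob; apply: ge0_le_integral => //=.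
- by move=> z _; rewrite lee_fin ltW.
- apply/measurable_EFinP; apply: measurable_funTS; exact: measurable_normal_pdf.
- move=> z; rewrite in_itv/= => /andP[xz zy]; rewrite lee_fin /e.
  rewrite !normal_pdfE ?oner_eq0// ler_wpM2l ?normal_peak_ge0//.
  rewrite /normal_fun ler_expR ler_wpM2r ?invr_ge0 ?mulrn_wge0 ?sqr_ge0//.
  rewrite !subr0 lerN2 -[z ^+ 2]real_normK ?num_real// lerXn2r ?nnegrE//.
    by rewrite addr_ge0.
  rewrite /M ler_norml; have := ler_norm y; have := ler_norm (- x).
  have := normr_ge0 x; have := normr_ge0 y.
  by rewrite normrN => *; apply/andP; split; lra.
Qed.

Lemma std_normal_ge_gt0 (x a : R) :
  (0 < @std_normal R [set y | x <= rho * a + c * y]%R)%E.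
Proof.
have lt1 : (x - rho * a) / c < (x - rho * a) / c + 1 by rewrite ltrDl.
apply: lt_le_trans (std_normal_interval_gt0 lt1) _.
apply: le_measure; first by rewrite inE; exact: measurable_itv.
  by rewrite inE; exact: measurable_set_ge.
move=> y /=; rewrite in_itv/= => /andP[+ _].
by rewrite ler_pdivrMr// lerBlDl (mulrC y).
Qed.

Lemma offspring_le_cst f r a : measurable_fun setT f -> (forall x, 0 <= f x)%E ->
  (0 <= r)%R -> (forall x, f x <= r%:E)%E -> (Q f a <= r%:E)%E.
Proof.
move=> mf f0 r0 fr; apply: (@le_trans _ _ (Q (cst r%:E) a)).
  exact: offspring_le.
rewrite offspring_cst ?lee_fin// -[leRHS]mule1.
apply: lee_wpmul2l; first by rewrite lee_fin.
exact: (probability_le1 (@std_normal R) (measurable_set_ge _ _)).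
Qed.

End offspring_theory.

(** * Extinction *)

Lemma sume_cst_ord (R : realType) (n : nat) (x : \bar R) : (0 <= x)%E ->
  (\sum_(i < n) x = n%:R%:E * x)%E.
Proof.
move=> x0; elim: n => [|n ih]; first by rewrite big_ord0 mul0e.
by rewrite big_ord_recr/= ih -natr1 EFinD ge0_muleDl ?lee_fin// mul1e.
Qed.

Section extinction.
Context (R : realType) (b : nat) (rho c h : R).
Hypotheses (b1 : (1 < b)%N) (rho0 : 0 < rho) (c0 : 0 < c).
Context (disp : measure_display) (Omega : measurableType disp).
Variables (P : probability Omega R) (zeta : seq 'I_b -> {RV P >-> R}).
Hypothesis iid : iid_normal zeta.

Local Notation N := (noise R (seq 'I_b)).
Local Notation Q := (offspring rho c h).
Local Notation open x := (h <= root_value rho c x.1 x.2).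

(** The vertex of value [a] is generation 0 and counts as 1 whatever [a] is; [h] constrains only the
    later generations. *)
Fixpoint mean_size (n : nat) (a : R) : \bar R :=
  if n is n'.+1 then (b%:R%:E * Q (mean_size n') a)%E else 1%E.

(** While [mean_size] starts at the vertex of value [a], this follows a single branch below it, and
    [n] counts generations below the root of that branch. *)
Fixpoint alive (n : nat) (x : R * N) : bool :=
  open x && (if n is n'.+1 then [exists i, alive n' (child rho c i x)] else true).

Lemma mean_size_ge0 n a : (0 <= mean_size n a)%E.
Proof.
elim: n a => [//|n ih] a /=; apply: mule_ge0; first by rewrite lee_fin.
exact: offspring_ge0.
Qed.

Lemma measurable_mean_size n : measurable_fun setT (mean_size n).
Proof.
elim: n => [|n ih] /=; first exact: measurable_cst.
apply: measurable_funeM; apply: measurable_offspring => //.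
exact: mean_size_ge0.
Qed.

Lemma mean_size_nondecreasing n a a' : (a <= a')%R ->
  (mean_size n a <= mean_size n a')%E.
Proof.
elim: n a a' => [//|n ih] a a' aa' /=.
apply: lee_wpmul2l; first by rewrite lee_fin.
apply: offspring_nondecreasing => //; first exact: measurable_mean_size.
  exact: mean_size_ge0.
by move=> x x' _; exact: ih.
Qed.

Lemma measurable_open : measurable_fun setT (fun x : R * N => open x).
Proof. by apply: measurable_fun_ler => //; exact: measurable_root_value. Qed.

Lemma measurable_exists (d : measure_display) (T : measurableType d)
    (I : finType) (f : I -> T -> bool) :
  (forall i, measurable_fun setT (f i)) ->
  measurable_fun setT (fun x => [exists i, f i x]).
Proof.
move=> mf.
rewrite (_ : (fun x => _) = fun x => has (fun i => f i x) (enum I)).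
  elim: (enum I) => [|i s ih] /=; first exact: measurable_cst.
  exact: measurable_or.
apply/funext => x; apply/existsP/hasP => [[i fi]|[i _ fi]]; exists i => //.
by rewrite mem_enum.
Qed.

Lemma measurable_alive n : measurable_fun setT (alive n).
Proof.
elim: n => [|n ih] /=.
  by apply: measurable_and; [exact: measurable_open|exact: measurable_cst].
apply: measurable_and; first exact: measurable_open.
by apply: measurable_exists => i; exact: (measurableT_comp ih (measurable_child _ _ _)).
Qed.

Lemma alive_nondecreasing n a a' z : a <= a' -> alive n (a, z) -> alive n (a', z).
Proof.
elim: n a a' z => [|n ih] a a' z aa' /=.
  rewrite !andbT => /le_trans; apply.
  by rewrite /root_value lerD2r ler_wpM2l// ltW.
have le : root_value rho c a z <= root_value rho c a' z.
  by rewrite /root_value lerD2r ler_wpM2l// ltW.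
move=> /andP[/le_trans ->//] /= /existsP[i ai].
by apply/existsP; exists i; exact: ih ai.
Qed.

Lemma aliveS n x : alive n.+1 x -> alive n x.
Proof.
elim: n x => [|n ih] x; first by move=> /= /andP[->].
move=> /andP[/= -> /= /existsP[i ai]]; apply/existsP; exists i; exact: ih.
Qed.

Let ind n (x : R * N) : \bar R := (alive n x)%:R%:E.

Let ind_ge0 n x : (0 <= ind n x)%E. Proof. by rewrite lee_fin. Qed.

Let measurable_ind n : measurable_fun setT (ind n).
Proof.
rewrite (_ : ind n = fun x => if alive n x then 1%E else 0%E).
  by apply: measurable_fun_ifT => //; exact: measurable_alive.
by apply/funext => x; rewrite /ind; case: alive.
Qed.

Definition survival n := averaged zeta (ind n).

Let survival_ge0 n a : (0 <= survival n a)%E.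
Proof. exact: averaged_ge0. Qed.

Let measurable_survival n : measurable_fun setT (survival n).
Proof. exact: measurable_averaged. Qed.

Let survival_le1 n a : (survival n a <= 1)%E.
Proof.
rewrite -[leRHS](averaged_cst zeta 1%E a); apply: averaged_le => //.
by move=> z; rewrite lee_fin; case: alive.
Qed.

Let survival_nondecreasing n a a' : a <= a' -> (survival n a <= survival n a')%E.
Proof.
move=> aa'; apply: averaged_le => // z; rewrite lee_fin ler_nat.
by have := @alive_nondecreasing n a a' z aa'; case: alive => // /(_ isT) ->.
Qed.

(* Inclusion-exclusion truncated at two children. *)
Let survivalS n a :
  (survival n.+1 a + Q (fun x => survival n x * survival n x) a <=
   b%:R%:E * Q (survival n) a)%E.
Proof.
pose i0 : 'I_b := Ordinal (ltnW b1); pose i1 : 'I_b := Ordinal b1.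
pose F i x := (if open x then ind n (child rho c i x) else 0)%E.
pose G x := (if open x then ind n (child rho c i0 x) * ind n (child rho c i1 x)
             else 0)%E.
have F0 i x : (0 <= F i x)%E by rewrite /F; case: ifP.
have G0 x : (0 <= G x)%E by rewrite /G; case: ifP => // _; rewrite mule_ge0.
have mc i : measurable_fun setT (fun x => ind n (child rho c i x)).
  exact: (measurableT_comp _ (measurable_child _ _ _)).
have mF i : measurable_fun setT (F i).
  by apply: measurable_fun_ifT => //; exact: measurable_open.
have mG : measurable_fun setT G.
  apply: measurable_fun_ifT => //; first exact: measurable_open.
  exact: emeasurable_funM.
rewrite -(averaged_child2 rho c h iid (i := i0) (l := i1))// -/G.
rewrite -averagedD//.
have -> : (b%:R%:E * Q (survival n) a = averaged zeta (fun x => \sum_i F i x) a)%E.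
  rewrite averaged_sum//.
  under eq_bigr => i _ do rewrite /F averaged_child//.
  by rewrite sume_cst_ord//; apply: offspring_ge0 => x; exact: averaged_ge0.
apply: averaged_le => //.
- exact: emeasurable_funD.
- by move=> x; exact: adde_ge0.
- exact: emeasurable_sum.
move=> z; rewrite /F /G {1}/ind /=.
case: (h <= root_value rho c a z) => /=; last first.
  by rewrite adde0 sume_ge0.
rewrite /ind.
rewrite -EFinM -EFinD sumEFin lee_fin.
set f := fun i => alive n (child rho c i (a, z)).
have f0 i : 0 <= (f i)%:R :> R by rewrite ler0n.
rewrite (bigD1 i0)//= (bigD1 i1)//= -!/(f _).
case: existsP => [[i fi]|nex]; last first.
  have nf j : f j = false by apply/negP => fj; apply: nex; exists j.
  by rewrite !nf mul0r !add0r sumr_ge0.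
case: (boolP (f i0)) => [_|n0].
  by rewrite mul1r lerD2l lerDl sumr_ge0.
rewrite mul0r addr0 add0r; case: (boolP (f i1)) => [_|n1].
  by rewrite lerDl sumr_ge0.
rewrite add0r (bigD1 i) ?fi ?lerDl ?sumr_ge0//=.
by apply/andP; split; apply: contraTneq fi => ->.
Qed.

(* If survival to depth [n] from [h] had probability at least [sigma] for every [n],
   then iterating [survivalS] from generation [0] would make the mean size grow
   linearly. *)
Let mean_size_linear (kappa : R) : (0 <= kappa)%R ->
  (forall n a, (h <= a)%R ->
     kappa%:E <= Q (fun x => survival n x * survival n x) a)%E ->
  forall n a, (h <= a)%R ->
  (survival n a + kappa%:E * \sum_(j < n) mean_size j a <= mean_size n a)%E.
Proof.
move=> k0 kQ; elim=> [|n ih] a ha.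
  by rewrite big_ord0 mule0 adde0.
rewrite big_ord_recl/= ge0_muleDr//; last first.
  by apply: sume_ge0 => j _; apply: mule_ge0;
     [rewrite lee_fin|apply: offspring_ge0 => x; exact: mean_size_ge0].
rewrite mule1 addeA.
have -> : (kappa%:E * \sum_(j < n) b%:R%:E * Q (mean_size j) a =
  b%:R%:E * Q (fun x => kappa%:E * \sum_(j < n) mean_size j x) a)%E.
  rewrite offspringZl//; last 2 first.
    by apply: emeasurable_sum => j; exact: measurable_mean_size.
    by move=> x; apply: sume_ge0 => j _; exact: mean_size_ge0.
  rewrite offspring_sum; last 2 first.
    by move=> j; exact: measurable_mean_size.
    by move=> j x; exact: mean_size_ge0.
  rewrite [RHS]muleCA; congr (_ * _)%E; rewrite ge0_sume_distrr// => j _.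
  by apply: offspring_ge0 => x; exact: mean_size_ge0.
have mS : measurable_fun setT (fun x => kappa%:E * \sum_(j < n) mean_size j x)%E.
  apply: measurable_funeM.
  by apply: emeasurable_sum => j; exact: measurable_mean_size.
have S0 x : (0 <= kappa%:E * \sum_(j < n) mean_size j x)%E.
  by apply: mule_ge0 => //; apply: sume_ge0 => j _; exact: mean_size_ge0.
apply: (@le_trans _ _ (b%:R%:E * Q (survival n) a +
  b%:R%:E * Q (fun x => kappa%:E * \sum_(j < n) mean_size j x) a)%E).
  rewrite leeD2r//; apply: le_trans (survivalS n a).
  by rewrite leeD2l// kQ.
rewrite -ge0_muleDr ?offspring_ge0// -offspringD//.
apply: lee_wpmul2l; first by rewrite lee_fin.
apply: offspring_le => //.
- exact: emeasurable_funD.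
- by move=> x; exact: adde_ge0.
- exact: measurable_mean_size.
Qed.

Hypothesis subcritical : forall n, (mean_size n h <= 1)%E.

(** Suppose that survival from [h] stays at least [sigma]. A child of a vertex above [h] is above
    [h] with probability at least [q], so the pair correction is at least [kappa = sigma ^+ 2 * q]
    at each step. All earlier means are at least [sigma], so [mean_size n h] is at least
    [kappa * n * sigma], against the bound 1. *)
Lemma survival_at_threshold_small (sigma : R) : (0 < sigma)%R ->
  exists n, (survival n h < sigma%:E)%E.
Proof.
move=> s0; apply: contrapT => nex.
have sge n : (sigma%:E <= survival n h)%E.
  by rewrite leNgt; apply/negP => lt; apply: nex; exists n.
pose q := fine (@std_normal R [set y | h <= rho * h + c * y]).
have qE : @std_normal R [set y | h <= rho * h + c * y] = q%:E.
  by rewrite /q fineK// fin_num_measure//; exact: measurable_set_ge.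
have q0 : (0 < q)%R by rewrite -lte_fin -qE; exact: std_normal_ge_gt0.
pose kappa := (sigma ^+ 2 * q)%R.
have kappa0 : (0 < kappa)%R by rewrite mulr_gt0// exprn_gt0.
have lin := @mean_size_linear kappa (ltW kappa0).
have {lin}lin n : (kappa%:E * (n%:R%:E * sigma%:E) <= 1)%E.
  have kQ m a : (h <= a)%R ->
      (kappa%:E <= Q (fun x => survival m x * survival m x) a)%E.
    move=> ha; apply: (@le_trans _ _ (Q (cst (sigma ^+ 2)%:E) h)).
      by rewrite offspring_cst ?lee_fin ?sqr_ge0// qE -EFinM.
    pose s2 x := (survival m x * survival m x)%E.
    have ms2 : measurable_fun setT s2 by exact: emeasurable_funM.
    apply: (@le_trans _ _ (Q s2 h)); last first.
      apply: offspring_nondecreasing => //.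
        by move=> x; exact: mule_ge0.
      by move=> x x' _ xx'; apply: lee_pmul => //; exact: survival_nondecreasing.
    apply: offspring_le => //.
    - by move=> x; rewrite lee_fin sqr_ge0.
    - move=> x hx; rewrite /= expr2 EFinM /s2.
      have sx : (sigma%:E <= survival m x)%E.
        by rewrite (le_trans (sge m))// survival_nondecreasing.
      by apply: lee_pmul => //; rewrite lee_fin ltW.
  apply: le_trans (subcritical n); apply: le_trans (lin kQ n h (lexx h)).
  rewrite -[leLHS]add0e; apply: leeD => //.
  apply: lee_wpmul2l; first by rewrite lee_fin ltW.
  rewrite -sume_cst_ord; last by rewrite lee_fin ltW.
  apply: lee_sum => j _.
  apply: le_trans (sge j) _.
  apply: le_trans (lin kQ j h (lexx h)); rewrite leeDl//.
  apply: mule_ge0; first by rewrite lee_fin ltW.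
  by apply: sume_ge0 => i _; exact: mean_size_ge0.
have ks : (0 < kappa * sigma)%R by rewrite mulr_gt0.
have := lin (Num.truncn (kappa * sigma)^-1).+1.
rewrite -!EFinM lee_fin mulrCA -ler_pdivlMr// mul1r leNgt => /negP; apply.
exact: truncnS_gt.
Qed.

(** Below a vertex at [h], a child exceeds both [h] and [K] with a probability [p > 0]. So [p] times
    survival from [K] is at most survival from [h] one generation later, which transfers smallness
    from the threshold to any starting value. *)
Lemma extinction (K : R) :
  P [set w | forall n, alive n (K, noise_of zeta w)] = 0%E.
Proof.
have mA n : measurable [set w | alive n (K, noise_of zeta w)].
  rewrite -[X in measurable X]setTI.
  have mf : measurable_fun setT (fun w => alive n (K, noise_of zeta w)).
    apply: (measurableT_comp (measurable_alive n)).
    exact: measurable_fun_pair.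
  exact: (mf measurableT [set true]).
have sE n : survival n K = P [set w | alive n (K, noise_of zeta w)].
  rewrite /survival /averaged -[X in P X]setIT -integral_indic//.
  apply: eq_integral => w _; rewrite /ind indicE; congr (_%:R%:E).
  case: (boolP (alive _ _)) => aw; first by rewrite mem_set.
  by rewrite memNset//; exact/negP.
pose p := fine (@std_normal R [set y | Num.max h K <= rho * h + c * y]).
have pE : @std_normal R [set y | Num.max h K <= rho * h + c * y] = p%:E.
  by rewrite /p fineK// fin_num_measure//; exact: measurable_set_ge.
have p0 : (0 < p)%R by rewrite -lte_fin -pE; exact: std_normal_ge_gt0.
have sK n : (p%:E * survival n K <= survival n.+1 h)%E.
  pose i0 : 'I_b := Ordinal (ltnW b1).
  pose h' := Num.max h K.
  pose F x := (if (h' <= root_value rho c x.1 x.2)%R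
               then ind n (child rho c i0 x) else 0)%E.
  have mF : measurable_fun setT F.
    apply: measurable_fun_ifT => //.
      by apply: measurable_fun_ler => //; exact: measurable_root_value.
    exact: (measurableT_comp _ (measurable_child _ _ _)).
  apply: (@le_trans _ _ (averaged zeta F h)).
    rewrite averaged_child// muleC -pE -offspring_cst//.
    apply: offspring_le => //.
    - by move=> x; exact: survival_ge0.
    - exact: measurable_survival.
    - by move=> x; rewrite /h' ge_max => /andP[_ Kx]; exact: survival_nondecreasing.
  apply: averaged_le => //.
    by move=> x; rewrite /F; case: ifP.
  move=> z; rewrite /F; case: ifP => // h'x; rewrite /ind lee_fin ler_nat /=.
  have -> /= : h <= root_value rho c h z.
    by apply: le_trans h'x; rewrite /h' le_max lexx.
  case: (boolP (alive n _)) => // ai.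
  by have -> : [exists i, alive n (child rho c i (h, z))] by apply/existsP; exists i0.
apply/eqP; rewrite eq_le measure_ge0 andbT.
apply/lee_addgt0Pr => e e0; rewrite add0e.
have [n sn] := survival_at_threshold_small (mulr_gt0 p0 e0).
apply: (@le_trans _ _ (survival n K)).
  rewrite sE; apply: le_measure; rewrite ?inE//; last by move=> w /= /(_ n).
  rewrite (_ : [set w | _] = \bigcap_n [set w | alive n (K, noise_of zeta w)]).
    exact: bigcapT_measurable.
  by apply/seteqP; split => w /= aw k; [move=> _|]; exact: aw.
rewrite -(@lee_pmul2l _ p%:E) ?lte_fin//.
apply: le_trans (sK n) _; rewrite -EFinM ltW//; apply: le_lt_trans sn.
apply: averaged_le => // z; rewrite /ind lee_fin ler_nat.
by have := @aliveS n (h, z); case: alive => // /(_ isT) ->.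
Qed.

End extinction.

(** * Growth of the mean generation sizes *)

Section mean_size_growth.
Context (R : realType) (b : nat) (rho c h : R).
Hypotheses (rho0 : 0 < rho) (c0 : 0 < c).

Local Notation Q := (offspring rho c h).
Local Notation mean_size := (mean_size b rho c h).

(** Every vertex counted in generation [n] has a value at least [h], so by monotonicity its mean
    number of descendants [m] generations later is at least [mean_size m h]. *)
Lemma mean_size_mul n m a : (h <= a)%R ->
  (mean_size n a * mean_size m h <= mean_size (n + m) a)%E.
Proof.
elim: n a => [|n ih] a ha.
  by rewrite mul1e add0n; exact: mean_size_nondecreasing.
rewrite addSn /= -muleA; apply: lee_wpmul2l; first by rewrite lee_fin.
rewrite muleC -offspringZl//; last 3 first.
- exact: mean_size_ge0.
- exact: measurable_mean_size.
- exact: mean_size_ge0.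
apply: offspring_le => //.
- by apply: measurable_funeM; exact: measurable_mean_size.
- by move=> x; apply: mule_ge0; exact: mean_size_ge0.
- exact: measurable_mean_size.
- by move=> x hx; rewrite muleC; exact: ih.
Qed.

Lemma mean_size_le n a : (mean_size n a <= (b%:R ^+ n)%:E)%E.
Proof.
elim: n a => [|n ih] a /=; first by rewrite expr0.
rewrite exprS EFinM; apply: lee_wpmul2l; first by rewrite lee_fin.
apply: (@le_trans _ _ (Q (cst (b%:R ^+ n)%:E) a)).
  apply: offspring_le => //; first exact: measurable_mean_size.
  exact: mean_size_ge0.
rewrite offspring_cst ?lee_fin ?exprn_ge0//.
rewrite -[leRHS]mule1; apply: lee_wpmul2l; first by rewrite lee_fin exprn_ge0.
exact: (probability_le1 (@std_normal R) (measurable_set_ge _ c0 _ _)).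
Qed.

Lemma mean_size_fin n a : mean_size n a = (fine (mean_size n a))%:E.
Proof.
rewrite fineK// ge0_fin_numE ?mean_size_ge0//.
exact: le_lt_trans (mean_size_le n a) (ltry _).
Qed.

(* Supermultiplicativity turns one mean above [1] into exponential growth, which
   beats the linear loss [n + 1] of a series of [n] unit conductances. *)
Lemma mean_size_large : (exists n, 1 < mean_size n h)%E ->
  exists n, ((2 * n.+1%:R)%:E <= mean_size n h)%E.
Proof.
move=> [n]; set u := fine (mean_size n h); rewrite mean_size_fin lte_fin -/u => u1.
have pow k : ((u ^+ k)%:E <= mean_size (k * n) h)%E.
  elim: k => [|k ih]; first by rewrite expr0.
  rewrite mulSn; apply: le_trans (mean_size_mul _ _ (lexx h)).
  rewrite exprS EFinM {1}/u -mean_size_fin.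
  by apply: lee_wpmul2l; first exact: mean_size_ge0.
pose e := u - 1; have e0 : 0 < e by rewrite subr_gt0.
(* This [m] ensures [4 * n + 2 <= m * e ^+ 2]. The square of Bernoulli's inequality gives [u ^+ (2 *
   m) >= (m * e) ^+ 2 >= m * (4 * n + 2)], enough for [2 * (2 * m * n + 1)]. Bernoulli alone is
   linear in [m], like the target. *)
pose m := (Num.truncn ((4 * n%:R + 2) / e ^+ 2)).+1.
exists (2 * m * n)%N; apply: le_trans (pow _); rewrite lee_fin.
have bern k : 1 + k%:R * e <= u ^+ k.
  elim: k => [|k ih]; first by rewrite expr0 mul0r addr0.
  have uE : u = 1 + e by rewrite /e; ring.
  rewrite exprS {1}uE.
  apply: (@le_trans _ _ ((1 + e) * (1 + k%:R * e))); last first.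
    by apply: ler_wpM2l => //; lra.
  rewrite -natr1; have : 0 <= k%:R * e * e by rewrite !mulr_ge0// ltW.
  by lra.
have mle : (4 * n%:R + 2) <= m%:R * e ^+ 2.
  rewrite -ler_pdivrMr ?exprn_gt0// ltW//; exact: truncnS_gt.
have me0 : 0 <= m%:R * e by rewrite mulr_ge0// ltW.
rewrite [in u ^+ _]mulnC exprM; apply: (@le_trans _ _ ((1 + m%:R * e) ^+ 2)); last first.
  by rewrite lerXn2r ?nnegrE ?bern ?exprn_ge0//; lra.
have m1 : 1 <= m%:R :> R by rewrite ler1n.
have H := ler_wpM2l (ler0n R m) mle.
apply: (@le_trans _ _ ((m%:R * e) ^+ 2)); last first.
  by rewrite lerXn2r ?nnegrE//; lra.
have -> : (2 * m * n).+1%:R = 2 * m%:R * n%:R + 1 :> R.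
  by rewrite -addn1 natrD !natrM.
have -> : (m%:R * e) ^+ 2 = m%:R * (m%:R * e ^+ 2) by ring.
by apply: le_trans H; rewrite mulrDr; lra.
Qed.

End mean_size_growth.

(** * Conductance of surviving subtrees *)

Section conductance.
Context (R : realType) (b : nat) (rho c h : R).
Hypotheses (rho0 : 0 < rho) (c0 : 0 < c).
Context (disp : measure_display) (Omega : measurableType disp).
Variables (P : probability Omega R) (zeta : seq 'I_b -> {RV P >-> R}).
Hypothesis iid : iid_normal zeta.

Local Notation N := (noise R (seq 'I_b)).
Local Notation Q := (offspring rho c h).
Local Notation open x := (h <= root_value rho c x.1 x.2).
Local Notation child := (child rho c).
Local Notation mean_size := (mean_size b rho c h).

(* Conductance between the parent of the root and generation [k], along unit
   conductances. *)
Fixpoint conductance (k : nat) (x : R * N) : R :=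
  if open x then
    if k is k'.+1 then
      let S := \sum_i conductance k' (child i x) in S / (1 + S)
    else 1
  else 0.

Lemma conductanceS k x : conductance k.+1 x =
  if open x then (\sum_i conductance k (child i x)) /
                 (1 + \sum_i conductance k (child i x)) else 0.
Proof. by []. Qed.

Lemma conductance_itv k x : 0 <= conductance k x <= 1.
Proof.
elim: k x => [|k ih] x /=; case: ifP => _; rewrite ?lexx ?ler01//.
set S := \sum_i _.
have S0 : 0 <= S by apply: sumr_ge0 => i _; case/andP: (ih (child i x)).
have S1 : 0 < 1 + S by lra.
by rewrite divr_ge0 ?ler_pdivrMr//=; lra.
Qed.

Lemma conductance_ge0 k x : 0 <= conductance k x.
Proof. by case/andP: (conductance_itv k x). Qed.

Lemma conductance_le1 k x : conductance k x <= 1.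
Proof. by case/andP: (conductance_itv k x). Qed.

Lemma ler_div1D (x y : R) : 0 <= x -> x <= y -> x / (1 + x) <= y / (1 + y).
Proof.
move=> x0 xy; have x1 : 0 < 1 + x by lra.
have y1 : 0 < 1 + y by lra.
by rewrite ler_pdivrMr// mulrAC ler_pdivlMr// !mulrDr !mulr1 (mulrC y) lerD2r.
Qed.

Lemma conductance_decreasing k x : conductance k.+1 x <= conductance k x.
Proof.
elim: k x => [|k ih] x.
  by rewrite [leRHS]/=; case: ifP => o; rewrite ?conductance_le1//= o.
rewrite conductanceS [leRHS]conductanceS; case: ifP => // _.
apply: ler_div1D; first by apply: sumr_ge0 => i _; exact: conductance_ge0.
by apply: ler_sum => i _; exact: ih.
Qed.

Section spread.
Variable Y : R * N -> R.
Hypotheses (Y0 : forall x, 0 <= Y x) (Y1 : forall x, Y x <= 1).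

(** The sum of [Y] over the descendants of generation [j] reached through open vertices. *)
Fixpoint spread (j : nat) (x : R * N) : R :=
  if j is j'.+1 then if open x then \sum_i spread j' (child i x) else 0
  else Y x.

(** The sum of products of [Y] over ordered pairs of distinct descendants of generation [j], sorted
    by the vertex where their ancestral lines separate. *)
Fixpoint cross (j : nat) (x : R * N) : R :=
  if j is j'.+1 then
    if open x then
      \sum_i cross j' (child i x) +
      \sum_i \sum_(l | l != i) spread j' (child i x) * spread j' (child l x)
    else 0
  else 0.

Lemma spread_ge0 j x : 0 <= spread j x.
Proof.
by elim: j x => [|j ih] x //=; case: ifP => // _; exact: sumr_ge0.
Qed.

Lemma cross_ge0 j x : 0 <= cross j x.
Proof.
elim: j x => [|j ih] x //=; case: ifP => // _; apply: addr_ge0.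
  by apply: sumr_ge0.
by do 2!(apply: sumr_ge0 => ? _); rewrite mulr_ge0// spread_ge0.
Qed.

(** Expanding the square leaves the pairs counted by [cross] and the diagonal squares, which are at
    most [spread] because [Y <= 1]. *)
Lemma spread_sqr_le j x : spread j x ^+ 2 <= cross j x + spread j x.
Proof.
elim: j x => [|j ih] x /=; first by have := Y0 x; have := Y1 x; nra.
case: ifP => _; last by rewrite expr0n addr0.
rewrite expr2 big_distrlr/=.
under eq_bigr => i _ do rewrite (bigD1 i)//=.
rewrite big_split/= addrAC lerD2r -big_split/=.
by apply: ler_sum => i _; rewrite -expr2.
Qed.

(* [spread j] unit-length ends hanging at depth [j]: merging the paths that lead
   to them can only lower the conductance. *)
Lemma spread_le_conductance k j x : (forall y, Y y <= conductance k y) ->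
  spread j x <= (1 + j%:R * spread j x) * conductance (k + j) x.
Proof.
move=> Yk; elim: j x => [|j ih] x; first by rewrite mul0r addr0 mul1r addn0 /= Yk.
rewrite addnS /=; case: ifP => _; last by rewrite mulr0.
set T := \sum_i conductance _ _; set S := \sum_i spread _ _.
have S0 : 0 <= S by apply: sumr_ge0 => i _; exact: spread_ge0.
have T0 : 0 <= T by apply: sumr_ge0 => i _; exact: conductance_ge0.
have ST : S <= (1 + j%:R * S) * T.
  rewrite /T mulr_sumr; apply: ler_sum => i _; apply: le_trans (ih _) _.
  apply: ler_wpM2r; first exact: conductance_ge0.
  rewrite lerD2l; apply: ler_wpM2l => //.
  rewrite /S (bigD1 i)//= lerDl; apply: sumr_ge0 => l _; exact: spread_ge0.
have j0 : 0 <= j%:R :> R by [].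
rewrite mulrA ler_pdivlMr; last by lra.
have -> : (1 + j.+1%:R * S) * T = (1 + j%:R * S) * T + S * T.
  by rewrite -natr1; ring.
by rewrite mulrDr mulr1 lerD2r.
Qed.

(** If the sum [S] is at most 1, the factor [1 + j * S] is at most [j + 1]; if [S > 1], the pairs
    take over, being at least [S ^+ 2 - S]. The bound is linear in the conductance, so that means
    can be taken. *)
Lemma spread_le_cross k j x : (forall y, Y y <= conductance k y) ->
  spread j x <= j.+1%:R * conductance (k + j) x + cross j x.
Proof.
move=> Yk; have := spread_le_conductance j x Yk; have := spread_sqr_le j x.
have := cross_ge0 j x; have := spread_ge0 j x; have := conductance_ge0 (k + j) x.
set S := spread j x; set C := cross j x; set T := conductance _ x.
rewrite -natr1; have : 0 <= j%:R :> R by [].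
move: (j%:R) => n n0 T0 S0 C0 SC ST.
have [S1|S1] := lerP S 1.
  have : 0 <= n * T * (1 - S) by rewrite !mulr_ge0//; lra.
  by lra.
(* After multiplication by [1 + n * S], the right side exceeds the left by at least
   [n * S * (S - 1) ^+ 2 + S * (S - 1)]. *)
have nS : 0 < 1 + n * S by have := mulr_ge0 n0 S0; lra.
rewrite -(ler_pM2l nS).
have h1 : (n + 1) * S <= (n + 1) * ((1 + n * S) * T).
  by rewrite ler_wpM2l//; lra.
have h2 : (1 + n * S) * (S ^+ 2 - S) <= (1 + n * S) * C.
  by rewrite ler_wpM2l//; lra.
have h3 : 0 <= n * S * (S - 1) ^+ 2 + S * (S - 1).
  by rewrite addr_ge0 ?mulr_ge0 ?sqr_ge0//; lra.
by lra.
Qed.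

End spread.

(** For values at least [e], the inverse is a shift of the map taking [y] to the inverse of
    [e + |y|], which is continuous on the whole line. *)
Lemma measurable_invr_gt (d : measure_display) (T : measurableType d)
    (e : R) (f : T -> R) : 0 < e -> (forall x, e <= f x) ->
  measurable_fun setT f -> measurable_fun setT (fun x => (f x)^-1).
Proof.
move=> e0 ef mf.
have -> : (fun x => (f x)^-1) = (fun y : R => (e + `|y|)^-1) \o (fun x => f x - e).
  apply/funext => x /=; rewrite ger0_norm ?subr_ge0//.
  by rewrite addrC subrK.
apply: measurableT_comp; last by apply: measurable_funB.
apply: continuous_measurable_fun => y.
apply: cvgV; first by rewrite gt_eqF// ltr_pwDl.
by apply: cvgD; [exact: cvg_cst|exact: norm_continuous].
Qed.

Lemma measurable_conductance k : measurable_fun setT (conductance k).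
Proof.
elim: k => [|k ih] /=; apply: measurable_fun_ifT => //; try exact: measurable_open.
have mS : measurable_fun setT (fun x => \sum_i conductance k (child i x)).
  by apply: measurable_sum => i; exact: (measurableT_comp ih (measurable_child _ _ _)).
apply: measurable_funM => //; apply: (@measurable_invr_gt _ _ 1) => //.
  by move=> x; rewrite lerDl; apply: sumr_ge0 => i _; exact: conductance_ge0.
exact: measurable_funD.
Qed.

Lemma measurable_spread Y j : measurable_fun setT Y ->
  measurable_fun setT (spread Y j).
Proof.
move=> mY; elim: j => [//|j ih] /=; apply: measurable_fun_ifT => //.
  exact: measurable_open.
by apply: measurable_sum => i; exact: (measurableT_comp ih (measurable_child _ _ _)).
Qed.

Lemma measurable_cross Y j : measurable_fun setT Y ->
  measurable_fun setT (cross Y j).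
Proof.
move=> mY; elim: j => [|j ih] /=; first exact: measurable_cst.
have mc i : measurable_fun setT (fun x => spread Y j (child i x)).
  exact: (measurableT_comp (measurable_spread j mY) (measurable_child _ _ _)).
apply: measurable_fun_ifT => //; first exact: measurable_open.
apply: measurable_funD.
  by apply: measurable_sum => i; exact: (measurableT_comp ih (measurable_child _ _ _)).
apply: measurable_sum => i.
rewrite [X in measurable_fun _ X](_ : _ = fun x => \sum_l
  (if l != i then spread Y j (child i x) * spread Y j (child l x) else 0)).
  apply: measurable_sum => l; case: (l != i) => //; exact: measurable_funM.
by apply/funext => x; rewrite big_mkcond.
Qed.

Local Notation mean F := (averaged zeta (fun x => (F x)%:E)).

Section spread_mean.
Variables (Y : R * N -> R) (s : R).
Hypotheses (mY : measurable_fun setT Y) (Y0 : forall x, 0 <= Y x).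
Hypotheses (s0 : 0 <= s) (Ys : forall a, (mean Y a <= s%:E)%E).

Let mspread j : measurable_fun setT (fun x => (spread Y j x)%:E).
Proof. by apply/measurable_EFinP; exact: measurable_spread. Qed.

Let mcross j : measurable_fun setT (fun x => (cross Y j x)%:E).
Proof. by apply/measurable_EFinP; exact: measurable_cross. Qed.

Let spread_ge0E j x : (0 <= (spread Y j x)%:E)%E.
Proof. by rewrite lee_fin spread_ge0. Qed.

Let cross_ge0E j x : (0 <= (cross Y j x)%:E)%E.
Proof. by rewrite lee_fin cross_ge0. Qed.

Let mean_sum_child (F : R * N -> R) a : measurable_fun setT F ->
  (forall x, 0 <= F x) ->
  averaged zeta (fun x => \sum_i (if open x then (F (child i x))%:E else 0))%E a =
  (b%:R%:E * Q (mean F) a)%E.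
Proof.
move=> mF F0; have mFE : measurable_fun setT (fun x => (F x)%:E) by exact/measurable_EFinP.
rewrite averaged_sum.
- under eq_bigr => i _ do rewrite (averaged_child rho c h iid (F := fun x => (F x)%:E))//.
  rewrite sume_cst_ord//; apply: offspring_ge0 => x; exact: averaged_ge0.
- move=> i; apply: measurable_fun_ifT => //; first exact: measurable_open.
  exact: (measurableT_comp mFE (measurable_child _ _ _)).
- by move=> i x; case: ifP; rewrite lee_fin.
Qed.

Lemma mean_spreadS j a : mean (spread Y j.+1) a = (b%:R%:E * Q (mean (spread Y j)) a)%E.
Proof.
rewrite -mean_sum_child; last 2 first.
- exact: measurable_spread.
- by move=> x; exact: spread_ge0.
congr averaged; apply/funext => x /=; case: ifP => _; first by rewrite -sumEFin.
by rewrite big1.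
Qed.

Lemma mean_spread_le j a : (mean (spread Y j) a <= (b%:R ^+ j * s)%:E)%E.
Proof.
elim: j a => [|j ih] a; first by rewrite expr0 mul1r.
rewrite mean_spreadS exprS -mulrA EFinM; apply: lee_wpmul2l; first by rewrite lee_fin.
apply: offspring_le_cst => //; first exact: measurable_averaged.
  by move=> x; exact: averaged_ge0.
by rewrite mulr_ge0 ?exprn_ge0.
Qed.

Lemma mean_spread_ge j a : (h <= a)%R ->
  (forall x, (h <= x)%R -> mean Y x = s%:E) ->
  (s%:E * mean_size j a <= mean (spread Y j) a)%E.
Proof.
move=> + Yh; elim: j a => [|j ih] a ha; first by rewrite mule1 Yh.
rewrite mean_spreadS /= muleCA; apply: lee_wpmul2l; first by rewrite lee_fin.
rewrite -offspringZl ?lee_fin//; last 2 first.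
- exact: measurable_mean_size.
- exact: mean_size_ge0.
apply: offspring_le => //.
- by apply: measurable_funeM; exact: measurable_mean_size.
- by move=> x; apply: mule_ge0; [rewrite lee_fin|exact: mean_size_ge0].
- exact: measurable_averaged.
Qed.

(** At most [b * b] pairs of branches separate at the root, each contributing at most the square of
    [b ^+ j * s] in mean; pairs separating later give the recursive term. *)
Fixpoint cross_const (j : nat) : R :=
  if j is j'.+1 then b%:R * cross_const j' + b%:R * (b%:R * (b%:R ^+ j' * b%:R ^+ j'))
  else 0.

Lemma cross_const_ge0 j : 0 <= cross_const j.
Proof.
by elim: j => [//|j ih] /=; rewrite addr_ge0 ?mulr_ge0 ?exprn_ge0.
Qed.

Lemma mean_cross_le j a : (mean (cross Y j) a <= (cross_const j * s ^+ 2)%:E)%E.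
Proof.
elim: j a => [|j ih] a.
  by rewrite [leLHS](averaged_cst zeta 0%E a) mul0r.
pose G i l x := (if open x then (spread Y j (child i x))%:E * (spread Y j (child l x))%:E
                 else 0)%E.
have G0 i l x : (0 <= G i l x)%E by rewrite /G; case: ifP => // _; rewrite mule_ge0.
have mG i l : measurable_fun setT (G i l).
  apply: measurable_fun_ifT => //; first exact: measurable_open.
  by apply: emeasurable_funM; apply: (measurableT_comp (mspread j) (measurable_child _ _ _)).
have -> : (fun x => (cross Y j.+1 x)%:E) = (fun x =>
   \sum_i (if open x then (cross Y j (child i x))%:E else 0) +
   \sum_i \sum_l (if l != i then G i l x else 0))%E.
  apply/funext => x /=; rewrite /G; case: ifP => _; last first.
    by rewrite !big1 ?adde0// => i _; rewrite big1// => l _; case: ifP.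
  rewrite EFinD -!sumEFin; congr (_ + _)%E; apply: eq_bigr => i _.
  by rewrite -sumEFin big_mkcond; apply: eq_bigr => l _; case: ifP.
rewrite averagedD//; last 4 first.
- apply: emeasurable_sum => i; apply: measurable_fun_ifT => //.
    exact: measurable_open.
  exact: (measurableT_comp (mcross j) (measurable_child _ _ _)).
- by move=> x; apply: sume_ge0 => i _; case: ifP; rewrite ?lee_fin ?cross_ge0.
- apply: emeasurable_sum => i; apply: emeasurable_sum => l.
  by case: (l != i); [exact: mG|exact: measurable_cst].
- by move=> x; do 2!(apply: sume_ge0 => ? _); case: ifP.
rewrite /= mulrDl EFinD; apply: leeD.
  rewrite mean_sum_child; last 2 first.
  - exact: measurable_cross.
  - by move=> x; exact: cross_ge0.
  rewrite -mulrA EFinM; apply: lee_wpmul2l; first by rewrite lee_fin.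
  apply: offspring_le_cst => //; first exact: measurable_averaged.
    by move=> x; exact: averaged_ge0.
  by rewrite mulr_ge0 ?cross_const_ge0 ?sqr_ge0.
have r0 : 0 <= b%:R ^+ j * s :> R by rewrite mulr_ge0 ?exprn_ge0.
have GE i l : (averaged zeta (fun x => if l != i then G i l x else 0) a <=
    ((b%:R ^+ j * s) * (b%:R ^+ j * s))%:E)%E.
  case: (eqVneq l i) => [_|li].
    by rewrite [leLHS](averaged_cst zeta 0%E a) lee_fin mulr_ge0.
  rewrite (averaged_child2 rho c h iid (F := fun x => (spread Y j x)%:E)
    (G := fun x => (spread Y j x)%:E))//; last by rewrite eq_sym.
  apply: offspring_le_cst => //.
  - by apply: emeasurable_funM; exact: measurable_averaged.
  - by move=> x; apply: mule_ge0; exact: averaged_ge0.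
  - by rewrite mulr_ge0.
  - by move=> x; rewrite EFinM; apply: lee_pmul;
      [exact: averaged_ge0|exact: averaged_ge0|exact: mean_spread_le..].
rewrite averaged_sum; last 2 first.
- move=> i; apply: emeasurable_sum => l.
  by case: (l != i); [exact: mG|exact: measurable_cst].
- by move=> i x; apply: sume_ge0 => l _; case: ifP.
apply: (@le_trans _ _ (\sum_(i < b) \sum_(l < b)
   ((b%:R ^+ j * s) * (b%:R ^+ j * s))%:E)%E).
  apply: lee_sum => i _; rewrite averaged_sum.
  - by apply: lee_sum => l _.
  - by move=> l; case: (l != i); [exact: mG|exact: measurable_cst].
  - by move=> l x; case: ifP.
under eq_bigr do rewrite sume_cst_ord ?lee_fin ?mulr_ge0//.
rewrite sume_cst_ord ?mule_ge0 ?lee_fin ?mulr_ge0//.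
by rewrite le_eqVlt; apply/orP; left; apply/eqP; ring.
Qed.

End spread_mean.

(** The first term is the bound at [k = 0], where only the root has to be open; the second one keeps
    the pair correction [cross_const n * t ^+ 2] below [t]. *)
Definition conductance_bound (n : nat) : R :=
  Num.min (fine (@std_normal R [set y | h <= rho * h + c * y]))
          (1 + cross_const n)^-1.

Lemma conductance_bound_gt0 n : 0 < conductance_bound n.
Proof.
rewrite lt_min invr_gt0 ltr_wpDr ?cross_const_ge0// andbT.
rewrite fine_gt0// std_normal_ge_gt0//=.
exact: le_lt_trans (probability_le1 (@std_normal R) (measurable_set_ge _ c0 _ _)) (ltry _).
Qed.

Let mconductance k : measurable_fun setT (fun x => (conductance k x)%:E).
Proof. by apply/measurable_EFinP; exact: measurable_conductance. Qed.

Let conductance_ge0E k x : (0 <= (conductance k x)%:E)%E.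
Proof. by rewrite lee_fin conductance_ge0. Qed.

Let mean_conductance_fin k a : mean (conductance k) a = (fine (mean (conductance k) a))%:E.
Proof.
rewrite fineK// ge0_fin_numE ?averaged_ge0//.
apply: (@le_lt_trans _ _ 1%E); last exact: ltry.
rewrite -[leRHS](averaged_cst zeta 1%E a); apply: averaged_le => //.
by move=> z; rewrite lee_fin conductance_le1.
Qed.

(* The field [Y] is [conductance k] thinned so that its mean is exactly the bound,
   whatever the value above [h] it starts from. *)
Let mean_conductance_block n k :
  ((2 * n.+1%:R)%:E <= mean_size n h)%E ->
  (forall a, (h <= a)%R -> (conductance_bound n)%:E <= mean (conductance k) a)%E ->
  (forall a, (h <= a)%R -> (conductance_bound n)%:E <= mean (conductance (k + n)) a)%E.
Proof.
set t := conductance_bound n => un tk a ha.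
have t0 : 0 < t := conductance_bound_gt0 n.
(* The thinning factor: the maximum makes it at most 1 everywhere, and for [h <= x] it is exactly
   [t] divided by the mean conductance. *)
pose v x := t / Num.max t (fine (mean (conductance k) x)).
have v0 x : 0 <= v x by rewrite divr_ge0 ?ltW// lt_max t0.
have v1 x : v x <= 1 by rewrite ler_pdivrMr ?lt_max ?t0// mul1r le_max lexx.
have mv : measurable_fun setT v.
  apply: measurable_funM => //; apply: (measurable_invr_gt t0).
    by move=> x; rewrite le_max lexx.
  apply: measurable_maxr => //.
  by apply: measurableT_comp => //; exact: measurable_averaged.
pose Y (x : R * N) := v x.1 * conductance k x.
have mY : measurable_fun setT Y.
  apply: measurable_funM; last exact: measurable_conductance.
  exact: (measurableT_comp mv measurable_fst).
have Y0 x : 0 <= Y x by rewrite mulr_ge0// conductance_ge0.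
have Yk x : Y x <= conductance k x by rewrite ler_piMl// conductance_ge0.
have Y1 x : Y x <= 1 by rewrite (le_trans (Yk x))// conductance_le1.
have meanY x : mean Y x = (v x * fine (mean (conductance k) x))%:E.
  rewrite EFinM -mean_conductance_fin /averaged -ge0_integralZl ?lee_fin//.
  exact: (measurable_at zeta x (mconductance k)).
have Yt x : (mean Y x <= t%:E)%E.
  rewrite meanY lee_fin /v mulrAC ler_pdivrMr ?lt_max ?t0//.
  by apply: ler_wpM2l; [exact: ltW|rewrite le_max lexx orbT].
have Yh x : h <= x -> mean Y x = t%:E.
  move=> hx; rewrite meanY; have := tk x hx; rewrite mean_conductance_fin lee_fin => tx.
  by rewrite /v max_r// divfK// gt_eqF// (lt_le_trans t0).
have t0' := ltW t0.
have lo := mean_spread_ge mY Y0 t0' n ha Yh.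
have up := mean_cross_le mY Y0 t0' Yt n a.
have mid : (mean (spread Y n) a <=
   n.+1%:R%:E * mean (conductance (k + n)) a + mean (cross Y n) a)%E.
  rewrite -averagedZl ?lee_fin// -averagedD//; last 4 first.
  - exact: measurable_funeM.
  - by move=> x; rewrite -EFinM lee_fin mulr_ge0 ?conductance_ge0.
  - by apply/measurable_EFinP; exact: measurable_cross.
  - by move=> x; rewrite lee_fin cross_ge0.
  apply: averaged_le.
  - by apply/measurable_EFinP; exact: measurable_spread.
  - by move=> x; rewrite lee_fin spread_ge0.
  - apply: emeasurable_funD; first exact: measurable_funeM.
    by apply/measurable_EFinP; exact: measurable_cross.
  - by move=> z; rewrite -EFinM -EFinD lee_fin; exact: spread_le_cross.
have : (t%:E * (2 * n.+1%:R)%:E <= n.+1%:R%:E * mean (conductance (k + n)) a +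
    (cross_const n * t ^+ 2)%:E)%E.
  apply: (@le_trans _ _ (t%:E * mean_size n a)%E).
    apply: lee_wpmul2l; first by rewrite lee_fin.
    by apply: le_trans un _; exact: mean_size_nondecreasing.
  apply: le_trans lo _; apply: le_trans mid _; exact: leeD2l.
rewrite mean_conductance_fin -!EFinM -EFinD !lee_fin.
set T := fine _; have Kt : cross_const n * t <= 1.
  have : t <= (1 + cross_const n)^-1 by rewrite /t ge_min lexx orbT.
  have K0 := cross_const_ge0 n.
  rewrite -[X in _ <= X -> _]mul1r ler_pdivlMr; last by lra.
  by lra.
have n1 : 1 <= n.+1%:R :> R by rewrite ler1n.
move: (n.+1%:R) n1 => m m1 H.
(* Of the [2 * m * t] available, at most [m * t] is lost to the pairs, and the remaining [m * t] is
   below [m * T]. *)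
have H2 : cross_const n * t ^+ 2 <= t.
  by rewrite expr2 mulrA ler_piMl.
have H3 : t <= m * t by rewrite ler_peMl.
have : m * t <= m * T by lra.
by rewrite ler_pM2l//; lra.
Qed.

(** Blocks give the bound at multiples of [n]. Every [k] is at most the multiple [k * n], and the
    conductance decreases with the generation. *)
Lemma mean_conductance_ge n : (0 < b)%N -> ((2 * n.+1%:R)%:E <= mean_size n h)%E ->
  forall k a, (h <= a)%R ->
  ((conductance_bound n)%:E <= mean (conductance k) a)%E.
Proof.
move=> b0 un.
have n0 : (0 < n)%N.
  by case: n un => //=; rewrite mulr1 lee_fin (@ler_nat R 2 1).
have blocks k a : h <= a ->
    ((conductance_bound n)%:E <= mean (conductance (k * n)) a)%E.
  elim: k a => [|k ih] a ha; last first.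
    by rewrite mulSn addnC; exact: mean_conductance_block.
  have <- : Q (cst 1%E) a = mean (conductance (0 * n)) a.
    rewrite mul0n (_ : cst 1%E = averaged zeta (cst 1%E)); last first.
      by apply/funext => x; rewrite averaged_cst.
    rewrite -(averaged_child rho c h iid (F := cst 1%E) (Ordinal b0))//.
    by congr averaged; apply/funext => x /=; case: ifP.
  apply: (@le_trans _ _ (Q (cst 1%E) h)); last first.
    exact: offspring_nondecreasing.
  rewrite offspring_cst// mul1e -[leRHS]fineK ?lee_fin ?ge_min ?lexx//.
  by apply: fin_num_measure; exact: measurable_set_ge.
have decr k m a : (mean (conductance (k + m)) a <= mean (conductance k) a)%E.
  elim: m => [|m ih]; first by rewrite addn0.
  apply: le_trans _ ih; rewrite addnS; apply: averaged_le => // z.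
  by rewrite lee_fin conductance_decreasing.
move=> k a ha; apply: le_trans (blocks k a ha) _.
rewrite -(subnKC (leq_pmulr k n0)); exact: decr.
Qed.

Lemma measurable_conductance_ge t k a :
  measurable [set w | t <= conductance k (a, noise_of zeta w)].
Proof.
have mf : measurable_fun setT (fun w => conductance k (a, noise_of zeta w)).
  apply: (measurableT_comp (measurable_conductance k)).
  exact: measurable_fun_pair.
rewrite -[X in measurable X]setTI (_ : [set w | _] =
  (fun w => conductance k (a, noise_of zeta w)) @^-1` `[t, +oo[).
  exact: mf.
by apply/seteqP; split => w /=; rewrite in_itv/= andbT.
Qed.

(** Conductances are at most 1, so a mean of at least [t] forces the value [t / 2] to be reached
    with probability at least [t / 2]. These events decrease in [k], and continuity from above
    applies. *)
Lemma conductance_likely (t a : R) : (0 <= t)%R ->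
  (forall k, t%:E <= mean (conductance k) a)%E ->
  ((t / 2)%:E <=
   P [set w | forall k, (t / 2 <= conductance k (a, noise_of zeta w))%R])%E.
Proof.
move=> t0 tk; pose A k := [set w | t / 2 <= conductance k (a, noise_of zeta w)].
have mA k : measurable (A k) by exact: measurable_conductance_ge.
have PA k : ((t / 2)%:E <= P (A k))%E.
  have : (t%:E <= (t / 2)%:E + P (A k))%E.
    apply: le_trans (tk k) _.
    have -> : ((t / 2)%:E + P (A k) =
        \int[P]_w ((t / 2)%:E + (\1_(A k) w)%:E))%E.
      rewrite ge0_integralD//.
      - congr (_ + _)%E; last by rewrite integral_indic// setIT.
        exact/esym/(averaged_cst zeta (t / 2)%:E a).
      - by move=> w _; rewrite lee_fin divr_ge0.
      - by apply/measurable_EFinP; exact: measurable_indic.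
    apply: ge0_le_integral => //.
    - exact: (measurable_at zeta a (mconductance k)).
    - apply: emeasurable_funD => //.
      by apply/measurable_EFinP; exact: measurable_indic.
    move=> w _; rewrite -EFinD lee_fin indicE.
    have := conductance_le1 k (a, noise_of zeta w).
    case: (lerP (t / 2) (conductance k (a, noise_of zeta w))) => tc.
      by rewrite mem_set//=; lra.
    have nA : ~ A k w by rewrite /A /= leNgt tc.
    by rewrite (memNset nA) addr0 => _; exact: ltW.
  have -> : P (A k) = (fine (P (A k)))%:E by rewrite fineK// fin_num_measure.
  by rewrite -EFinD !lee_fin; lra.
have capE : [set w | forall k, t / 2 <= conductance k (a, noise_of zeta w)] =
    \bigcap_k A k.
  by apply/seteqP; split => w /= H k; [move=> _|]; exact: H.
rewrite capE.
have cv : P \o A @ \oo --> P (\bigcap_k A k).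
  apply: nonincreasing_cvg_mu => //.
  - by apply: le_lt_trans (probability_le1 P (mA 0%N)) _; exact: ltry.
  - exact: bigcapT_measurable.
  - apply/nonincreasing_seqP => k; apply/subsetPset => w /= H.
    by apply: le_trans H (conductance_decreasing _ _).
rewrite -(cvg_lim _ cv)//; apply: lime_ge; first by apply/cvg_ex; exists (P (\bigcap_k A k)).
by apply: nearW => k; exact: PA.
Qed.

End conductance.

(** * Simple random walk *)

Section walk_law.
Context (R : realType) (V : countType) (adj : rel V) (A : set V).

Local Notation deg := (degree adj A).
Local Notation step := (srw_step R adj A).

(** The possible next states. Degree 0 is the absorbing case; it also covers an infinite
    neighbourhood, whose [fset_set] is empty. *)
Definition srw_range (x : V) : seq V :=
  if deg x == 0%N then [:: x] else enum_fset (fset_set (nbrs adj A x)).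

Definition srw_mean (f : V -> R) (x : V) : R :=
  if deg x == 0%N then f x
  else (\sum_(y <- enum_fset (fset_set (nbrs adj A x))) f y) / (deg x)%:R.

Lemma srw_range_uniq x : uniq (srw_range x).
Proof. by rewrite /srw_range; case: ifP => // _; exact: fset_uniq. Qed.

Lemma mem_nbrs_fset x y : deg x != 0%N ->
  (y \in enum_fset (fset_set (nbrs adj A x))) = (y \in nbrs adj A x).
Proof.
move=> d0; have fN : finite_set (nbrs adj A x).
  apply: contrapT => nf; move: d0; rewrite /degree.
  by rewrite /fset_set; case: pselect => // _; rewrite cardfs0.
by rewrite -[LHS]/(y \in fset_set (nbrs adj A x)) in_fset_set.
Qed.

Lemma srw_meanE f x : srw_mean f x = \sum_(y <- srw_range x) step x y * f y.
Proof.
rewrite /srw_mean /srw_range /srw_step; case: ifP => d0.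
  by rewrite big_seq1 eqxx mul1r.
rewrite mulr_suml big_seq [RHS]big_seq; apply: eq_bigr => y yN.
by rewrite -mem_nbrs_fset ?d0// yN mul1r mulrC.
Qed.

Lemma srw_mean1 x : srw_mean (fun=> 1) x = 1.
Proof.
rewrite /srw_mean; case: ifPn => // d0.
rewrite big_const_seq count_predT iter_addr_0 -/(degree _ _ _).
by rewrite divff// pnatr_eq0.
Qed.

(** Probability that the walk from [x] satisfies the successive predicates at times 1, 2 and so on;
    the starting point is not tested. *)
Fixpoint visit_prob (Es : seq (pred V)) (x : V) : R :=
  if Es is E :: Es' then srw_mean (fun y => (E y)%:R * visit_prob Es' y) x else 1.

Context (r : V) (disp : measure_display) (Omega : measurableType disp).
Variables (Q : probability Omega R) (X : nat -> Omega -> V).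
Hypothesis srwX : is_srw adj A r Q X.

Let mX n x : measurable (X n @^-1` [set x]).
Proof. by case: srwX => + _; exact. Qed.

Let mXset n (s : set V) : measurable [set w | s (X n w)].
Proof.
rewrite (_ : [set w | s (X n w)] = \bigcup_k
  (if choice.unpickle k is Some x then (if `[< s x >] then X n @^-1` [set x] else set0)
   else set0)).
  apply: bigcupT_measurable => k; case: (choice.unpickle k) => // x.
  by case: ifP.
apply/seteqP; split => w /=.
  by move=> sw; exists (choice.pickle (X n w)) => //; rewrite choice.pickleK asboolT.
by move=> [k _]; case: (choice.unpickle k) => // x; case: ifPn => // /asboolP sx /= ->.
Qed.

Let path_event m (p : nat -> V) := [set w | forall k, (k <= m)%N -> X k w = p k].

Let mpath m p : measurable (path_event m p).
Proof.
rewrite (_ : path_event m p = \bigcap_(k in `I_m.+1) (X k @^-1` [set p k])).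
  by apply: fin_bigcap_measurable => // k _; exact: mX.
by apply/seteqP; split => w /= H k km; exact: H.
Qed.

Let event m (p : nat -> V) (Es : seq (pred V)) := path_event m p `&`
  [set w | forall k, (k < size Es)%N -> nth xpredT Es k (X (m + k).+1 w)].

Let mevent m p Es : measurable (event m p Es).
Proof.
apply: measurableI; first exact: mpath.
rewrite (_ : [set w | _] = \bigcap_(k in `I_(size Es))
  [set w | nth xpredT Es k (X (m + k).+1 w)]).
  apply: fin_bigcap_measurable => // k _.
  exact: (mXset (m + k).+1 (fun y => nth xpredT Es k y)).
by apply/seteqP; split => w /= H k km; exact: H.
Qed.

Let measure_in_seq n (s : seq V) (B : set Omega) : uniq s -> measurable B ->
  Q (B `&` [set w | X n w \in s]) = (\sum_(y <- s) Q (B `&` X n @^-1` [set y]))%E.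
Proof.
move=> + mB; elim: s => [|y s ih] /=.
  move=> _; rewrite big_nil (_ : [set w | _] = set0) ?setI0 ?measure0//.
  by apply/seteqP; split.
move=> /andP[ys us]; rewrite big_cons -ih// -measureU//.
- congr (Q _); rewrite -setIUr; congr (_ `&` _).
  apply/seteqP; split => w /=; rewrite inE; first by case/orP=> [/eqP|]; tauto.
  by case=> [->|->]; rewrite ?eqxx ?orbT.
- exact: measurableI.
- by apply: measurableI => //; exact: (mXset n (fun y => y \in s)).
- by apply/seteqP; split => // w /= [[_ ->] [_]]; rewrite (negbTE ys).
Qed.

Let extend m (p : nat -> V) y k := if k == m.+1 then y else p k.

Let path_extend m p y :
  path_event m p `&` X m.+1 @^-1` [set y] = path_event m.+1 (extend m p y).
Proof.
apply/seteqP; split => w /=.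
  move=> [Hp Xy] k; rewrite leq_eqVlt /extend => /orP[/eqP ->|].
    by rewrite eqxx.
  by move=> km; rewrite ltn_eqF//; exact: Hp.
move=> H; split; last by rewrite /= (H m.+1)// /extend eqxx.
by move=> k km; rewrite H ?(leq_trans km)// /extend ltn_eqF.
Qed.

Let Qpath_extend m p y : Q (path_event m.+1 (extend m p y)) =
  (Q (path_event m p) * (step (p m) y)%:E)%E.
Proof.
case: srwX => _ H; rewrite !H -EFinM big_ord_recr/= mulrA.
rewrite /extend eqxx (ltn_eqF (ltnSn m)); congr (_ * _ * _)%:E.
apply: eq_bigr => k _; rewrite ltn_eqF; last by rewrite ltnS ltnW.
by rewrite ltn_eqF// ltnS.
Qed.

(** The transition probabilities over the finite range already sum to 1. This reduces conditioning
    on the next position to a finite sum. *)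
Let Qescape m p : Q (path_event m p `&` ~` [set w | X m.+1 w \in srw_range (p m)]) = 0%E.
Proof.
set B := path_event m p; set S := [set w | _].
have mB : measurable B := mpath m p.
have mS : measurable S by exact: (mXset m.+1 (fun y => y \in srw_range (p m))).
have BE : (Q B = Q (B `&` S) + Q (B `&` ~` S))%E.
  rewrite -measureU; [by rewrite -setIUr setUv setIT|exact: measurableI| |].
    by apply: measurableI => //; exact: measurableC.
  by rewrite setIACA setICr setI0.
have : Q (B `&` S) = Q B.
  rewrite measure_in_seq ?srw_range_uniq//.
  under eq_bigr => y _ do rewrite path_extend Qpath_extend.
  rewrite -ge0_sume_distrr ?sumEFin; last first.
    by move=> y _; rewrite lee_fin /srw_step; case: ifP => // _; rewrite divr_ge0.
  have := srw_mean1 (p m); rewrite srw_meanE.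
  by under eq_bigr do rewrite mulr1; move=> ->; rewrite mule1.
move=> BS; move: BE; rewrite BS.
have -> : Q B = (fine (Q B))%:E by rewrite fineK// fin_num_measure.
have -> : Q (B `&` ~` S) = (fine (Q (B `&` ~` S)))%:E.
  by rewrite fineK// fin_num_measure//; apply: measurableI => //; exact: measurableC.
by rewrite -EFinD => -[]; rewrite -[LHS]addr0 => /addrI <-.
Qed.

(** Markov property, by conditioning on the position at time [m + 1]. *)
Let Qevent m p Es :
  Q (event m p Es) = (Q (path_event m p) * (visit_prob Es (p m))%:E)%E.
Proof.
elim: Es m p => [|E Es ih] m p /=.
  by rewrite mule1; congr (Q _); apply/seteqP; split => w /=; [case|split].
set B := event m p (E :: Es); set S := [set w | X m.+1 w \in srw_range (p m)].
have mB : measurable B := mevent m p (E :: Es).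
have mS : measurable S by exact: (mXset m.+1 (fun y => y \in srw_range (p m))).
have BS : Q (B `&` ~` S) = 0%E.
  apply/eqP; rewrite eq_le measure_ge0 andbT -(Qescape m p).
  apply: le_measure; rewrite ?inE.
  - by apply: measurableI => //; exact: measurableC.
  - by apply: measurableI => //; exact: measurableC.
  - by move=> w /= [[]].
have -> : (Q B = Q (B `&` S) + Q (B `&` ~` S))%E.
  rewrite -measureU; [by rewrite -setIUr setUv setIT|exact: measurableI| |].
    by apply: measurableI => //; exact: measurableC.
  by rewrite setIACA setICr setI0.
rewrite BS adde0 measure_in_seq ?srw_range_uniq// srw_meanE -sumEFin.
rewrite ge0_sume_distrr; last first.
  move=> y _; rewrite lee_fin !mulr_ge0//.
    by rewrite /srw_step; case: ifP => // _; rewrite divr_ge0.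
  elim: (Es) y => //= F Fs ih' y; rewrite /srw_mean; case: ifP => _.
    by rewrite mulr_ge0.
  by rewrite divr_ge0// sumr_ge0// => z _; rewrite mulr_ge0.
apply: eq_bigr => y _.
have BE : B `&` X m.+1 @^-1` [set y] =
    if E y then event m.+1 (extend m p y) Es else set0.
  apply/seteqP; split => w /=.
    move=> [[Hp HE] Xy]; have := HE 0%N isT; rewrite addn0 /= Xy => ->.
    split; first by rewrite -path_extend.
    by move=> k kE; have := HE k.+1 kE; rewrite addnS addSn.
  case: ifP => // Ey [+ HE]; rewrite -path_extend => -[Hp Xy]; split => //.
  split => //; case=> [_|k kE]; first by rewrite addn0 /= Xy.
  by have := HE k kE; rewrite addnS addSn.
rewrite BE; case: ifP => Ey; last by rewrite measure0 mul0r mulr0 mule0.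
by rewrite ih Qpath_extend mul1r EFinM muleA /extend eqxx.
Qed.

Lemma srw_visit (Es : seq (pred V)) :
  Q [set w | forall k, (k < size Es)%N -> nth xpredT Es k (X k.+1 w)] =
  (visit_prob Es r)%:E.
Proof.
have := Qevent 0 (fun=> r) Es.
have -> : Q (path_event 0 (fun=> r)) = 1%E.
  by case: srwX => _ ->; rewrite eqxx big_ord0 mulr1.
rewrite mul1e => <-; set S := [set w | _].
have mS : measurable S.
  rewrite (_ : S = \bigcap_(k in `I_(size Es)) [set w | nth xpredT Es k (X k.+1 w)]).
    apply: fin_bigcap_measurable => // k _.
    exact: (mXset k.+1 (fun y => nth xpredT Es k y)).
  by apply/seteqP; split => w /= H k km; exact: H.
have mP := mpath 0 (fun=> r).
have -> : event 0 (fun=> r) Es = S `&` path_event 0 (fun=> r) by rewrite setIC.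
have -> : (Q S = Q (S `&` path_event 0 (fun=> r)) +
                 Q (S `&` ~` path_event 0 (fun=> r)))%E.
  rewrite -measureU; [by rewrite -setIUr setUv setIT|exact: measurableI| |].
    by apply: measurableI => //; exact: measurableC.
  by rewrite setIACA setICr setI0.
rewrite [X in (_ + X)%E](_ : _ = 0%E) ?adde0//.
apply/eqP; rewrite eq_le measure_ge0 andbT.
have <- : Q (~` path_event 0 (fun=> r)) = 0%E.
  rewrite probability_setC//.
  by case: srwX => _ ->; rewrite eqxx big_ord0 mulr1 subee.
apply: le_measure; rewrite ?inE.
- by apply: measurableI => //; exact: measurableC.
- exact: measurableC.
- by move=> w [].
Qed.

(** Never returning is the decreasing limit of not returning within [n] steps. The right-hand side
    depends on the graph only, not on the realization of the walk. *)
Lemma srw_never_return (delta : R) :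
  (delta%:E <= Q [set w | forall k, (0 < k)%N -> X k w <> r])%E <->
  forall n, delta <= visit_prob (nseq n (fun y => y != r)) r.
Proof.
pose S n := [set w | forall k, (k < n)%N -> X k.+1 w != r].
have QS n : Q (S n) = (visit_prob (nseq n (fun y => y != r)) r)%:E.
  rewrite -srw_visit size_nseq; congr (Q _).
  by apply/seteqP; split => w /= H k kn; have := H k kn; rewrite nth_nseq kn.
have mS n : measurable (S n).
  rewrite (_ : S n = \bigcap_(k in `I_n) [set w | X k.+1 w != r]).
    apply: fin_bigcap_measurable => // k _.
    exact: (mXset k.+1 (fun y => y != r)).
  by apply/seteqP; split => w /= H k km; exact: H.
have SE : [set w | forall k, (0 < k)%N -> X k w <> r] = \bigcap_n S n.
  apply/seteqP; split => w /= H.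
    by move=> n _ k _; apply/eqP; exact: H.
  by case=> // k _; apply/eqP; exact: (H k.+1 I k).
have dS : nonincreasing_seq S.
  by apply/nonincreasing_seqP => n; apply/subsetPset => w /= H k kn;
    apply: H; rewrite ltnS ltnW.
rewrite SE; split=> [dQ n|dn].
  rewrite -lee_fin -QS; apply: le_trans dQ _; apply: le_measure; rewrite ?inE//.
    exact: bigcapT_measurable.
  exact: bigcap_inf.
have cv : Q \o S @ \oo --> Q (\bigcap_n S n).
  apply: nonincreasing_cvg_mu => //.
  - by apply: le_lt_trans (probability_le1 Q (mS 0%N)) _; exact: ltry.
  - exact: bigcapT_measurable.
rewrite -(cvg_lim _ cv)//; apply: lime_ge; first by apply/cvg_ex; exists (Q (\bigcap_n S n)).
by apply: nearW => n; rewrite /= QS lee_fin.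
Qed.

Lemma srw_position n y : Q (X n @^-1` [set y]) =
  (iter n srw_mean (fun x => (x == y)%:R) r)%:E.
Proof.
case: n => [|n].
  have [_ /(_ 0%N (fun=> y))] := srwX; rewrite big_ord0 mulr1 eq_sym => <- /=.
  congr (Q _); apply/seteqP; split => w /=; last by move/(_ 0%N) ->.
  by move=> Xy k; rewrite leqn0 => /eqP ->.
pose Es : seq (pred V) := rcons (nseq n xpredT) (fun z => z == y).
transitivity (visit_prob Es r)%:E.
  rewrite -srw_visit size_rcons size_nseq; congr (Q _).
  apply/seteqP; split => w /= H.
    move=> k; rewrite ltnS leq_eqVlt /Es nth_rcons size_nseq => /orP[/eqP ->|kn].
      by rewrite ltnn eqxx H /=.
    by rewrite kn nth_nseq kn.
  have := H n (ltnSn n); rewrite /Es nth_rcons size_nseq ltnn eqxx.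
  by move=> /eqP.
congr EFin; rewrite /Es; elim: n (r) {Es} => [|n ih] x.
  by rewrite /=; congr srw_mean; apply/funext => z; rewrite mulr1.
by rewrite iterS /=; congr srw_mean; apply/funext => z; rewrite mul1r ih.
Qed.

Lemma green_sum y : (\int[Q]_w \sum_(0 <= n <oo) ((X n w == y)%:R)%:E =
  \sum_(0 <= n <oo) (iter n srw_mean (fun x => (x == y)%:R) r)%:E)%E.
Proof.
have ind n w : ((X n w == y)%:R)%:E = (\1_(X n @^-1` [set y]) w)%:E :> \bar R.
  rewrite indicE; congr (_%:R%:E).
  by case: eqP => [Xy|Xy]; [rewrite mem_set|rewrite memNset].
rewrite integral_nneseries//.
- apply: eq_eseriesr => n _; rewrite -srw_position.
  under eq_integral do rewrite ind.
  by rewrite integral_indic// setIT.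
- move=> n; under eq_fun do rewrite ind.
  by apply/measurable_EFinP; exact: measurable_indic.
Qed.

End walk_law.

(** * Uniform choices made from a normal variable *)

Section uniform_transform.
Context (R : realType).

Definition normal_cdf (t : R) : R := fine (@std_normal R `]-oo, t]).

Let std_normal_fin (B : set R) : measurable B ->
  @std_normal R B = (fine (@std_normal R B))%:E.
Proof. by move=> mB; rewrite fineK// fin_num_measure. Qed.

Lemma std_normal_itv_le (s t : R) : s <= t ->
  (@std_normal R `]s, t] <= (normal_peak 1 * (t - s))%:E)%E.
Proof.
move=> st.
have -> : ((normal_peak 1 * (t - s))%:E =
    \int[lebesgue_measure]_(y in `]s, t]) (normal_peak 1 : R)%:E)%E.
  rewrite integral_cst//= lebesgue_measure_itv/= lte_fin.
  case: ltrP => [|ts]; first by rewrite -EFinD.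
  by rewrite mule0 (_ : t - s = 0) ?mulr0//; apply/eqP; rewrite subr_eq0 eq_le ts.
rewrite /std_normal /normal_prob; apply: ge0_le_integral => //=.
- by move=> y _; rewrite lee_fin normal_pdf_ge0.
- by apply/measurable_EFinP; apply: measurable_funTS; exact: measurable_normal_pdf.
- by move=> y _; rewrite lee_fin normal_pdf_ub// oner_eq0.
Qed.

Lemma normal_cdfB (s t : R) : s <= t ->
  @std_normal R `]s, t] = (normal_cdf t - normal_cdf s)%:E.
Proof.
move=> st; rewrite std_normal_fin//; congr EFin; apply/esym/eqP.
rewrite subr_eq addrC /normal_cdf -fineD ?fin_num_measure// -measureU//.
  by rewrite -itv_bndbnd_setU// bnd_simp.
apply/seteqP; split => // y /=; rewrite !in_itv/= => -[ys /andP[sy _]].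
by move: (lt_le_trans sy ys); rewrite ltxx.
Qed.

Lemma normal_cdf_lt (s t : R) : s < t -> normal_cdf s < normal_cdf t.
Proof.
move=> st; rewrite -subr_gt0 -lte_fin -normal_cdfB ?ltW//.
have lt2 : (s + t) / 2 < t by lra.
apply: lt_le_trans (std_normal_interval_gt0 lt2) _.
apply: le_measure; rewrite ?inE; [exact: measurable_itv..|].
by move=> y /=; rewrite !in_itv/= => /andP[? ->]; rewrite andbT; lra.
Qed.

Lemma normal_cdf_le (s t : R) : s <= t -> normal_cdf s <= normal_cdf t.
Proof. by rewrite le_eqVlt => /orP[/eqP -> //|/normal_cdf_lt/ltW]. Qed.

Lemma normal_cdf_ge0 t : 0 <= normal_cdf t.
Proof. by rewrite fine_ge0. Qed.

Lemma normal_cdf_le1 t : normal_cdf t <= 1.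
Proof.
rewrite -lee_fin -std_normal_fin//.
by apply: probability_le1; exact: measurable_itv.
Qed.

Lemma normal_cdf_lt1 t : normal_cdf t < 1.
Proof.
apply: (@lt_le_trans _ _ (normal_cdf (t + 1))); last exact: normal_cdf_le1.
by apply: normal_cdf_lt; rewrite ltrDl.
Qed.

(** The density is bounded by its peak, so the distribution function is Lipschitz. *)
Lemma continuous_normal_cdf : continuous normal_cdf.
Proof.
have p0 : 0 < normal_peak (1 : R) by rewrite normal_peak_gt0 ?oner_eq0.
have lip s t : s <= t -> `|normal_cdf t - normal_cdf s| <= normal_peak 1 * (t - s).
  move=> st; rewrite ger0_norm ?subr_ge0 ?normal_cdf_le//.
  by rewrite -lee_fin -normal_cdfB// std_normal_itv_le.
move=> x; apply/cvgrPdist_le => e e0; near=> y.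
have : `|normal_cdf x - normal_cdf y| <= normal_peak 1 * `|x - y|.
  have [xy|xy] := lerP x y.
    by rewrite distrC lip.
  by rewrite lip// ltW.
move=> /le_trans; apply; rewrite mulrC -ler_pdivlMr//.
by near: y; apply: cvgr_dist_le; [exact: cvg_id|exact: divr_gt0].
Unshelve. all: end_near. Qed.

Lemma normal_cdf_ex_gt (p : R) : p < 1 -> exists t, p < normal_cdf t.
Proof.
move=> p1; apply: contrapT => nex.
have Fp n : (@std_normal R `]-oo, n%:R] <= p%:E)%E.
  rewrite std_normal_fin// lee_fin leNgt; apply/negP => pn.
  by apply: nex; exists n%:R.
pose F (n : nat) : set R := `]-oo, n%:R]%classic.
have FT : \bigcup_n F n = setT.
  rewrite -subTset => t _ /=.
  by exists (Num.truncn t).+1; rewrite //= /F /= in_itv/= ltW// truncnS_gt.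
have cv : @std_normal R \o F @ \oo --> @std_normal R setT.
  rewrite -FT; apply: nondecreasing_cvg_mu => //.
  - by move=> n; exact: measurable_itv.
  - by apply: bigcupT_measurable => n; exact: measurable_itv.
  move=> n m nm; apply/subsetPset => x/=; rewrite /F /= !in_itv/= => /le_trans.
  by apply; rewrite ler_nat.
have : (@std_normal R setT <= p%:E)%E.
  rewrite -(cvg_lim _ cv)//; apply: lime_le.
    by apply/cvg_ex; exists (@std_normal R setT).
  by apply: nearW => n; exact: Fp.
by rewrite probability_setT lee_fin leNgt p1.
Qed.

Lemma normal_cdf_ex_lt (p : R) : 0 < p -> exists t, normal_cdf t < p.
Proof.
move=> p0; apply: contrapT => nex.
have Fp n : (p%:E <= @std_normal R `]-oo, (- n%:R)%R])%E.
  rewrite std_normal_fin// lee_fin leNgt; apply/negP => pn.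
  by apply: nex; exists (- n%:R).
pose F (n : nat) : set R := `]-oo, (- n%:R)]%classic.
have F0 : \bigcap_n F n = set0.
  rewrite -subset0 => t /(_ (Num.truncn (- t)).+1 I).
  by rewrite /F/= in_itv/= leNgt => /negP; apply; rewrite ltrNl truncnS_gt.
have cv : @std_normal R \o F @ \oo --> @std_normal R set0.
  rewrite -F0; apply: nonincreasing_cvg_mu => //.
  - by rewrite (le_lt_trans (probability_le1 _ _)) ?ltry//; exact: measurable_itv.
  - by move=> n; exact: measurable_itv.
  - by apply: bigcapT_measurable => n; exact: measurable_itv.
  - move=> m n mn; apply/subsetPset => x/=; rewrite /F /= !in_itv/= => /le_trans; apply.
    by rewrite lerN2 ler_nat.
have : (p%:E <= @std_normal R set0)%E.
  rewrite -(cvg_lim _ cv)//; apply: lime_ge.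
    by apply/cvg_ex; exists (@std_normal R set0).
  by apply: nearW => n; exact: Fp.
by rewrite measure0 lee_fin leNgt p0.
Qed.

Lemma normal_cdf_surj (p : R) : 0 < p -> p < 1 -> exists t, normal_cdf t = p.
Proof.
move=> /normal_cdf_ex_lt[s sp] /normal_cdf_ex_gt[t pt].
have st : s <= t.
  by rewrite leNgt; apply/negP => /ltW/normal_cdf_le ts; lra.
have cs : {within `[s, t], continuous normal_cdf}.
  by apply: continuous_subspaceT => x; exact: continuous_normal_cdf.
have pI : Num.min (normal_cdf s) (normal_cdf t) <= p <=
          Num.max (normal_cdf s) (normal_cdf t).
  by rewrite ge_min (ltW sp) le_max (ltW pt) orbT.
by have [c _ <-] := IVT st cs pI; exists c.
Qed.

Let measurable_normal_cdf : measurable_fun setT normal_cdf.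
Proof. by apply: continuous_measurable_fun; exact: continuous_normal_cdf. Qed.

(** Probability integral transform: the set is a half-line ending at a preimage of [p]. The values 0
    and 1 have no preimage and are treated apart. *)
Lemma std_normal_cdf_lt (p : R) : 0 <= p -> p <= 1 ->
  @std_normal R [set y | normal_cdf y < p] = p%:E.
Proof.
rewrite le_eqVlt => /orP[/eqP <- _|p0].
  rewrite (_ : [set y | _] = set0) ?measure0//; apply/seteqP; split => // y /=.
  by rewrite ltNge normal_cdf_ge0.
rewrite le_eqVlt => /orP[/eqP ->|p1].
  rewrite (_ : [set y | _] = setT) ?probability_setT//.
  by apply/seteqP; split => // y _; exact: normal_cdf_lt1.
have [t tp] := normal_cdf_surj p0 p1.
rewrite (_ : [set y | _] = `]-oo, t[%classic); last first.
  apply/seteqP; split => y /=; rewrite in_itv/= -tp; last exact: normal_cdf_lt.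
  by move=> yt; rewrite ltNge; apply/negP => /normal_cdf_le; rewrite leNgt yt.
rewrite -tp /normal_cdf -std_normal_fin//.
rewrite /std_normal /normal_prob integral_itv_bndo_bndc//.
by apply/measurable_EFinP; apply: measurable_funTS; exact: measurable_normal_pdf.
Qed.

Definition uniform_index (k : nat) (y : R) : nat :=
  Num.truncn (k%:R * normal_cdf y).

Lemma uniform_index_lt k y : (0 < k)%N -> (uniform_index k y < k)%N.
Proof.
move=> k0; rewrite truncn_lt_nat ?mulr_ge0 ?normal_cdf_ge0//.
by rewrite gtr_pMr ?ltr0n// normal_cdf_lt1.
Qed.

Let measurable_cdf_lt p : measurable [set y : R | normal_cdf y < p].
Proof.
rewrite -[X in measurable X]setTI (_ : [set y : R | _] =
  normal_cdf @^-1` `]-oo, p[); first exact: measurable_normal_cdf.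
by apply/seteqP; split => y /=; rewrite in_itv.
Qed.

Let uniform_index_preimage k j : (0 < k)%N ->
  uniform_index k @^-1` [set j] = [set y : R | normal_cdf y < j.+1%:R / k%:R] `\`
    [set y : R | normal_cdf y < j%:R / k%:R].
Proof.
move=> k0; have k0' : 0 < k%:R :> R by rewrite ltr0n.
apply/seteqP; split => y /=.
  move/eqP; rewrite /uniform_index truncn_eq ?mulr_ge0 ?normal_cdf_ge0//.
  move=> /andP[jy yj]; rewrite ltr_pdivlMr// mulrC; split => //.
  by rewrite ltr_pdivlMr// mulrC; apply/negP; rewrite -leNgt.
rewrite !ltr_pdivlMr// => -[yj /negP]; rewrite -leNgt => jy.
by apply/eqP; rewrite truncn_eq ?mulr_ge0 ?normal_cdf_ge0// ![k%:R * _]mulrC jy yj.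
Qed.

Lemma measurable_uniform_index k j : (0 < k)%N ->
  measurable (uniform_index k @^-1` [set j] : set R).
Proof. by move=> k0; rewrite uniform_index_preimage//; exact: measurableD. Qed.

Lemma std_normal_uniform_index k j : (j < k)%N ->
  @std_normal R (uniform_index k @^-1` [set j]) = (k%:R^-1)%:E.
Proof.
move=> jk; have k0 : (0 < k)%N by case: k jk.
have k0' : 0 < k%:R :> R by rewrite ltr0n.
have lejk : j%:R / k%:R <= j.+1%:R / k%:R :> R.
  by rewrite ler_pM2r ?invr_gt0// ler_nat.
rewrite uniform_index_preimage// measureD//; last first.
  by apply: le_lt_trans (probability_le1 _ (measurable_cdf_lt _)) (ltry _).
rewrite setIidr; last by move=> y /= /lt_le_trans; apply.
have E i : (i <= k)%N ->
    @std_normal R [set y | normal_cdf y < i%:R / k%:R] = (i%:R / k%:R)%:E.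
  by move=> ik; rewrite std_normal_cdf_lt ?divr_ge0// ler_pdivrMr// mul1r ler_nat.
apply: etrans (congr2 (fun x y => x - y)%E (E _ jk) (E _ (ltnW jk))) _.
by rewrite -EFinB -natr1 mulrDl addrC addKr mul1r.
Qed.

End uniform_transform.

(** * A random walk driven by normal variables *)

Section walk_construction.
Context (R : realType) (V : countType) (adj : rel V) (A : set V) (r : V).
Context (disp : measure_display) (Omega : measurableType disp).
Variables (P : probability Omega R) (zeta : nat -> {RV P >-> R}).
Hypothesis iid : iid_normal zeta.

(** A uniform index selects the next state, so a walk exists wherever a sequence of independent
    normal variables does. *)
Let next (x : V) (y : R) : V :=
  nth x (srw_range adj A x) (uniform_index (size (srw_range adj A x)) y).

Fixpoint normal_walk (n : nat) (w : Omega) : V :=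
  if n is n'.+1 then next (normal_walk n' w) (zeta n' w) else r.

Let size_range x : (0 < size (srw_range adj A x))%N.
Proof. by rewrite /srw_range; case: ifPn => //; rewrite lt0n. Qed.

Let next_preimage x z : next x @^-1` [set z] =
  if z \in srw_range adj A x then
    uniform_index (size (srw_range adj A x)) @^-1` [set index z (srw_range adj A x)]
  else set0.
Proof.
have us := srw_range_uniq adj A x.
apply/seteqP; split => y /=; rewrite /next.
  move=> <-; rewrite mem_nth ?uniform_index_lt//= index_uniq// uniform_index_lt//.
by case: ifP => // zs /= ->; rewrite nth_index.
Qed.

Let mnext x z : measurable (next x @^-1` [set z]).
Proof. by rewrite next_preimage; case: ifP => // _; exact: measurable_uniform_index. Qed.

Let next_law x z : @std_normal R (next x @^-1` [set z]) = (srw_step R adj A x z)%:E.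
Proof.
rewrite next_preimage; case: ifPn => [zs|zs].
  rewrite std_normal_uniform_index ?index_mem//; congr EFin.
  move: zs; rewrite /srw_range /srw_step; case: ifPn => d0.
    by rewrite inE => /eqP ->; rewrite eqxx invr1.
  by rewrite mem_nbrs_fset// => ->; rewrite mul1r.
rewrite measure0; congr EFin; move: zs; rewrite /srw_range /srw_step; case: ifPn => d0.
  by rewrite inE => /negbTE ->.
by rewrite mem_nbrs_fset// => /negbTE ->; rewrite mul0r.
Qed.

Let zeta_law n B : measurable B -> P (zeta n @^-1` B) = @std_normal R B.
Proof. by move=> mB; rewrite iid.2// oner_eq0. Qed.

Lemma normal_walk_srw : is_srw adj A r P normal_walk.
Proof.
split.
  elim=> [|n ih] x.
    rewrite (_ : _ @^-1` _ = if r == x then setT else set0); first by case: ifP.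
    by apply/seteqP; split => w /=; case: eqP.
  rewrite (_ : _ @^-1` _ = \bigcup_k (if choice.unpickle k is Some v then
    normal_walk n @^-1` [set v] `&` zeta n @^-1` (next v @^-1` [set x]) else set0)).
    apply: bigcupT_measurable => k; case: (choice.unpickle k) => // v.
    by apply: measurableI => //; exact: measurable_funPTI.
  apply/seteqP; split => w /=.
    by move=> H; exists (choice.pickle (normal_walk n w)); rewrite ?choice.pickleK.
  by move=> [k _]; case: (choice.unpickle k) => // v [/= ->].
move=> n p; case: (eqVneq (p 0%N) r) => [p0|p0]; last first.
  rewrite mul0r (_ : [set w | _] = set0) ?measure0//.
  apply/seteqP; split => // w /= /(_ 0%N isT) /= rp.
  by rewrite rp eqxx in p0.
rewrite mul1r.
have -> : [set w | forall k, (k <= n)%N -> normal_walk k w = p k] =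
    [set w | forall k, k \in iota 0 n -> (next (p k) @^-1` [set p k.+1]) (zeta k w)].
  apply/seteqP; split => w /= H k.
    rewrite mem_iota /= add0n => kn.
    by rewrite -(H k.+1 kn) -(H k (ltnW kn)).
  elim: k => [_|k ih kn]; first by rewrite p0.
  have Hk : next (p k) (zeta k w) = p k.+1 by apply: (H k); rewrite mem_iota add0n.
  by rewrite -Hk -(ih (ltnW kn)).
rewrite (iid.1 _ (fun k => next (p k) @^-1` [set p k.+1]) (iota_uniq 0 n))//.
rewrite (eq_bigr (fun k => (srw_step R adj A (p k) (p k.+1))%:E)); last first.
  by move=> k _; rewrite zeta_law.
by rewrite -prodEFin -[n in iota 0 n]subn0 big_mkord.
Qed.

(** Any realization yields the inequalities, and conversely [normal_walk] is a realization.
    Transience becomes a countable family of inequalities, which is also what makes it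
    measurable. *)
Lemma delta_transientP (delta : R) : delta_transient adj A r delta <->
  forall n, delta <= visit_prob R adj A (nseq n (fun y => y != r)) r.
Proof.
split=> [[d [Om [Q [X [srwX dX]]]]]|dn]; first exact/(srw_never_return srwX).
exists disp, Omega, P, normal_walk; split; first exact: normal_walk_srw.
exact/(srw_never_return normal_walk_srw).
Qed.

End walk_construction.

(** * The regular tree *)

HB.instance Definition _ (d : nat) := SubCountable.on (tree d).

Section finite_neighbours.
Context (R : realType) (V : choiceType) (adj : rel V) (N : V -> seq V).
Hypotheses (adjN : forall x y, adj x y = (y \in N x)) (uN : forall x, uniq (N x)).
Variable A : set V.

Lemma nbrs_perm x :
  perm_eq (enum_fset (fset_set (nbrs adj A x))) [seq y <- N x | y \in A].
Proof.
have fin : finite_set (nbrs adj A x).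
  apply: (@sub_finite_set _ _ [set` N x]); last exact: finite_seq.
  by move=> y [_]; rewrite adjN.
apply: uniq_perm; [exact: fset_uniq|exact: filter_uniq|move=> y].
rewrite mem_filter -[LHS]/(y \in fset_set (nbrs adj A x)) in_fset_set//.
by apply/idP/andP; rewrite !inE /= => -[Ay]; rewrite ?adjN// => xy; split;
  rewrite ?inE// adjN.
Qed.

Lemma degreeE x : degree adj A x = count (fun y => y \in A) (N x).
Proof. by rewrite /degree (perm_size (nbrs_perm x)) size_filter. Qed.

Lemma sum_nbrs (f : V -> R) x :
  \sum_(y <- enum_fset (fset_set (nbrs adj A x))) f y =
  \sum_(y <- N x | y \in A) f y.
Proof. by rewrite (perm_big _ (nbrs_perm x)) big_filter. Qed.

End finite_neighbours.

Section regular_tree.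
Context (d : nat).
Implicit Types x y : tree d.

Lemma code_inj : injective (fun x => sval x).
Proof.
by move=> [s ps] [t pt] /= st; subst t; congr exist; exact: bool_irrelevance.
Qed.

Definition depth x : nat := size (sval x).

Definition tree_children x : seq (tree d) :=
  pmap insub [seq i :: sval x | i <- iota 0 (if sval x is [::] then d else d.-1)].

Definition tree_nbrs x : seq (tree d) :=
  (if x == tree_root d then [::] else [:: parent x]) ++ tree_children x.

Lemma depth_eq0 x : (depth x == 0%N) = (x == tree_root d).
Proof.
apply/eqP/eqP => [|-> //]; rewrite /depth => /size0nil s0.
by apply: code_inj; rewrite s0.
Qed.

Lemma depth_parent x : depth (parent x) = (depth x).-1.
Proof. by rewrite /depth /= size_behead. Qed.

Lemma parent_root : parent (tree_root d) = tree_root d.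
Proof. by apply: code_inj. Qed.

Lemma mem_tree_children x y :
  (y \in tree_children x) = (y != tree_root d) && (parent y == x).
Proof.
rewrite mem_pmap_sub; apply/mapP/andP => [[i]|].
  rewrite mem_iota /= add0n => _ yE; split; first by rewrite -depth_eq0 /depth yE.
  by apply/eqP/code_inj; rewrite /= yE.
case: y => -[|i s] /= si [y0 /eqP <-] //.
exists i => //=; rewrite mem_iota add0n.
by case/andP: si; case: s.
Qed.

Lemma tree_children_uniq x : uniq (tree_children x).
Proof.
apply: pmap_sub_uniq; rewrite map_inj_uniq ?iota_uniq//.
by move=> i j [].
Qed.

Lemma tree_nbrs_uniq x : uniq (tree_nbrs x).
Proof.
rewrite /tree_nbrs; case: ifPn => x0 /=; first exact: tree_children_uniq.
rewrite tree_children_uniq andbT mem_tree_children negb_and negbK -implyNb.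
apply/implyP => px0; apply/eqP => /(congr1 depth); rewrite !depth_parent.
move: x0; rewrite -depth_eq0; case: (depth x) => //= n _ /eqP.
by rewrite ltn_eqF// (leq_ltn_trans (leq_pred n)).
Qed.

Lemma tree_adjE x y : tree_adj x y = (y \in tree_nbrs x).
Proof.
rewrite /tree_adj /tree_nbrs mem_cat mem_tree_children orbC; congr (_ || _).
by case: (x == tree_root d); rewrite //= inE eq_sym.
Qed.

Lemma size_tree_children x :
  size (tree_children x) = if x == tree_root d then d else d.-1.
Proof.
rewrite size_pmap_sub; set s := map _ _.
have -> : count (tree_code d) s = size s.
  apply/eqP; rewrite -all_count; apply/allP => _ /mapP[i + ->] /=.
  rewrite mem_iota add0n /= => ilt; apply/andP; split; last exact: (svalP x).
  by move: ilt; case: (sval x).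
rewrite size_map size_iota -depth_eq0 /depth; by case: (sval x).
Qed.

(** Since the root is its own parent, letting [j] run over all integers tests exactly the vertices
    from [x] up to the root. *)
Definition ancestral (B : set (tree d)) : set (tree d) :=
  [set x | forall j, B (iter j (@parent d) x)].

Lemma iter_parent_depth x : iter (depth x) (@parent d) x = tree_root d.
Proof.
move: {2}(depth x) (erefl (depth x)) => n; elim: n x => [|n ih] x xn.
  by rewrite xn /=; apply/eqP; rewrite -depth_eq0 xn.
by rewrite xn iterSr -(ih (parent x)) depth_parent xn.
Qed.

Lemma ancestralP B x : ancestral B x <-> B x /\ ancestral B (parent x).
Proof.
split=> [Bx|[Bx Bp] [//|j]]; last by rewrite iterSr.
by split=> [|j]; [exact: (Bx 0%N)|rewrite -iterSr; exact: Bx].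
Qed.

Lemma ancestral_root B : ancestral B (tree_root d) <-> B (tree_root d).
Proof.
split=> [/ancestralP[]//|Br j]; elim: j => //= j.
by have -> : iter j (@parent d) (tree_root d) = tree_root d; 
  [elim: j => //= j ->; exact: parent_root|rewrite parent_root].
Qed.

(** Along a path from the root, a step up keeps the ancestral line in [B] and a step down adds one
    vertex of [B]. Conversely, the ancestral line is itself a path. *)
Lemma component_tree B :
  component (@tree_adj d) B (tree_root d) = ancestral B.
Proof.
apply/seteqP; split => x.
  move=> [p [pp <- pB]].
  have : ancestral B (tree_root d) by apply/ancestral_root/pB; rewrite inE eqxx.
  have {pB} : forall z, z \in p -> B z by move=> z zp; apply: pB; rewrite inE zp orbT.
  elim: p (tree_root d) pp => [//|y p ih] z /= /andP[zy yp] pB Bz.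
  apply: ih => //; first by move=> t tp; apply: pB; rewrite inE tp orbT.
  move: zy; rewrite /tree_adj => /orP[/andP[_ /eqP yz]|/andP[_ /eqP <-]].
    by apply/ancestralP; rewrite yz; split => //; apply: pB; rewrite inE eqxx.
  by have /ancestralP[] := Bz.
move: {2}(depth x) (erefl (depth x)) => n; elim: n x => [|n ih] x xn Bx.
  have -> : x = tree_root d by apply/eqP; rewrite -depth_eq0 xn.
  exists [::]; split => // z; rewrite inE => /eqP ->.
  by have := Bx (depth x); rewrite iter_parent_depth.
have /ancestralP[Bxx Bp] := Bx.
have [|p [pp lp pB]] := ih (parent x) _ Bp; first by rewrite depth_parent xn.
exists (rcons p x); split.
- by rewrite rcons_path pp lp /tree_adj eqxx -depth_eq0 xn.
- by rewrite last_rcons.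
- move=> z; rewrite -rcons_cons mem_rcons inE => /orP[/eqP -> //|]; exact: pB.
Qed.

Lemma finite_depth n : finite_set [set x | (depth x <= n)%N].
Proof.
elim: n => [|n ih].
  apply: (@sub_finite_set _ _ [set tree_root d]) => // x /=.
  by rewrite leqn0 depth_eq0 => /eqP.
apply: (@sub_finite_set _ _ ([set x | (depth x <= n)%N] `|`
    \bigcup_(x in [set x | (depth x <= n)%N]) [set` tree_children x])).
  move=> x /= xn; have [xle|nx] := leqP (depth x) n; first by left.
  right; exists (parent x) => /=; first by rewrite depth_parent -ltnS prednK// (leq_trans _ nx).
  by rewrite mem_tree_children eqxx andbT -depth_eq0; case: (depth x) nx.
rewrite finite_setU; split => //; apply: bigcup_finite => // x _; exact: finite_seq.
Qed.

End regular_tree.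

(** * Conductance and escape probability on a subtree *)

Section tree_walk.
Context (R : realType) (d : nat) (A : set (tree d)).
Hypothesis d0 : (0 < d)%N.
Hypothesis Aroot : A (tree_root d).
Hypothesis Aparent : forall x, A x -> A (parent x).
Implicit Types x y : tree d.

Local Notation root := (tree_root d).
Local Notation M := (srw_mean (R := R) (@tree_adj d) A).

Fixpoint tree_conductance (k : nat) x : R :=
  if x \in A then
    if k is k'.+1 then
      let S := \sum_(y <- tree_children x) tree_conductance k' y in S / (1 + S)
    else 1
  else 0.

Lemma tree_conductance_itv k x : 0 <= tree_conductance k x <= 1.
Proof.
elim: k x => [|k ih] x /=; case: ifP => _; rewrite ?lexx ?ler01//.
set S := \sum_(y <- _) _.
have S0 : 0 <= S by apply: sumr_ge0 => y _; case/andP: (ih y).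
have S1 : 0 < 1 + S by lra.
by rewrite divr_ge0 ?ler_pdivrMr//=; lra.
Qed.

Lemma tree_conductance_ge0 k x : 0 <= tree_conductance k x.
Proof. by case/andP: (tree_conductance_itv k x). Qed.

Lemma tree_conductance_notin k x : x \notin A -> tree_conductance k x = 0.
Proof. by case: k => [|k] /negbTE /= ->. Qed.

Let deg x : degree (@tree_adj d) A x = count (fun y => y \in A) (tree_nbrs x).
Proof. by apply: degreeE; [exact: tree_adjE|exact: tree_nbrs_uniq]. Qed.

Let meanE f x : degree (@tree_adj d) A x != 0%N ->
  M f x = (\sum_(y <- tree_nbrs x | y \in A) f y) / (degree (@tree_adj d) A x)%:R.
Proof.
move=> d1; rewrite /srw_mean (negbTE d1) (sum_nbrs (N := @tree_nbrs d))//.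
  exact: tree_adjE.
exact: tree_nbrs_uniq.
Qed.

(* Voltage, in units where the root has [1] and generation [n] has [0]: it is
   multiplied by [1 - tree_conductance] across each edge. *)
Definition voltage (n : nat) x : R := \prod_(j < depth x)
  (1 - tree_conductance (n - (depth x - j)) (iter j (@parent d) x)).

Lemma voltage_itv n x : 0 <= voltage n x <= 1.
Proof.
rewrite /voltage; apply/andP; split.
  by apply: prodr_ge0 => j _; case/andP: (tree_conductance_itv (n - (depth x - j)) (iter j (@parent d) x)); lra.
apply: prodr_ile1 => j _.
by case/andP: (tree_conductance_itv (n - (depth x - j)) (iter j (@parent d) x)) => *; apply/andP; split; lra.
Qed.

Lemma voltage_root n : voltage n root = 1.
Proof. by rewrite /voltage big_ord0. Qed.

Lemma voltage_child n x : x != root ->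
  voltage n x = (1 - tree_conductance (n - depth x) x) * voltage n (parent x).
Proof.
rewrite -depth_eq0 /voltage depth_parent; case: (depth x) => // m _.
rewrite big_ord_recl /= subn0; congr (_ * _); apply: eq_bigr => j _.
by rewrite -iterSr /= /bump /= add1n subSS.
Qed.

(** Kirchhoff's law. With [S] the total conductance below [x], the voltage of the parent is [1 + S]
    times that of [x], and the children together fall short by [S] times it. Children outside [A]
    have conductance 0 and drop out. *)
Lemma voltage_harmonic n x : A x -> x != root -> (depth x < n)%N ->
  \sum_(y <- tree_nbrs x | y \in A) voltage n y =
  (degree (@tree_adj d) A x)%:R * voltage n x.
Proof.
move=> Ax x0 xn; rewrite deg /tree_nbrs (negbTE x0) /= big_cons.
have Ap : parent x \in A by rewrite inE; exact: Aparent.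
rewrite Ap add1n -natr1.
pose S := \sum_(y <- tree_children x) tree_conductance (n - (depth x).+1) y.
have S0 : 0 <= S by apply: sumr_ge0 => y _; exact: tree_conductance_ge0.
have vx : voltage n (parent x) = voltage n x * (1 + S).
  rewrite (voltage_child n x0) -(subnSK xn) /= mem_set// -/S.
  have S1 : 1 + S != 0 by rewrite gt_eqF//; lra.
  by field.
have vc y : y \in tree_children x -> voltage n y =
    voltage n x - voltage n x * tree_conductance (n - (depth x).+1) y.
  rewrite mem_tree_children => /andP[y0 /eqP yx]; rewrite (voltage_child n y0) yx.
  have -> : depth y = (depth x).+1.
    by move: y0; rewrite -yx -depth_eq0 depth_parent; case: (depth y).
  by ring.
rewrite vx big_seq_cond (eq_bigr (fun y => voltage n x -
   voltage n x * tree_conductance (n - (depth x).+1) y)); last first.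
  by move=> y /andP[yx _]; exact: vc.
rewrite -big_seq_cond sumrB -mulr_sumr.
have -> : \sum_(y <- tree_children x | y \in A) tree_conductance (n - (depth x).+1) y = S.
  rewrite /S [RHS](bigID (fun y => y \in A))/= [X in _ = _ + X]big1 ?addr0//.
  by move=> y; exact: tree_conductance_notin.
rewrite big_const_seq iter_addr_0.
rewrite -[X in X = _]/(voltage n x * (1 + S) + (voltage n x *+ _ - _)) -mulr_natr.
by ring.
Qed.

Local Notation avoid := (fun y => y != root).

Let visit_ge0 Es x : 0 <= visit_prob R (@tree_adj d) A Es x.
Proof.
elim: Es x => //= E Es ih x; rewrite /srw_mean; case: ifP => _.
  by rewrite mulr_ge0.
by rewrite divr_ge0// sumr_ge0// => y _; rewrite mulr_ge0.
Qed.

(** The function [1 - voltage] vanishes at the root, is at most 1, and is harmonic at the other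
    vertices above generation [n], which the walk cannot pass in the [k] steps considered. *)
Lemma voltage_visit n k x : A x -> (depth x + k <= n)%N ->
  1 - voltage n x <= (avoid x)%:R * visit_prob R (@tree_adj d) A (nseq k avoid) x.
Proof.
elim: k x => [|k ih] x Ax.
  rewrite addn0 => xn; case: (eqVneq x root) => [->|x0] /=.
    by rewrite voltage_root subrr mul0r.
  by rewrite mul1r; have := voltage_itv n x; lra.
move=> xn; case: (eqVneq x root) => [->|x0]; first by rewrite voltage_root subrr mul0r.
have d1 : degree (@tree_adj d) A x != 0%N.
  rewrite deg -lt0n -has_count; apply/hasP; exists (parent x).
    by rewrite /tree_nbrs (negbTE x0) inE eqxx.
  by rewrite inE; exact: Aparent.
have dp : 0 < (degree (@tree_adj d) A x)%:R :> R by rewrite ltr0n lt0n.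
rewrite mul1r /= meanE// ler_pdivlMr// mulrBl mul1r mulrC.
have xn' : (depth x < n)%N by rewrite (leq_trans _ xn)// addnS ltnS leq_addr.
rewrite -voltage_harmonic//.
have -> : (degree (@tree_adj d) A x)%:R = \sum_(y <- tree_nbrs x | y \in A) (1 : R).
  by rewrite big_const_seq iter_addr_0 deg.
rewrite -sumrB big_seq_cond [leRHS]big_seq_cond; apply: ler_sum => y /andP[yx yA].
apply: ih; first by rewrite inE in yA.
apply: leq_trans xn; rewrite addnS -addSn leq_add2r.
move: yx; rewrite /tree_nbrs (negbTE x0) inE mem_tree_children => /orP[/eqP ->|/andP[_ /eqP <-]].
  by rewrite depth_parent (leq_trans (leq_pred _)).
by rewrite depth_parent leqSpred.
Qed.

(** If [y] lies in [A], the first step leads to it with probability at least [1 / d]. With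
    generation [k + 1] at voltage 0, the value of [1 - voltage] at [y] is exactly its
    conductance. *)
Lemma escape_ge k y : parent y = root -> y != root ->
  tree_conductance k y / d%:R <=
  visit_prob R (@tree_adj d) A (nseq k.+1 avoid) root.
Proof.
move=> py y0; have dp : 0 < d%:R :> R by rewrite ltr0n.
have [yA|yA] := boolP (y \in A); last first.
  by rewrite tree_conductance_notin// mul0r visit_ge0.
have yr : y \in tree_children root by rewrite mem_tree_children y0 py eqxx.
have d1 : degree (@tree_adj d) A root != 0%N.
  rewrite deg -lt0n -has_count; apply/hasP; exists y => //.
have d1p : 0 < (degree (@tree_adj d) A root)%:R :> R by rewrite ltr0n lt0n.
have dd : (degree (@tree_adj d) A root)%:R <= d%:R :> R.
  rewrite ler_nat deg (leq_trans (count_size _ _))// /tree_nbrs eqxx.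
  by rewrite size_tree_children eqxx.
rewrite /= meanE//; apply: (@le_trans _ _ (tree_conductance k y /
    (degree (@tree_adj d) A root)%:R)).
  by rewrite ler_wpM2l ?tree_conductance_ge0// lef_pV2 ?posrE.
rewrite ler_pM2r ?invr_gt0// /tree_nbrs eqxx /=.
rewrite big_mkcond (bigD1_seq y)//=; last exact: tree_children_uniq.
rewrite yA; apply: ler_wpDr.
  by apply: sumr_ge0 => z _; case: ifP => // _; rewrite mulr_ge0.
have dy : depth y = 1%N.
  move: y0; rewrite -depth_eq0; have := congr1 (@depth d) py; rewrite depth_parent.
  by case: (depth y) => [|[]].
have := @voltage_visit k.+1 k y; rewrite inE in yA; move=> /(_ yA).
rewrite dy add1n => /(_ (leqnn _)); rewrite (voltage_child _ y0) py voltage_root mulr1.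
by rewrite dy subSS subn0 opprB addrC subrK.
Qed.

End tree_walk.

(** * Branches at the root as trees of words *)

Section word_vertices.
Context (d : nat).

Let word_vertex_code (i0 : 'I_d) (u : seq 'I_d.-1) :
  tree_code d (map val u ++ [:: val i0]).
Proof.
elim: u => [|i u ih]; first by rewrite /= ltn_ord.
rewrite /= ih andbT; have := ltn_ord i.
by case: (map val u) => [|j s].
Qed.

(** Below the child [i0] of the root every vertex has [d.-1] children, so this branch is a full tree
    of words; words and codes are both read upwards. *)
Definition word_vertex (i0 : 'I_d) (u : seq 'I_d.-1) : tree d :=
  exist _ (map val u ++ [:: val i0]) (word_vertex_code i0 u).

Lemma parent_word i0 i u : parent (word_vertex i0 (i :: u)) = word_vertex i0 u.
Proof. exact: code_inj. Qed.

Lemma parent_word_nil i0 : parent (word_vertex i0 [::]) = tree_root d.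
Proof. exact: code_inj. Qed.

Lemma depth_word i0 u : depth (word_vertex i0 u) = (size u).+1.
Proof. by rewrite /depth /= size_cat size_map addn1. Qed.

Lemma word_neq_root i0 u : word_vertex i0 u != tree_root d.
Proof. by rewrite -depth_eq0 depth_word. Qed.

Lemma word_vertex_inj i0 : injective (word_vertex i0).
Proof.
move=> u v /(congr1 (fun x : tree d => sval x)) /=.
by rewrite !cats1 => /rcons_inj[/(inj_map val_inj)].
Qed.

Lemma word_vertex_surj (x : tree d) : x != tree_root d ->
  exists i0 u, x = word_vertex i0 u.
Proof.
case: x => s sd; rewrite -depth_eq0 /depth /=; elim: s sd => [//|i s ih] sd _.
have H : tree_code d (i :: s) by [].
move: H => /= /andP[id sd']; case: s ih sd id sd' => [|j s] ih sd id sd'.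
  by exists (Ordinal id), [::]; apply: code_inj.
have [//|i0 [u /(congr1 (fun x : tree d => sval x)) /= E]] := ih sd'.
by exists i0, (Ordinal id :: u); apply: code_inj; rewrite /= E.
Qed.

Lemma root_children_word (x : tree d) : x != tree_root d ->
  parent x = tree_root d -> exists i0, x = word_vertex i0 [::].
Proof.
move=> /word_vertex_surj[i0 [[|i u] ->]]; first by exists i0.
by rewrite parent_word => /eqP; rewrite (negbTE (word_neq_root _ _)).
Qed.

Lemma word_children i0 u :
  perm_eq (tree_children (word_vertex i0 u))
          [seq word_vertex i0 (i :: u) | i <- enum 'I_d.-1].
Proof.
apply: uniq_perm; first exact: tree_children_uniq.
  by rewrite map_inj_uniq ?enum_uniq// => i j /word_vertex_inj[].
move=> y; rewrite mem_tree_children; apply/andP/mapP => [[y0 /eqP py]|[i _ ->]].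
  have [j0 [v yE]] := word_vertex_surj y0; subst y.
  case: v py {y0} => [|i v].
    by rewrite parent_word_nil => /esym/eqP; rewrite (negbTE (word_neq_root _ _)).
  rewrite parent_word => /(congr1 (fun x : tree d => sval x)) /=.
  rewrite !cats1 => /rcons_inj[/(inj_map val_inj) -> /val_inj ->].
  by exists i; rewrite ?mem_enum.
by rewrite word_neq_root parent_word.
Qed.

Section field_on_words.
Context (R : realType) (rho c h : R) (phi zeta : tree d -> R) (A : set (tree d)).
Hypothesis phiE : forall y, y != tree_root d ->
  phi y = rho * phi (parent y) + c * zeta y.
Variable i0 : 'I_d.
Hypothesis AE : forall u,
  A (word_vertex i0 u) <-> A (parent (word_vertex i0 u)) /\ h <= phi (word_vertex i0 u).

(** The state of the branching chain at [u]: the value at its parent and the noise of its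
    subtree. *)
Let state u : R * noise R (seq 'I_d.-1) :=
  (phi (parent (word_vertex i0 u)), fun v => zeta (word_vertex i0 (v ++ u))).

Let root_value_state u : root_value rho c (state u).1 (state u).2 =
  phi (word_vertex i0 u).
Proof. by rewrite phiE ?word_neq_root. Qed.

Let child_state i u : child rho c i (state u) = state (i :: u).
Proof.
rewrite /child root_value_state /state parent_word; congr pair.
by apply/funext => v; rewrite /subnoise /= cat_rcons.
Qed.

Lemma tree_conductance_word k u : A (parent (word_vertex i0 u)) ->
  tree_conductance R A k (word_vertex i0 u) =
  conductance rho c h k (phi (parent (word_vertex i0 u)),
                         fun v => zeta (word_vertex i0 (v ++ u))).
Proof.
rewrite -/(state u); elim: k u => [|k ih] u Ap.
  rewrite /= -/(root_value _ _ _ _) (root_value_state u).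
  by congr (if _ then _ else _); apply/idP/idP; rewrite inE => H; [case/AE: H|apply/AE].
rewrite conductanceS root_value_state /=.
have -> : (word_vertex i0 u \in A) = (h <= phi (word_vertex i0 u)).
  by apply/idP/idP; rewrite inE => H; [case/AE: H|apply/AE].
case: ifP => // hu; have Au : A (word_vertex i0 u) by exact/AE.
have -> : \sum_(y <- tree_children (word_vertex i0 u)) tree_conductance R A k y =
    \sum_i conductance rho c h k (child rho c i (state u)).
  rewrite (perm_big _ (word_children i0 u)) big_map big_enum/=.
  by apply: eq_bigr => i _; rewrite child_state; apply: ih; rewrite parent_word.
by [].
Qed.

Lemma alive_word t u : A (word_vertex i0 (t ++ u)) ->
  alive rho c h (size t) (phi (parent (word_vertex i0 u)),
                         fun v => zeta (word_vertex i0 (v ++ u))).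
Proof.
rewrite -/(state u).
have anc s v : A (word_vertex i0 (s ++ v)) -> A (word_vertex i0 v).
  elim: s => [//|i s ih] /AE[]; rewrite /= parent_word => /ih//.
(* The last letter of [t] is the branch taken at [u], hence the one that [alive] examines first. *)
elim/last_ind: t u => [|t i ih] u.
  by move=> /AE[_ hu]; rewrite /= root_value_state hu.
rewrite cat_rcons size_rcons => Atu /=.
have /AE[_ hu] : A (word_vertex i0 u) by exact: (anc [:: i]) (anc t _ Atu).
rewrite root_value_state hu /=; apply/existsP; exists i.
by rewrite child_state; exact: ih.
Qed.

End field_on_words.

End word_vertices.

(** * Measurability of transience *)

Section transience_measurable.
Context (R : realType) (d : nat) (disp : measure_display)
  (Omega : measurableType disp) (A : Omega -> set (tree d)).
Hypothesis mA : forall x, measurable [set w | A w x].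

Local Notation adj := (@tree_adj d).

Let measurable_mem x : measurable_fun setT (fun w => x \in A w).
Proof.
apply: (measurable_fun_bool true); rewrite setTI.
rewrite (_ : _ @^-1` _ = [set w | A w x])//.
by apply/seteqP; split => w /=; [move=> /set_mem|move=> /mem_set ->].
Qed.

Lemma measurable_has (I : Type) (s : seq I) (f : I -> Omega -> bool) :
  (forall i, measurable_fun setT (f i)) ->
  measurable_fun setT (fun w => has (fun i => f i w) s).
Proof.
move=> mf; elim: s => [|i s ih] /=; first exact: measurable_cst.
exact: measurable_or.
Qed.

Let measurable_srw_mean (f : Omega -> tree d -> R) x :
  (forall y, measurable_fun setT (f ^~ y)) ->
  measurable_fun setT (fun w => srw_mean adj (A w) (f w) x).
Proof.
move=> mf.
pose g y w : R := if y \in A w then f w y else 0.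
pose n y w : R := if y \in A w then 1 else 0.
have mg y : measurable_fun setT (g y) by exact: measurable_fun_ifT.
have mn y : measurable_fun setT (n y) by exact: measurable_fun_ifT.
(* The random degree is a sum over the fixed list of neighbours; the maximum with 1 keeps the
   denominator positive in the case where the quotient is not selected. *)
have -> : (fun w => srw_mean adj (A w) (f w) x) = fun w =>
    if has (fun y => y \in A w) (tree_nbrs x)
    then (\sum_(y <- tree_nbrs x) g y w) *
         (Num.max 1 (\sum_(y <- tree_nbrs x) n y w))^-1
    else f w x.
  apply/funext => w; rewrite /srw_mean.
  rewrite (degreeE (@tree_adjE d) (@tree_nbrs_uniq d)) has_count lt0n.
  case: eqP => //= /eqP c0; congr (_ / _).
    by rewrite (sum_nbrs (@tree_adjE d) (@tree_nbrs_uniq d)) big_mkcond.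
  rewrite -big_mkcond big_const_seq iter_addr_0 max_r//.
  by rewrite ler1n lt0n.
apply: measurable_fun_ifT => //; first exact: measurable_has.
apply: measurable_funM; first by apply: measurable_sum => y; exact: mg.
apply: (@measurable_invr_gt _ _ _ 1) => //.
  by move=> w; rewrite le_max lexx.
by apply: measurable_maxr => //; apply: measurable_sum => y; exact: mn.
Qed.

Lemma measurable_visit_prob (Es : seq (pred (tree d))) x :
  measurable_fun setT (fun w => visit_prob R adj (A w) Es x).
Proof.
elim: Es x => [|E Es ih] x /=; first exact: measurable_cst.
apply: (measurable_srw_mean (f := fun w y => (E y)%:R * visit_prob R adj (A w) Es y)).
by move=> y; apply: measurable_funM => //; exact: ih.
Qed.

Lemma measurable_not_transient (P : probability Omega R) (zeta : nat -> {RV P >-> R})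
    (r : tree d) (delta : R) : iid_normal zeta ->
  measurable [set w | ~ delta_transient adj (A w) r delta].
Proof.
move=> iid; rewrite (_ : [set w | _] = ~` \bigcap_n
  [set w | delta <= visit_prob R adj (A w) (nseq n (fun y => y != r)) r]).
  apply: measurableC; apply: bigcapT_measurable => n.
  rewrite -[X in measurable X]setTI (_ : [set w | _] =
    (fun w => visit_prob R adj (A w) (nseq n (fun y => y != r)) r) @^-1` `[delta, +oo[).
    exact: measurable_visit_prob.
  by apply/seteqP; split => w /=; rewrite in_itv/= andbT.
congr (~` _); apply/seteqP; split => w /=.
  by move=> /(delta_transientP adj (A w) r iid) H n _; exact: H.
by move=> H; apply/(delta_transientP adj (A w) r iid) => n; exact: H.
Qed.

End transience_measurable.

(** * Transience when some mean is large *)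

Section supercritical.
Context (R : realType) (d : nat) (h : R).
Hypothesis d3 : (3 <= d)%N.

Local Notation rho := ((d%:R - 1)^-1 : R).
Local Notation c := (Num.sqrt (d%:R / (d%:R - 1)) : R).

Lemma tree_rho_gt0 : 0 < rho.
Proof. by rewrite invr_gt0 subr_gt0 (@ltr_nat R 1) (leq_trans _ d3). Qed.

Lemma tree_c_gt0 : 0 < c.
Proof.
rewrite sqrtr_gt0 divr_gt0 ?ltr0n ?(leq_trans _ d3)//.
by rewrite subr_gt0 (@ltr_nat R 1) (leq_trans _ d3).
Qed.

Let bound n : R := conductance_bound d.-1 rho c h n.

(** One branch at the root other than that of [obar] suffices: with probability at least
    [bound n / 2] all its conductances are at least [bound n / 2], and then the walk escapes through
    it with probability at least [bound n / 2 / d]. *)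
Lemma supercritical_not_transient n (a delta : R) (obar : tree d)
    (disp : measure_display) (Omega : measurableType disp)
    (P : probability Omega R) (phi : tree d -> {RV P >-> R}) :
  ((2 * n.+1%:R)%:E <= mean_size d.-1 rho c h n h)%E ->
  h <= a -> tree_adj (tree_root d) obar -> is_gff_at a phi ->
  delta <= 1 -> delta <= bound n / 2 / d%:R ->
  (q_prob obar h delta phi <= (1 - bound n / 2)%:E)%E.
Proof.
move=> un ha ro [zeta [ind law phi0 phiE]] d1 db.
have b0 : (0 < d.-1)%N by case: d d3 => [|[]].
have [j0 obarE] : exists j0, obar = word_vertex j0 [::].
  move: ro; rewrite /tree_adj eqxx /= orbF => /andP[nr /eqP pr].
  exact: root_children_word.
have [i0 i0j0] : exists i0 : 'I_d, i0 != j0.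
  have lt0 : (0 < d)%N by exact: leq_trans d3.
  have lt1 : (1 < d)%N by exact: leq_trans d3.
  case: (eqVneq (Ordinal lt0) j0) => [<-|]; last by exists (Ordinal lt0).
  by exists (Ordinal lt1).
pose W := word_vertex i0.
have iidW : iid_normal (zeta \o W).
  split; last by move=> u; apply: law; exact: word_neq_root.
  apply: (independent_on_comp (@word_vertex_inj d i0) _ ind) => u /=.
  by apply/eqP; exact: word_neq_root.
(* Normal variables along one ray of the branch serve to drive the walk. *)
have iidN : iid_normal (fun n => (zeta \o W) (nseq n (Ordinal b0))).
  apply: (iid_normal_comp (iota := fun n => nseq n (Ordinal b0)) _ iidW).
  by move=> m k /(congr1 size); rewrite !size_nseq.
pose A w := level_cluster h (fun x => phi x w) `&` tree_plus obar.
have AE w : A w = ancestral [set x | h <= phi x w] `&` ancestral (~` [set obar]).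
  by rewrite /A /level_cluster /tree_plus !component_tree.
have mA x : measurable [set w | A w x].
  have [px|npx] := pselect (ancestral (~` [set obar]) x); last first.
    rewrite (_ : [set w | _] = set0)//; apply/seteqP; split => // w /=.
    by rewrite AE => -[].
  rewrite (_ : [set w | _] = \bigcap_j [set w | h <= phi (iter j (@parent d) x) w]).
    apply: bigcapT_measurable => j.
    rewrite -[X in measurable X]setTI (_ : [set w | _] =
      phi (iter j (@parent d) x) @^-1` `[h, +oo[); first exact: measurable_funPT.
    by apply/seteqP; split => w /=; rewrite in_itv/= andbT.
  apply/seteqP; split => w /=; rewrite AE; first by move=> [H _] j _; exact: H.
  by move=> H; split => // j; exact: H.
have Aparent w x : A w x -> A w (parent x).
  by rewrite AE => -[/ancestralP[_ ?] /ancestralP[_ ?]].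
have Aroot w : A w (tree_root d).
  rewrite AE; split; apply/ancestral_root; first by rewrite /= phi0.
  move=> /= ro'; move: obarE; rewrite -ro' => /eqP.
  by rewrite eq_sym (negbTE (word_neq_root _ _)).
have Wobar u : W u <> obar.
  rewrite obarE => /(congr1 (fun x : tree d => sval x)) /= /(congr1 (last 0%N)).
  rewrite last_cat /= => /val_inj e; by rewrite e eqxx in i0j0.
have AW w u : A w (W u) <-> A w (parent (W u)) /\ h <= phi (W u) w.
  rewrite AE; split=> [[/ancestralP[hu hp] /ancestralP[_ op]]|[[hp op] hu]] //.
  by split; apply/ancestralP; split => //; exact: Wobar.
have mq : measurable [set w | ~ delta_transient (@tree_adj d) (A w) (tree_root d) delta].
  exact: (measurable_not_transient mA _ _ iidN).
have dp : 0 < d%:R :> R by rewrite ltr0n; exact: leq_trans d3.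
have t0 : 0 < bound n by apply: conductance_bound_gt0; exact: tree_c_gt0.
have likely := conductance_likely (ltW t0)
  (fun k => mean_conductance_ge tree_rho_gt0 tree_c_gt0 iidW b0 un k ha).
pose T := [set w | forall k, bound n / 2 <=
  conductance rho c h k (a, noise_of (zeta \o W) w)].
pose S := [set w | ~ delta_transient (@tree_adj d) (A w) (tree_root d) delta].
have TS : T `<=` ~` S.
  move=> w Tw; apply: contrapT => nT; apply: nT => nd; apply: nd.
  apply/(delta_transientP _ _ _ iidN) => -[|k]; first by rewrite /= d1.
  apply: le_trans db _; apply: le_trans (escape_ge _ (leq_trans _ d3) (Aparent w) k
    (parent_word_nil i0) (word_neq_root i0 [::])) => //.
  rewrite ler_pM2r ?invr_gt0//.
  rewrite (tree_conductance_word (phiE w) (AW w)); last first.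
    by rewrite parent_word_nil; exact: Aroot.
  rewrite parent_word_nil phi0; apply: le_trans (Tw k) _.
  by rewrite le_eqVlt; apply/orP; left; apply/eqP; congr conductance;
    congr pair; apply/funext => v; rewrite cats0.
have mT : measurable T.
  rewrite (_ : T = \bigcap_k [set w | bound n / 2 <=
      conductance rho c h k (a, noise_of (zeta \o W) w)]).
    by apply: bigcapT_measurable => k; exact: measurable_conductance_ge.
  by apply/seteqP; split => w /= H k; [move=> _|]; exact: H.
have : ((bound n / 2)%:E <= P (~` S))%E.
  apply: le_trans likely _; apply: le_measure; rewrite ?inE//.
  exact: measurableC.
rewrite probability_setC// /q_prob -/(A _) -/S.
have -> : P S = (fine (P S))%:E by rewrite fineK// fin_num_measure.
by rewrite -EFinB !lee_fin; lra.
Qed.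

End supercritical.

(** * Gaussian sums *)

Section lebesgue_affine.
Context (R : realType).
Local Notation mu := (@lebesgue_measure R).

(* Lebesgue measure on [R] itself rather than on its copy [measurableTypeR R]. *)
Definition lebesgue : set R -> \bar R := mu.

Let lebesgue0 : lebesgue set0 = 0%E. Proof. exact: measure0. Qed.

Let lebesgue_ge0 A : (0 <= lebesgue A)%E. Proof. exact: measure_ge0. Qed.

Let lebesgue_sigma_additive : semi_sigma_additive lebesgue.
Proof.
by move=> F mF tF mU; exact: (@measure_semi_sigma_additive _ _ _ mu).
Qed.

HB.instance Definition _ := isMeasure.Build _ R R lebesgue
  lebesgue0 lebesgue_ge0 lebesgue_sigma_additive.

Let lebesgue_sigma_finite : sigma_finite setT lebesgue.
Proof. by have [F FT mF] := sigma_finiteT mu; exists F. Qed.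

HB.instance Definition _ :=
  Measure_isSigmaFinite.Build _ R R lebesgue lebesgue_sigma_finite.

Lemma integral_lebesgue (D : set R) (f : R -> \bar R) : measurable D ->
  measurable_fun D f -> (forall x, D x -> 0 <= f x)%E ->
  (\int[lebesgue]_(x in D) f x = \int[mu]_(x in D) f x)%E.
Proof.
move=> mD mf f0.
pose i : measurableTypeR R -> R := id.
have mi : measurable_fun setT i by move=> _ A mA; rewrite setTI.
rewrite -[RHS](ge0_integral_pushforward mi mu (D := D))//.
by move=> x; rewrite inE; exact: f0.
Qed.

(** The image of Lebesgue measure under the affine map, multiplied by the absolute value of [a],
    gives half-open intervals their length, which characterizes Lebesgue measure. *)
Lemma ge0_integral_affine (a t : R) (f : R -> \bar R) : a != 0 ->
  measurable_fun setT f -> (forall x, 0 <= f x)%E ->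
  (\int[lebesgue]_x f x =
   (`|a|%R)%:E * \int[lebesgue]_x f (a * x + t)%R)%E.
Proof.
move=> a0 mf f0.
have mg : measurable_fun setT (fun x : R => a * x + t).
  by apply: measurable_funD => //; exact: measurable_funM.
have ap : 0 < `|a| by rewrite normr_gt0.
rewrite !integral_lebesgue//; last exact: measurableT_comp.
pose g : measurableTypeR R -> measurableTypeR R := fun x => a * x + t.
pose k : {nonneg R} := NngNum (normr_ge0 a).
have mg' : measurable_fun setT g by exact: mg.
pose nu := measure_function_pushforward__canonical__measure_function_Measure mu mg'.
transitivity (\int[mscale k nu]_x f x)%E; last first.
  by rewrite ge0_integral_mscale// ge0_integral_pushforward.
apply: eq_measure_integral => A mA _.
apply: lebesgue_measure_unique => // _ [[u v]] /= uv <-.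
rewrite -[RHS]/((`|a|%R)%:E * mu (g @^-1` `]u, v]%classic))%E.
have [aneg|apos|a0'] := ltrgtP a 0; last by rewrite a0' eqxx in a0.
- have -> : g @^-1` `]u, v]%classic = `[(v - t) / a, (u - t) / a[%classic.
    apply/seteqP; split => x /=; rewrite !in_itv/= /g ler_ndivrMr// ltr_ndivlMr//.
      by move=> /andP[h1 h2]; apply/andP; split; lra.
    by move=> /andP[h1 h2]; apply/andP; split; lra.
  rewrite !lebesgue_measure_itv/= !lte_fin ltr_nM2r ?invr_lt0// ltrD2r.
  case: ifP => _; last by rewrite mule0.
  by rewrite -!EFinB -EFinM; congr EFin; rewrite ltr0_norm//; field; rewrite lt_eqF.
- have -> : g @^-1` `]u, v]%classic = `](u - t) / a, (v - t) / a]%classic.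
    apply/seteqP; split => x /=; rewrite !in_itv/= /g ltr_pdivrMr// ler_pdivlMr//.
      by move=> /andP[h1 h2]; apply/andP; split; lra.
    by move=> /andP[h1 h2]; apply/andP; split; lra.
  rewrite !lebesgue_measure_itv/= !lte_fin ltr_pM2r ?invr_gt0// ltrD2r.
  case: ifP => _; last by rewrite mule0.
  by rewrite -!EFinB -EFinM; congr EFin; rewrite gtr0_norm//; field; rewrite gt_eqF.
Qed.

End lebesgue_affine.

(** * Density and stability of the normal law *)

Section normal_density.
Context (R : realType).
Local Notation lebesgue := (@lebesgue R).

Lemma normal_probE (m s : R) (B : set R) : measurable B ->
  normal_prob m s B = (\int[lebesgue]_x ((\1_B x)%:E * (normal_pdf m s x)%:E))%E.
Proof.
move=> mB; rewrite /normal_prob -integral_lebesgue//.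
- rewrite integral_mkcond; apply: eq_integral => x _; rewrite /patch indicE.
  by case: ifP; rewrite ?mul1e ?mul0e.
- by apply/measurable_EFinP; apply: measurable_funTS; exact: measurable_normal_pdf.
- by move=> x _; rewrite lee_fin normal_pdf_ge0.
Qed.

Let g := @normal_pdf R 0 1.

Let mg : measurable_fun setT g. Proof. exact: measurable_normal_pdf. Qed.

Let g0 x : 0 <= g x. Proof. exact: normal_pdf_ge0. Qed.

Import HBNNSimple.

(** True for indicators by definition of the law, then for simple functions, then by monotone
    convergence. *)
Lemma ge0_integral_std_normal_density (f : R -> \bar R) :
  measurable_fun setT f -> (forall x, 0 <= f x)%E ->
  (\int[@std_normal R]_x f x = \int[lebesgue]_x (f x * (g x)%:E))%E.
Proof.
move=> mf f0; pose k := nnsfun_approx measurableT mf.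
have fE x : f x = lim ((EFin \o k n) x @[n --> \oo]).
  by apply/esym/cvg_lim => //; apply: cvg_nnsfun_approx.
have kE n x : (k n x)%:E =
    (\sum_(y \in range (k n)) (y * \1_(k n @^-1` [set y]) x)%:E)%E.
  by rewrite fimfunE -fsumEFin.
have mind n y : measurable_fun setT (fun x => (y * \1_(k n @^-1` [set y]) x)%:E).
  by apply/measurable_EFinP; exact: measurable_funM.
have simple n : (\int[@std_normal R]_x (k n x)%:E =
    \int[lebesgue]_x ((k n x)%:E * (g x)%:E))%E.
  under eq_integral do rewrite kE.
  rewrite ge0_integral_fsum//; last by move=> y x _; exact: nnfun_muleindic_ge0.
  transitivity (\int[lebesgue]_x (\sum_(y \in range (k n))
      (y * \1_(k n @^-1` [set y]) x)%:E * (g x)%:E))%E; last first.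
    apply: eq_integral => x _; rewrite kE ge0_mule_fsuml// => y.
    exact: nnfun_muleindic_ge0.
  rewrite ge0_integral_fsum//; last 2 first.
    - by move=> y; apply: emeasurable_funM => //; exact/measurable_EFinP.
    - by move=> y x _; rewrite mule_ge0 ?lee_fin//; exact: nnfun_muleindic_ge0.
  apply: eq_fsbigr => y yk.
  have y0 : 0 <= y by move: yk; rewrite inE => -[x _ <-].
  have mky : measurable (k n @^-1` [set y]) by [].
  under [LHS]eq_integral do rewrite EFinM.
  rewrite ge0_integralZl ?lee_fin//; last first.
    by apply/measurable_EFinP; exact: measurable_indic.
  rewrite integral_indic// setIT.
  rewrite [X in (_ * X)%E](normal_probE 0 1 mky) -ge0_integralZl ?lee_fin//.
  - by apply: eq_integral => x _; rewrite EFinM muleA.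
  - apply: emeasurable_funM; last exact/measurable_EFinP.
    by apply/measurable_EFinP; exact: measurable_indic.
  - by move=> x _; rewrite mule_ge0 ?lee_fin.
transitivity (lim (\int[@std_normal R]_x (k n x)%:E @[n --> \oo])%E).
  under eq_integral do rewrite fE.
  rewrite monotone_convergence//.
  - by move=> n; exact/measurable_EFinP.
  - by move=> n x _; rewrite lee_fin.
  - by move=> x _ m n mn; rewrite lee_fin; exact/lefP/nd_nnsfun_approx.
under eq_fun do rewrite simple.
rewrite -monotone_convergence//.
- apply: eq_integral => x _; apply/cvg_lim => //; apply: cvgeZr => //.
  exact: cvg_nnsfun_approx.
- by move=> n; apply: emeasurable_funM; exact/measurable_EFinP.
- by move=> n x _; rewrite mule_ge0 ?lee_fin.
- move=> x _ m n mn; rewrite lee_wpmul2r ?lee_fin//.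
  exact/lefP/nd_nnsfun_approx.
Qed.

Lemma normal_pdf_val (m s x : R) : s != 0 ->
  normal_pdf m s x = normal_peak s * expR (- (x - m) ^+ 2 / (s ^+ 2 *+ 2)).
Proof. by move=> s0; rewrite normal_pdfE. Qed.

Lemma normal_peakE (s : R) : normal_peak s = `|s|^-1 * normal_peak 1.
Proof.
rewrite /normal_peak -mulrnAr sqrtrM ?sqr_ge0// sqrtr_sqr invfM.
by rewrite expr1n mul1r.
Qed.

Lemma std_normal_scale (s : R) (B : set R) : s != 0 -> measurable B ->
  @std_normal R [set y | B (s * y)] = normal_prob 0 s B.
Proof.
move=> s0 mB.
have ms : measurable_fun setT (fun y : R => s * y) by exact: measurable_funM.
have mB' : measurable [set y | B (s * y)].
  by rewrite -[X in measurable X]setTI; exact: ms.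
rewrite [LHS](normal_probE 0 1 mB') normal_probE//.
rewrite [RHS](@ge0_integral_affine _ s 0)//; last 2 first.
- apply: emeasurable_funM; first by apply/measurable_EFinP; exact: measurable_indic.
  by apply/measurable_EFinP; exact: measurable_normal_pdf.
- by move=> x; rewrite mule_ge0 ?lee_fin ?normal_pdf_ge0.
rewrite -ge0_integralZl ?lee_fin//; last 2 first.
- apply: emeasurable_funM.
    apply/measurable_EFinP; apply: (measurableT_comp (measurable_indic _)) => //.
    by apply: measurable_funD.
  apply/measurable_EFinP; apply: (measurableT_comp (measurable_normal_pdf _ _)) => //.
  by apply: measurable_funD.
- by move=> x; rewrite mule_ge0 ?lee_fin ?normal_pdf_ge0.
apply: eq_integral => x _; rewrite addr0 muleCA; congr (_ * _)%E.
rewrite -EFinM; congr EFin; rewrite /g !normal_pdf_val ?oner_eq0// (normal_peakE s).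
rewrite !mulrA divff ?normr_eq0// mul1r; congr (_ * expR _).
by rewrite !subr0 exprMn expr1n; field.
Qed.

Lemma normal_prob_norm (s : R) (B : set R) :
  normal_prob 0 `|s| B = normal_prob 0 s B.
Proof.
apply: eq_integral => x _; congr EFin.
by rewrite /normal_pdf normr_eq0 /normal_peak /normal_fun !real_normK ?num_real.
Qed.

(* Completing the square. *)
Let pdf_convolution (a s u y : R) : a != 0 -> s != 0 ->
  `|a|^-1 * g ((u - s * y) / a) * g y =
  normal_pdf 0 (Num.sqrt (a ^+ 2 + s ^+ 2)) u *
  normal_pdf (u * s / (a ^+ 2 + s ^+ 2)) (a / Num.sqrt (a ^+ 2 + s ^+ 2)) y.
Proof.
move=> a0 s0; have q0 : 0 < a ^+ 2 + s ^+ 2.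
  by rewrite ltr_pwDl ?sqr_ge0// exprn_even_gt0.
set r := Num.sqrt _; have r0 : 0 < r by rewrite sqrtr_gt0.
have rE : r ^+ 2 = a ^+ 2 + s ^+ 2 by rewrite sqr_sqrtr// ltW.
have r1 : r != 0 by rewrite gt_eqF.
have ar0 : a / r != 0 by rewrite mulf_neq0// invr_eq0.
rewrite /g !normal_pdf_val ?oner_eq0//.
rewrite (normal_peakE r) (normal_peakE (a / r)) normrM normfV (gtr0_norm r0).
rewrite invfM invrK; set p := normal_peak 1.
rewrite [LHS](_ : _ = `|a|^-1 * p * p * (expR (- ((u - s * y) / a - 0) ^+ 2 / (1 ^+ 2 *+ 2)) *
  expR (- (y - 0) ^+ 2 / (1 ^+ 2 *+ 2)))); last by ring.
rewrite [RHS](_ : _ = (r^-1 * r) * (`|a|^-1 * p * p) * (expR (- (u - 0) ^+ 2 / (r ^+ 2 *+ 2)) *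
  expR (- (y - u * s / (a ^+ 2 + s ^+ 2)) ^+ 2 / ((a / r) ^+ 2 *+ 2)))); last by ring.
rewrite mulVf ?gt_eqF// mul1r -!expRD; congr (_ * expR _).
rewrite exprMn exprVn rE !subr0 expr1n.
by field; rewrite a0 gt_eqF.
Qed.

Let measurable_sub2 (a s : R) : measurable_fun setT
  (fun z : R * R => a * z.2 + s * z.1).
Proof. by apply: measurable_funD; apply: measurable_funM. Qed.

(** Substituting [u = a * x + s * y] and exchanging the integrals isolates the density of [u]; after
    completion of the square, what remains is a normal density in [y], of mass 1. Zero coefficients
    are treated apart, since the square cannot be completed there. *)
Lemma std_normal_add (a s : R) (B : set R) : measurable B ->
  (\int[@std_normal R]_y \int[@std_normal R]_x (\1_B (a * x + s * y)%R)%:E =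
   @std_normal R [set z | B (Num.sqrt (a ^+ 2 + s ^+ 2) * z)%R])%E.
Proof.
move=> mB; set r := Num.sqrt _.
have mscale k : measurable [set y : R | B (k * y)].
  have mk : measurable_fun setT (fun y : R => k * y) by exact: measurable_funM.
  by rewrite -[X in measurable X]setTI; exact: mk.
have intB k : (\int[@std_normal R]_y (\1_B (k * y)%R)%:E =
               @std_normal R [set y | B (k * y)%R])%E.
  transitivity (\int[@std_normal R]_y (\1_[set y | B (k * y)%R] y)%:E)%E.
    by apply: eq_integral => y _; rewrite !indicE; congr (_%:R%:E); apply/idP/idP; rewrite !inE.
  by rewrite integral_indic ?setIT//; exact: mscale.
have cstB k : (\int[@std_normal R]_y k = k)%E.
  rewrite [LHS](integral_cst (@std_normal R) measurableT k) -[RHS]mule1.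
  congr (_ * _)%E; exact: (@probability_setT _ _ R (@std_normal R)).
have norm k : @std_normal R [set y | B (`|k|%R * y)%R] = @std_normal R [set y | B (k * y)%R].
  have [->|k0] := eqVneq k 0; first by rewrite normr0.
  by rewrite !std_normal_scale ?normr_eq0// normal_prob_norm.
have [a0|a0] := eqVneq a 0.
  rewrite /r a0 expr0n /= add0r sqrtr_sqr norm -intB; apply: eq_integral => y _.
  by under eq_integral do rewrite mul0r add0r.
have [s0|s0] := eqVneq s 0.
  rewrite /r s0 expr0n /= addr0 sqrtr_sqr norm -intB -[RHS]cstB.
  by apply: eq_integral => y _; under eq_integral do rewrite mul0r addr0.
have r0 : r != 0.
  by rewrite sqrtr_eq0 -ltNge ltr_pwDl ?sqr_ge0// exprn_even_gt0.
rewrite std_normal_scale// normal_probE//.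
have mG : measurable_fun setT (fun z : R * R =>
    (\1_B z.2)%:E * (`|a|^-1 * g ((z.2 - s * z.1) / a) * g z.1)%:E)%E.
  apply: emeasurable_funM.
    apply/measurable_EFinP; apply: (measurableT_comp (measurable_indic _)) => //.
  apply/measurable_EFinP; apply: measurable_funM; last exact: measurableT_comp.
  apply: measurable_funM => //; apply: (measurableT_comp mg).
  apply: measurable_funM => //; apply: measurable_funB => //.
  exact: measurable_funM.
have G0 z : (0 <= (\1_B z.2)%:E * (`|a|^-1 * g ((z.2 - s * z.1) / a) * g z.1)%:E :> \bar R)%E.
  by rewrite mule_ge0 ?lee_fin ?mulr_ge0 ?invr_ge0 ?normal_pdf_ge0.
transitivity (\int[lebesgue]_y \int[lebesgue]_u
    ((\1_B u)%:E * (`|a|^-1 * g ((u - s * y) / a) * g y)%:E))%E.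
  rewrite ge0_integral_std_normal_density; last 2 first.
  - apply: (measurable_fun_fubini_tonelli_F (m2 := @std_normal R)
      (fun z : R * R => (\1_B (a * z.2 + s * z.1)%R)%:E)) => //.
    apply/measurable_EFinP; apply: (measurableT_comp (measurable_indic _)) => //.
  - by move=> y; apply: integral_ge0 => x _; rewrite lee_fin.
  apply: eq_integral => y _.
  have mi : measurable_fun setT (fun x : R => a * x + s * y).
    by apply: measurable_funD => //; exact: measurable_funM.
  have mib : measurable_fun setT (fun x : R => (\1_B (a * x + s * y))%:E : \bar R).
    by apply/measurable_EFinP; apply: (measurableT_comp (measurable_indic _)).
  rewrite ge0_integral_std_normal_density//.
  have mh : measurable_fun setT (fun u : R =>
      (\1_B u)%:E * (`|a|^-1 * g ((u - s * y) / a) * g y)%:E)%E.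
    exact: (measurableT_comp mG (measurable_fun_pair (measurable_cst _) (@measurable_id _ _ _))).
  rewrite [RHS](@ge0_integral_affine _ a (s * y))//; last by move=> u; exact: (G0 (y, u)).
  rewrite -ge0_integralZl ?lee_fin//; last 2 first.
  - exact: (measurableT_comp mh mi).
  - by move=> x _; exact: (G0 (y, _)).
  rewrite muleC -ge0_integralZl ?lee_fin//; last 2 first.
  - by apply: emeasurable_funM => //; exact/measurable_EFinP.
  - by move=> x _; rewrite mule_ge0 ?lee_fin.
  apply: eq_integral => x _; rewrite addrK [(a * x) / a]mulrAC divff// mul1r.
  rewrite muleCA [RHS]muleCA; congr (_ * _)%E; rewrite -!EFinM; congr EFin.
  by rewrite !mulrA divff ?normr_eq0// mul1r mulrC.
transitivity (\int[lebesgue]_u \int[lebesgue]_y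
    ((\1_B u)%:E * (`|a|^-1 * g ((u - s * y) / a) * g y)%:E))%E.
  exact: (@fubini_tonelli _ _ _ _ R lebesgue lebesgue (fun z : R * R =>
    (\1_B z.2)%:E * (`|a|^-1 * g ((z.2 - s * z.1) / a) * g z.1)%:E)%E mG G0).
apply: eq_integral => u _ /=.
rewrite ge0_integralZl ?lee_fin//; last 2 first.
- apply/measurable_EFinP; apply: measurable_funM => //.
  apply: measurable_funM => //; apply: (measurableT_comp mg).
  by apply: measurable_funM => //; apply: measurable_funB => //; exact: measurable_funM.
- by move=> y _; rewrite lee_fin ?mulr_ge0 ?invr_ge0 ?normal_pdf_ge0.
congr (_ * _)%E; under eq_integral do rewrite pdf_convolution// EFinM.
rewrite ge0_integralZl ?lee_fin ?normal_pdf_ge0//; last 2 first.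
- by apply/measurable_EFinP; exact: measurable_normal_pdf.
- by move=> y _; rewrite lee_fin normal_pdf_ge0.
rewrite integral_lebesgue//; last 2 first.
- by apply/measurable_EFinP; exact: measurable_normal_pdf.
- by move=> y _; rewrite lee_fin normal_pdf_ge0.
by rewrite integral_normal_pdf mule1.
Qed.

End normal_density.

(** * Variance of the standard normal law *)

Section second_moment.
Context (R : realType).
Local Notation mu := (@lebesgue_measure R).

Let g := @normal_pdf R 0 1.

(** Its derivative is [(1 - x ^+ 2) * g x], the difference between the integrands of the total mass
    and of the second moment. *)
Let G (x : R) : R := x * g x.

Let g_val x : g x = normal_peak 1 * expR (- (x ^+ 2 / 2)).
Proof.
by rewrite /g normal_pdf_val ?oner_eq0// subr0 expr1n; congr (_ * expR _); lra.
Qed.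

Let g0 x : 0 <= g x. Proof. exact: normal_pdf_ge0. Qed.

Let cg : continuous g. Proof. by apply: continuous_normal_pdf; rewrite oner_eq0. Qed.

Let cpoly (a b : R) : continuous (fun x : R => (a * x ^+ 2 + b) * g x).
Proof.
move=> x; apply: cvgM; last exact: cg.
apply: cvgD; last exact: cvg_cst.
apply: cvgM; first exact: cvg_cst.
by apply: cvgM; exact: cvg_id.
Qed.

Let G_derive (x : R) : is_derive x (1 : R) G ((- 1 * x ^+ 2 + 1) * g x).
Proof.
have -> : G = (fun x => normal_peak 1 * (x * expR (- (2^-1 * x ^+ 2)))).
  by apply/funext => y; rewrite /G g_val mulrCA [_ / 2]mulrC.
apply: is_derive_eq; rewrite g_val /GRing.scale /= (mulrC 2^-1 (x ^+ 2)).
set e := expR _; set k := normal_peak 1; by field.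
Qed.

Let G_cvg0 : G x @[x --> +oo] --> (0 : R).
Proof.
set k := @normal_peak R 1.
have k0 : 0 < k by apply: normal_peak_gt0; rewrite oner_eq0.
apply/cvgr0Pnorm_lt => e e0; near=> x.
have x0 : 0 < x by near: x; apply: nbhs_pinfty_gt; exact: num_real.
have xe : 2 * k / e < x by near: x; apply: nbhs_pinfty_gt; exact: num_real.
rewrite ger0_norm ?mulr_ge0 ?(ltW x0)// /G g_val expRN.
have ex : x ^+ 2 / 2 < expR (x ^+ 2 / 2).
  by apply: lt_le_trans (expR_ge1Dx _); rewrite ltrDr.
have x2 : 0 < x ^+ 2 / 2 by rewrite divr_gt0// exprn_gt0.
apply: (@lt_trans _ _ (x * (k * (x ^+ 2 / 2)^-1))).
  by rewrite !ltr_pM2l// ltf_pV2// posrE ?expR_gt0.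
rewrite invfM invrK [ltLHS](_ : _ = 2 * k / x); last by field; rewrite gt_eqF.
by rewrite ltr_pdivrMr// [e * x]mulrC -ltr_pdivrMr.
Unshelve. all: by end_near.
Qed.

Let mpoly (a b : R) (D : set R) :
  measurable_fun D (fun x => ((a * x ^+ 2 + b) * g x)%:E).
Proof.
apply/measurable_EFinP; apply: measurable_funTS; apply: continuous_measurable_fun.
exact: cpoly.
Qed.

(** The half-line is cut at 1, where [1 - x ^+ 2] changes sign, so that all integrals involved are
    of nonnegative functions. *)
Let split0 (a b : R) : (forall x, 0 <= (a * x ^+ 2 + b) * g x) ->
  (\int[mu]_x ((a * x ^+ 2 + b) * g x)%:E =
   2%:E * (\int[mu]_(x in `[0%R, 1%R]) ((a * x ^+ 2 + b) * g x)%:E +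
           \int[mu]_(x in `[1%R, +oo[) ((a * x ^+ 2 + b) * g x)%:E))%E.
Proof.
move=> f0; rewrite ge0_symfun_integralT//; last first.
  by move=> x /=; rewrite !g_val sqrrN.
congr (_ * _)%E; rewrite -integral_itv_bndo_bndc; last exact: mpoly.
have -> : [set x : R | 0 <= x] = `[0, 1[%classic `|` `[1, +oo[%classic.
  apply/seteqP; split => x /=; rewrite !in_itv /= andbT; have [x1|x1] := ltP x 1.
  - by move=> ->; left.
  - by right.
  - by case=> // /andP[].
  - by case=> [/andP[]//|_]; apply: le_trans x1.
rewrite ge0_integral_setU//.
- exact: mpoly.
- by move=> x _; rewrite lee_fin.
- rewrite disj_set2E; apply/eqP/seteqP; split => x //= [].
  by rewrite !in_itv /= andbT => /andP[_]; rewrite ltNge => /negP.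
Qed.

Let first_half : (\int[mu]_(x in `[0%R, 1%R]) ((- 1 * x ^+ 2 + 1) * g x)%:E = (g 1)%:E)%E.
Proof.
rewrite (@continuous_FTC2 _ _ G)//.
- by rewrite /G mul0r mul1r sube0.
- exact/continuous_subspaceT/cpoly.
- have cG x : {for x, continuous G}.
    by apply: differentiable_continuous; apply/derivable1_diffP; exact: ex_derive.
  split.
  + by move=> x _; exact: ex_derive.
  + by apply: cvg_at_right_filter; exact: cG.
  + by apply: cvg_at_left_filter; exact: cG.
- by move=> x _; rewrite derive1E (@derive_val _ _ _ _ _ _ _ (G_derive x)).
Qed.

Let second_half : (\int[mu]_(x in `[1%R, +oo[) ((1 * x ^+ 2 + - 1) * g x)%:E = (g 1)%:E)%E.
Proof.
have dG x : is_derive x (1 : R) (\- G) ((1 * x ^+ 2 - 1) * g x).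
  have -> : (1 * x ^+ 2 - 1) * g x = - ((- 1 * x ^+ 2 + 1) * g x) by ring.
  exact: is_deriveN.
rewrite (@ge0_continuous_FTC2y _ _ (\- G) _ 0)//.
- by rewrite /= /G mul1r -EFinB sub0r opprK.
- by move=> x x1; rewrite mulr_ge0// mul1r subr_ge0 exprn_ege1.
- exact/continuous_subspaceT/cpoly.
- by rewrite -oppr0; exact: cvgN.
- apply: cvg_at_right_filter.
  by apply: differentiable_continuous; apply/derivable1_diffP; exact: ex_derive.
- by move=> x _; rewrite derive1E (@derive_val _ _ _ _ _ _ _ (dG x)).
Qed.

(** On [0, 1] the mass exceeds the second moment by [g 1]; beyond 1 the second moment exceeds the
    mass by [g 1]. The two gaps cancel. *)
Lemma std_normal_second_moment :
  (\int[@std_normal R]_x (x ^+ 2)%:E = 1)%E.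
Proof.
have f1 x : 0 <= (1 * x ^+ 2 + 0) * g x by rewrite mulr_ge0// mul1r addr0 sqr_ge0.
have f2 x : 0 <= (0 * x ^+ 2 + 1) * g x by rewrite mulr_ge0// mul0r add0r.
transitivity (\int[mu]_x ((1 * x ^+ 2 + 0) * g x)%:E)%E.
  rewrite ge0_integral_std_normal_density.
  - rewrite integral_lebesgue//.
    + by apply: eq_integral => x _; rewrite mul1r addr0 EFinM.
    + under eq_fun => x do rewrite -EFinM -[x ^+ 2]mul1r -[1 * _]addr0.
      exact: mpoly.
    + by move=> x _; rewrite mule_ge0 ?lee_fin ?sqr_ge0.
  - by apply/measurable_EFinP; exact: exprn_measurable.
  - by move=> x; rewrite lee_fin sqr_ge0.
transitivity (\int[mu]_x ((0 * x ^+ 2 + 1) * g x)%:E)%E; last first.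
  rewrite -[RHS](integral_normal_pdf 0 1).
  by apply: eq_integral => x _; rewrite mul0r add0r mul1r.
rewrite !split0//; congr (_ * _)%E.
have <- : (\int[mu]_(x in `[0%R, 1%R]) ((1 * x ^+ 2 + 0) * g x)%:E + (g 1)%:E =
    \int[mu]_(x in `[0%R, 1%R]) ((0 * x ^+ 2 + 1) * g x)%:E)%E.
  rewrite -first_half -ge0_integralD//.
  - by apply: eq_integral => x _; rewrite -EFinD; congr EFin; lra.
  - by move=> x _; rewrite lee_fin.
  - exact: mpoly.
  - move=> x /=; rewrite in_itv /= => /andP[x0 x1]; rewrite lee_fin mulr_ge0//.
    by rewrite mulN1r addrC subr_ge0 exprn_ile1.
  - exact: mpoly.
rewrite -addeA; congr (_ + _)%E.
rewrite -second_half -ge0_integralD//.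
- by apply: eq_integral => x _; rewrite -EFinD; congr EFin; lra.
- move=> x /=; rewrite in_itv /= andbT => x1; rewrite lee_fin mulr_ge0//.
  by rewrite mul1r subr_ge0 exprn_ege1.
- exact: mpoly.
- by move=> x _; rewrite lee_fin.
- exact: mpoly.
Qed.

End second_moment.

Lemma ge0_integral_same_law (R : realType) (d1 d2 d : measure_display)
    (Omega1 : measurableType d1) (Omega2 : measurableType d2)
    (T : measurableType d) (P1 : probability Omega1 R)
    (P2 : probability Omega2 R) (X1 : {mfun Omega1 >-> T})
    (X2 : {mfun Omega2 >-> T}) (f : T -> \bar R) :
  (forall B, measurable B -> P1 (X1 @^-1` B) = P2 (X2 @^-1` B)) ->
  measurable_fun setT f -> (forall y, 0 <= f y)%E ->
  (\int[P1]_w f (X1 w) = \int[P2]_w f (X2 w))%E.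
Proof.
move=> X12 mf f0.
rewrite -[LHS](@ge0_integral_distribution _ _ _ _ _ P1 X1 f)//.
rewrite -[RHS](@ge0_integral_distribution _ _ _ _ _ P2 X2 f)//.
by apply: eq_measure_integral => A mA _; exact: X12.
Qed.

(** * Finite linear combinations of independent normal variables *)

Section linear_combinations.
Context (R : realType) (disp : measure_display) (Omega : measurableType disp).
Context (P : probability Omega R) (J : eqType).
Implicit Types (zeta : J -> {RV P >-> R}) (t : seq J) (a b : J -> R).

Definition lincomb zeta t a (w : Omega) : R := \sum_(z <- t) a z * zeta z w.

Let measurable_lincomb zeta t a : measurable_fun setT (lincomb zeta t a).
Proof. by apply: measurable_sum => z; exact: measurable_funM. Qed.

HB.instance Definition _ zeta t a :=
  isMeasurableFun.Build _ _ _ _ (lincomb zeta t a) (measurable_lincomb zeta t a).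

Let dilation (r y : R) : R := r * y.

Let measurable_dilation r : measurable_fun setT (dilation r).
Proof. exact: measurable_funM. Qed.

HB.instance Definition _ r :=
  isMeasurableFun.Build _ _ _ _ (dilation r) (measurable_dilation r).

Lemma lincomb_independent zeta z t a C D : iid_normal zeta -> z \notin t ->
  measurable C -> measurable D ->
  P (zeta z @^-1` C `&` lincomb zeta t a @^-1` D) =
  (P (zeta z @^-1` C) * P (lincomb zeta t a @^-1` D))%E.
Proof.
move=> [ind _] zt mC mD.
pose iota (x : unit + {y : J | y != z}) : J :=
  match x with inl _ => z | inr y => val y end.
have iotaI : injective iota.
  move=> [[]|y] [[]|y'] //= E.
  - by have := valP y'; rewrite /= -E eqxx.
  - by have := valP y; rewrite /= E eqxx.
  - by congr inr; exact: val_inj.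
pose eta := zeta \o iota.
have indeta : independent_on setT eta by exact: (independent_on_comp iotaI _ ind).
(* The combination as a function of the noise away from [z]; the default 0 is never reached, since
   [t] avoids [z]. *)
pose F (u : noise R {y : J | y != z}) : R :=
  \sum_(x <- t) a x * (if insub x is Some y then u y else 0).
have mF : measurable_fun setT F.
  apply: measurable_sum => x; apply: measurable_funM => //.
  by case: insub => [y|]; [exact: measurable_coord|exact: measurable_cst].
have mC' : measurable [set u : noise R unit | C (u tt)].
  by rewrite -[X in measurable X]setTI; exact: measurable_coord.
have mD' : measurable (F @^-1` D) by rewrite -[X in measurable X]setTI; exact: mF.
have := noise_independent indeta mC' mD'.
have -> : noise_of (eta \o inr) @^-1` (F @^-1` D) = lincomb zeta t a @^-1` D.
  suff FE w : F (noise_of (eta \o inr) w) = lincomb zeta t a w.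
    by apply/seteqP; split => w /=; rewrite FE.
  apply: eq_big_seq => x xt; congr (_ * _).
  have xz : x != z by apply: contraNneq zt => <-.
  by rewrite insubT.
by [].
Qed.

(** Independence splits off the head of the list, and [std_normal_add] merges it with the law of the
    tail. Expressing the law by a dilated standard normal variable includes variance 0. *)
Lemma lincomb_law zeta t a B : iid_normal zeta -> uniq t -> measurable B ->
  P (lincomb zeta t a @^-1` B) =
  @std_normal R [set y | B (Num.sqrt (\sum_(z <- t) a z ^+ 2) * y)].
Proof.
move=> zetaN; elim: t B => [|z t IH] B /=.
  move=> _ mB; rewrite big_nil sqrtr0.
  have [B0|B0] := pselect (B 0).
    rewrite (_ : _ @^-1` B = setT); last first.
      by apply/seteqP; split => // w _; rewrite /lincomb /= big_nil.
    rewrite (_ : [set y | _] = setT); last first.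
      by apply/seteqP; split => // y _ /=; rewrite mul0r.
    by rewrite probability_setT; apply/esym/(@probability_setT _ _ R (@std_normal R)).
  rewrite (_ : _ @^-1` B = set0); last first.
    by apply/seteqP; split => // w; rewrite /lincomb /= big_nil.
  rewrite (_ : [set y | _] = set0) ?measure0//.
  by apply/seteqP; split => // y /=; rewrite mul0r.
move=> /andP[zt ut] mB.
set s := \sum_(x <- t) a x ^+ 2.
have s0 : 0 <= s by apply: sumr_ge0 => x _; exact: sqr_ge0.
have mBi : measurable_fun setT (fun x : R * R => (\1_B (a z * x.2 + x.1))%:E : \bar R).
  apply/measurable_EFinP; apply: (measurableT_comp (measurable_indic _)) => //.
  by apply: measurable_funD => //; exact: measurable_funM.
have Bi0 (x : R * R) : (0 <= (\1_B (a z * x.2 + x.1))%:E :> \bar R)%E.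
  by rewrite lee_fin.
have mE : measurable (lincomb zeta (z :: t) a @^-1` B).
  by rewrite -[X in measurable X]setTI; exact: measurable_lincomb.
transitivity (\int[P]_w (\1_B (a z * zeta z w + lincomb zeta t a w))%:E)%E.
  transitivity (\int[P]_w (\1_(lincomb zeta (z :: t) a @^-1` B) w)%:E)%E.
    by rewrite integral_indic// setIT.
  apply: eq_integral => w _.
  rewrite !indicE (_ : (w \in _) = (a z * zeta z w + lincomb zeta t a w \in B))//.
  by apply/idP/idP; rewrite !inE /= /lincomb big_cons.
have ind C1 C2 : measurable C1 -> measurable C2 ->
    P (lincomb zeta t a @^-1` C1 `&` zeta z @^-1` C2) =
    (P (lincomb zeta t a @^-1` C1) * P (zeta z @^-1` C2))%E.
  by move=> mC1 mC2; rewrite setIC muleC lincomb_independent.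
rewrite [LHS](ge0_integral_independent ind mBi Bi0).
pose f y := (\int[@std_normal R]_x (\1_B (a z * x + y)%R)%:E)%E.
transitivity (\int[P]_w f (lincomb zeta t a w))%E.
  apply: eq_integral => w _.
  apply: (ge0_integral_std_normal (f := fun x => (\1_B (a z * x + lincomb zeta t a w))%:E) (zetaN.2 z)).
    exact: (measurableT_comp mBi (measurable_fun_pair (measurable_cst _) (@measurable_id _ _ _))).
  by move=> y; rewrite lee_fin.
have mf : measurable_fun setT f.
  by apply: (measurable_fun_fubini_tonelli_F (m2 := @std_normal R)
    (fun x : R * R => (\1_B (a z * x.2 + x.1)%R)%:E)).
have f0 y : (0 <= f y)%E by apply: integral_ge0 => x _; rewrite lee_fin.
rewrite [LHS](@ge0_integral_same_law _ _ _ _ _ _ _ _ (@std_normal R) _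
  (dilation (Num.sqrt s)) f _ mf f0); last by move=> B' mB'; exact: IH.
rewrite big_cons -/s -[in RHS](sqr_sqrtr s0); exact: std_normal_add.
Qed.

Lemma lincomb_normal zeta t a : iid_normal zeta -> uniq t ->
  has_normal_law P (lincomb zeta t a) 0 (Num.sqrt (\sum_(z <- t) a z ^+ 2)).
Proof.
move=> zetaN ut B mB; rewrite lincomb_law//.
case: ifPn => [/eqP ->|s0]; last exact: std_normal_scale.
rewrite diracE; have [B0|B0] := boolP (0 \in B).
  rewrite (_ : [set y | _] = setT).
    exact: (@probability_setT _ _ R (@std_normal R)).
  by apply/seteqP; split => // y _ /=; rewrite mul0r; exact: set_mem.
rewrite (_ : [set y | _] = set0) ?measure0//.
by apply/seteqP; split => // y /=; rewrite mul0r => /mem_set; rewrite (negbTE B0).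
Qed.

Lemma lincomb_second_moment zeta t a : iid_normal zeta -> uniq t ->
  (\int[P]_w (lincomb zeta t a w ^+ 2)%:E = (\sum_(z <- t) a z ^+ 2)%:E)%E.
Proof.
move=> zetaN ut; set s := \sum_(z <- t) _.
have s0 : 0 <= s by apply: sumr_ge0 => x _; exact: sqr_ge0.
have m2 : measurable_fun setT (fun y : R => (y ^+ 2)%:E : \bar R).
  by apply/measurable_EFinP; exact: exprn_measurable.
have p2 (y : R) : (0 <= (y ^+ 2)%:E)%E by rewrite lee_fin sqr_ge0.
rewrite (@ge0_integral_same_law _ _ _ _ _ _ _ _ (@std_normal R) _
  (dilation (Num.sqrt s)) (fun y => (y ^+ 2)%:E) _ m2 p2); last first.
  by move=> B mB; exact: lincomb_law.
under eq_integral do rewrite /dilation exprMn sqr_sqrtr// EFinM.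
rewrite ge0_integralZl ?lee_fin//.
by rewrite std_normal_second_moment mule1.
Qed.

(** Reversing the signs of the coefficients preserves the law, so the positive and negative parts
    have equal integrals; were these infinite, [fine] would still give 0. *)
Lemma lincomb_mean zeta t a : iid_normal zeta -> uniq t ->
  fine ('E_P[lincomb zeta t a]) = 0.
Proof.
move=> zetaN ut; rewrite unlock integralE.
set A := (\int[P]_w _ w)%E; set A' := (\int[P]_w _ w)%E.
have mmax : measurable_fun setT (fun y : R => (Num.max y 0)%:E : \bar R).
  by apply/measurable_EFinP; exact: measurable_maxr.
have max0 (y : R) : (0 <= (Num.max y 0)%:E :> \bar R)%E.
  by rewrite lee_fin le_max lexx orbT.
have -> : A = A'.
  transitivity (\int[P]_w (Num.max (lincomb zeta t a w) 0)%:E)%E.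
    by apply: eq_integral => w _; rewrite funeposE -EFin_max.
  transitivity (\int[P]_w (Num.max (lincomb zeta t (\- a) w) 0)%:E)%E; last first.
    apply: eq_integral => w _; rewrite funenegE -EFinN -EFin_max; congr (Num.max _ _)%:E.
    by rewrite /lincomb -sumrN; apply: eq_bigr => z _; rewrite mulNr.
  apply: (ge0_integral_same_law _ mmax max0) => B mB.
  rewrite [LHS]lincomb_law// [RHS]lincomb_law//.
  by under [in RHS]eq_bigr do rewrite sqrrN.
by case: A' => [r| |] //=; rewrite subrr.
Qed.

(** Polarization: a product is the square of the half-sum minus the square of the half-difference,
    and both second moments are known. *)
Lemma lincomb_covariance zeta t a b : iid_normal zeta -> uniq t ->
  covariance P (lincomb zeta t a) (lincomb zeta t b) =
  (\sum_(z <- t) a z * b z)%:E.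
Proof.
move=> zetaN ut; rewrite unlock !lincomb_mean// unlock.
pose X e w := 2^-1 * lincomb zeta t (fun z => a z + e * b z) w.
have mX e : measurable_fun setT (fun w => (X e w ^+ 2)%:E).
  by apply/measurable_EFinP; apply: measurable_funX; exact: measurable_funM.
have intX e : (\int[P]_w (X e w ^+ 2)%:E =
    (4^-1 * \sum_(z <- t) (a z + e * b z) ^+ 2)%:E)%E.
  rewrite EFinM -(lincomb_second_moment _ zetaN ut) -ge0_integralZl ?lee_fin ?invr_ge0//.
  - by apply: eq_integral => w _; rewrite -EFinM; congr EFin; rewrite /X; field.
  - by apply/measurable_EFinP; exact: measurable_funX.
  - by move=> w _; rewrite lee_fin sqr_ge0.
have iX e : P.-integrable setT (fun w => (X e w ^+ 2)%:E).
  apply/integrableP; split; first exact: mX.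
  under eq_integral do rewrite gee0_abs ?lee_fin ?sqr_ge0//.
  by rewrite intX ltry.
transitivity (\int[P]_w ((X 1 w ^+ 2)%:E - (X (-1) w ^+ 2)%:E))%E.
  apply: eq_integral => w _; rewrite -EFinB; congr EFin.
  have XE e : X e w = 2^-1 * (lincomb zeta t a w + e * lincomb zeta t b w).
    rewrite /X /lincomb mulr_sumr -big_split/=; congr (_ * _).
    by apply: eq_bigr => z _; ring.
  transitivity ((lincomb zeta t a w - 0) * (lincomb zeta t b w - 0)) => //.
  by rewrite !XE !subr0; field.
rewrite integralB// !intX -EFinB; congr EFin.
by rewrite -mulrBr -sumrB mulr_sumr; apply: eq_bigr => z _; field.
Qed.

End linear_combinations.

(** * Green kernel and Gaussian free field *)

Section ancestors.
Context (d : nat).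
Implicit Types x y z : tree d.

Definition ancestor z x : Prop := exists j, iter j (@parent d) x = z.

Lemma ancestor_refl x : ancestor x x. Proof. by exists 0%N. Qed.

Lemma root_ancestor x : ancestor (tree_root d) x.
Proof. by exists (depth x); exact: iter_parent_depth. Qed.

Lemma ancestor_parent z x : ancestor z (parent x) -> ancestor z x.
Proof. by move=> [j <-]; exists j.+1; rewrite iterSr. Qed.

Lemma parent_ancestor z x : ancestor z x -> ancestor (parent z) x.
Proof. by move=> [j <-]; exists j.+1. Qed.

Lemma strict_ancestor z x : ancestor z x -> z != x -> ancestor z (parent x).
Proof. by move=> [[|j] <-]; [rewrite eqxx|exists j; rewrite -iterSr]. Qed.

Lemma depth_iter_parent j x : depth (iter j (@parent d) x) = (depth x - j)%N.
Proof. by elim: j => [|j ih] /=; rewrite ?subn0// depth_parent ih subnS. Qed.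

Lemma ancestor_depth z x : ancestor z x -> (depth z <= depth x)%N.
Proof. by move=> [j <-]; rewrite depth_iter_parent leq_subr. Qed.

Lemma not_ancestor_parent x : x != tree_root d -> ~ ancestor x (parent x).
Proof.
by rewrite -depth_eq0 => x0 /ancestor_depth; rewrite depth_parent; case: (depth x) x0 => //= n; rewrite ltnn.
Qed.

Lemma ancestor_eq z z' x : ancestor z x -> ancestor z' x -> depth z = depth z' -> z = z'.
Proof.
move=> [j <-] [k <-]; rewrite !depth_iter_parent => jk.
have [dj|jd] := leqP (depth x) j.
  have dk : (depth x <= k)%N by rewrite -subn_eq0 -jk subn_eq0.
  have E m : (depth x <= m)%N -> iter m (@parent d) x = tree_root d.
    by move=> dm; apply/eqP; rewrite -depth_eq0 depth_iter_parent subn_eq0.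
  by rewrite !E.
by congr (iter _ _ _); lia.
Qed.

Lemma next_ancestor x y : ancestor x y -> x != y ->
  exists z, [/\ z != tree_root d, parent z = x & ancestor z y].
Proof.
move=> [j]; elim: j x => [|j ih] x /= jx xy; first by rewrite jx eqxx in xy.
have [yr|yr] := eqVneq (iter j (@parent d) y) (tree_root d).
  by apply: (ih x) => //; rewrite -jx yr parent_root.
by exists (iter j (@parent d) y); split => //; exists j.
Qed.

End ancestors.

(** * Characterization of the Green function by its one-step equation *)

Section green_kernel.
Context (R : realType) (d : nat).
Hypothesis d3 : (3 <= d)%N.
Local Notation rho := ((d%:R - 1)^-1 : R).
Local Notation mean := (srw_mean (R := R) (@tree_adj d) setT).

Let d_ge3 : 3 <= d%:R :> R. Proof. by rewrite ler_nat. Qed.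

Lemma tree_degree x : degree (@tree_adj d) setT x = d.
Proof.
rewrite (degreeE (N := @tree_nbrs d) (@tree_adjE d) (@tree_nbrs_uniq d)).
rewrite (eq_count (a2 := xpredT)); last by move=> y; rewrite in_setT.
rewrite count_predT /tree_nbrs size_cat size_tree_children.
by case: ifP => _ //=; rewrite add1n prednK//; exact: leq_trans d3.
Qed.

Lemma tree_srw_mean (f : tree d -> R) x :
  mean f x = (\sum_(y <- tree_nbrs x) f y) / d%:R.
Proof.
rewrite /srw_mean tree_degree ifF; last by case: d d3.
rewrite (sum_nbrs (N := @tree_nbrs d) (@tree_adjE d) (@tree_nbrs_uniq d)).
by congr (_ / _); apply: eq_bigl => y; rewrite in_setT.
Qed.

Lemma sum_tree_nbrs (f : tree d -> R) x :
  \sum_(y <- tree_nbrs x) f y =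
  (x != tree_root d)%:R * f (parent x) + \sum_(y <- tree_children x) f y.
Proof.
by rewrite big_cat; case: eqP => _ /=; rewrite ?big_nil ?mul0r// big_seq1 mul1r.
Qed.

Lemma size_tree_children_nat x :
  (size (tree_children x))%:R = d%:R - (x != tree_root d)%:R :> R.
Proof.
rewrite size_tree_children; case: eqP => _; first by rewrite subr0.
by rewrite -{2}(prednK (leq_trans (isT : 0 < 3)%N d3)) -natr1 addrK.
Qed.

Lemma srw_mean_linear (a b : R) (f g : tree d -> R) x :
  mean (fun y => a * f y + b * g y) x = a * mean f x + b * mean g x.
Proof.
by rewrite !tree_srw_mean !mulrA -mulrDl !mulr_sumr -big_split.
Qed.

Lemma srw_mean_le (f g : tree d -> R) x : (forall y, f y <= g y) ->
  mean f x <= mean g x.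
Proof.
move=> fg; rewrite !tree_srw_mean ler_wpM2r ?invr_ge0//.
by apply: ler_sum => y _; exact: fg.
Qed.

(* The walk moves away from the root with probability [(d - 1) / d], so
   [(3/4) ^ depth] decreases geometrically in mean. *)
Let psi (x : tree d) : R := (3 / 4) ^+ depth x.
(** Off the root, the mean of [psi] is [3/4 + (4/3 - 3/4) / d] times [psi], which is 17/18 for
    [d = 3] and less for larger [d]; at the root the ratio is 3/4. *)
Let kappa : R := 17 / 18.

Let psi_child x y : y \in tree_children x -> psi y = 3 / 4 * psi x.
Proof.
rewrite mem_tree_children => /andP[y0 /eqP <-]; rewrite /psi depth_parent.
by move: y0; rewrite -depth_eq0; case: (depth y) => // n _; rewrite exprS.
Qed.

Let psi_gt0 x : 0 < psi x. Proof. by rewrite exprn_gt0//; lra. Qed.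

Let psi_parent x : x != tree_root d -> psi (parent x) = 4 / 3 * psi x.
Proof.
rewrite -depth_eq0 /psi depth_parent; case: (depth x) => // n _.
by rewrite exprS /=; lra.
Qed.

Let mean_psi x : mean psi x <= kappa * psi x.
Proof.
rewrite tree_srw_mean sum_tree_nbrs ler_pdivrMr; last by have := d_ge3; lra.
rewrite (eq_big_seq (fun=> 3 / 4 * psi x)); last exact: psi_child.
rewrite big_const_seq count_predT iter_addr_0 -[X in _ + X]mulr_natl size_tree_children_nat.
have := psi_gt0 x; set p := psi x => p0.
have dp : 3 * p <= d%:R * p by rewrite ler_pM2r// d_ge3.
have [->|x0] := eqVneq x (tree_root d) ; rewrite /kappa /= ?mul0r ?mul1r; first by lra.
by rewrite psi_parent// -/p; lra.
Qed.

Let iter_mean_psi n x : iter n mean psi x <= kappa ^+ n * psi x.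
Proof.
elim: n x => [|n ih] x /=; first by rewrite mul1r.
apply: le_trans (srw_mean_le _ ih) _.
have -> : (fun y => kappa ^+ n * psi y) = (fun y => kappa ^+ n * psi y + 0 * psi y).
  by apply/funext => y; rewrite mul0r addr0.
rewrite srw_mean_linear mul0r addr0 exprSr -mulrA ler_wpM2l// exprn_ge0//.
by rewrite /kappa; lra.
Qed.

Let iter_mean_le n (f g : tree d -> R) x : (forall y, f y <= g y) ->
  iter n mean f x <= iter n mean g x.
Proof. by move=> fg; elim: n x => //= n ih x; exact: srw_mean_le. Qed.

Let iter_mean_linear n (a b : R) (f g : tree d -> R) x :
  iter n mean (fun y => a * f y + b * g y) x = a * iter n mean f x + b * iter n mean g x.
Proof.
elim: n x => //= n ih x; rewrite -srw_mean_linear.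
by congr (mean _ x); apply/funext => y; exact: ih.
Qed.

(** The equation makes the partial sums telescope to [g x] minus the [n]-fold mean of [g], and the
    decay of [g] sends this remainder to 0. *)
Lemma green_unique (g : tree d -> R) (y : tree d) (C : R) (x : tree d) :
  (forall z, g z = (z == y)%:R + mean g z) ->
  (forall z, `|g z| <= C * (3 / 4) ^+ depth z) ->
  (\sum_(0 <= n <oo) (iter n mean (fun z => (z == y)%:R) x)%:E = (g x)%:E)%E.
Proof.
move=> gE gC.
have partial n : \sum_(0 <= k < n) iter k mean (fun z => (z == y)%:R) x =
    g x - iter n mean g x.
  elim: n => [|n ih]; first by rewrite big_geq//= subrr.
  rewrite big_nat_recr//= ih.
  have -> : (fun z => (z == y)%:R) = (fun z => 1 * g z + (-1) * mean g z).
    by apply/funext => z; rewrite [g z in RHS]gE mul1r mulN1r addrK.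
  rewrite iter_mean_linear -iterSr /=; lra.
have bnd n : `|iter n mean g x| <= kappa ^+ n * (C * psi x).
  have le1 := @iter_mean_le n g (fun z => C * psi z + 0 * psi z) x.
  have le2 := @iter_mean_le n (fun z => (- C) * psi z + 0 * psi z) g x.
  have C0 : 0 <= C.
    by have := le_trans (normr_ge0 _) (gC x); rewrite pmulr_lge0//; exact: psi_gt0.
  have Cit : C * iter n mean psi x <= C * (kappa ^+ n * psi x).
    by rewrite ler_wpM2l.
  rewrite !iter_mean_linear in le1 le2.
  have {}le1 : iter n mean g x <= C * iter n mean psi x.
    rewrite -[leRHS]addr0 -[X in _ + X](mul0r (iter n mean psi x)); apply: le1 => z.
    by rewrite mul0r addr0 (le_trans (ler_norm _)) ?gC.
  have {}le2 : - C * iter n mean psi x <= iter n mean g x.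
    rewrite -[leLHS]addr0 -[X in _ + X](mul0r (iter n mean psi x)); apply: le2 => z.
    by rewrite mul0r addr0 mulNr lerNl (le_trans _ (gC z))// -normrN ler_norm.
  by rewrite ler_norml; apply/andP; split; lra.
have lim0 : iter n mean g x @[n --> \oo] --> (0 : R).
  apply/cvgr0Pnorm_lt => e e0.
  have : geometric (C * psi x) kappa n @[n --> \oo] --> (0 : R).
    by apply: cvg_geometric; rewrite /kappa ger0_norm; lra.
  move=> /cvgr0Pnorm_lt /(_ e e0); apply: filterS => n.
  rewrite /geometric /= => /(le_lt_trans (ler_norm _)); apply: le_lt_trans.
  by rewrite [leRHS]mulrC; exact: bnd.
under eq_fun do rewrite sumEFin partial.
apply/cvg_lim => //; apply: cvg_EFin; first exact: nearW.
rewrite -[X in _ --> X]subr0; apply: cvgB; [exact: cvg_cst|exact: lim0].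
Qed.

End green_kernel.

(** * The recursive field and its covariance kernel *)

Section tree_field.
Context (R : realType) (d : nat).
Hypothesis d3 : (3 <= d)%N.
Local Notation rho := ((d%:R - 1)^-1 : R).
Local Notation c := (Num.sqrt (d%:R / (d%:R - 1)) : R).
Local Notation s := ((d%:R - 1) / (d%:R - 2) : R).
Implicit Types (u : tree d -> R) (x y z : tree d).

(** The root variance [s] is the diagonal value of the Green function, and it is stationary for the
    recursion: [s = rho ^+ 2 * s + c ^+ 2]. *)
Fixpoint field_at_depth u n x : R :=
  if n is n'.+1 then rho * field_at_depth u n' (parent x) + c * u x
  else Num.sqrt s * u (tree_root d).

Definition field u x : R := field_at_depth u (depth x) x.

Lemma field_root u : field u (tree_root d) = Num.sqrt s * u (tree_root d).
Proof. by []. Qed.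

Lemma field_step u x : x != tree_root d ->
  field u x = rho * field u (parent x) + c * u x.
Proof. by rewrite -depth_eq0 /field depth_parent; case: (depth x). Qed.

Lemma tree_ind_parent (Q : tree d -> Prop) : Q (tree_root d) ->
  (forall x, x != tree_root d -> Q (parent x) -> Q x) -> forall x, Q x.
Proof.
move=> Q0 QS x; move: {2}(depth x) (erefl (depth x)) => n.
elim: n x => [|n ih] x xn.
  by have -> : x = tree_root d by apply/eqP; rewrite -depth_eq0 xn.
by apply: QS; [rewrite -depth_eq0 xn|apply: ih; rewrite depth_parent xn].
Qed.

Definition field_coef x z : R := field (fun y => (y == z)%:R) x.

Definition tree_ball n : seq (tree d) := enum_fset (fset_set [set x | (depth x <= n)%N]).

Lemma mem_tree_ball n x : (x \in tree_ball n) = (depth x <= n)%N.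
Proof.
rewrite /tree_ball (in_fset_set (@finite_depth d n)).
by apply/idP/idP; rewrite inE.
Qed.

Lemma tree_ball_uniq n : uniq (tree_ball n). Proof. exact: fset_uniq. Qed.

Lemma sum_pred1 (t : seq (tree d)) u x : uniq t -> x \in t ->
  \sum_(z <- t) (x == z)%:R * u z = u x.
Proof.
move=> ut xt; rewrite (bigD1_seq x)//= eqxx mul1r big1 ?addr0// => z.
by rewrite eq_sym => /negbTE ->; rewrite mul0r.
Qed.

Lemma field_sum n u x : (depth x <= n)%N ->
  field u x = \sum_(z <- tree_ball n) field_coef x z * u z.
Proof.
elim/tree_ind_parent: x => [|x x0 ih] xn.
  rewrite field_root -(@sum_pred1 (tree_ball n) u) ?tree_ball_uniq ?mem_tree_ball//.
  by rewrite mulr_sumr; apply: eq_bigr => z _; rewrite /field_coef field_root mulrA.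
rewrite field_step// ih; last by rewrite depth_parent (leq_trans (leq_pred _)).
rewrite -[u x](@sum_pred1 (tree_ball n)) ?tree_ball_uniq ?mem_tree_ball//.
rewrite !mulr_sumr -big_split; apply: eq_bigr => z _.
by rewrite /field_coef [in RHS]field_step//= mulrDl !mulrA.
Qed.

Lemma field_coef0 x z : ~ ancestor z x -> field_coef x z = 0.
Proof.
elim/tree_ind_parent: x => [|x x0 ih] zx; rewrite /field_coef.
  rewrite field_root; case: eqP => [E|_]; last by rewrite mulr0.
  by exfalso; apply: zx; rewrite -E; exact: ancestor_refl.
rewrite field_step//; case: eqP => [E|_].
  by exfalso; apply: zx; rewrite -E; exact: ancestor_refl.
by rewrite -/(field_coef _ _) ih ?mulr0 ?addr0// => /ancestor_parent.
Qed.

(** The covariance, that is the sum over [z] of the products of coefficients. Written as the field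
    evaluated on the coefficients of [y], it inherits the recursion of the field. *)
Definition field_kernel x y : R := field (field_coef y) x.

Lemma field_kernel_sum n x y : (depth x <= n)%N ->
  field_kernel x y = \sum_(z <- tree_ball n) field_coef x z * field_coef y z.
Proof. by move=> xn; exact: field_sum. Qed.

Lemma field_kernelC x y : field_kernel x y = field_kernel y x.
Proof.
rewrite (@field_kernel_sum (maxn (depth x) (depth y))) ?leq_maxl//.
rewrite (@field_kernel_sum (maxn (depth x) (depth y)) y) ?leq_maxr//.
by apply: eq_bigr => z _; rewrite mulrC.
Qed.

(** The noise at [x] does not enter the value at [y], so only the parent term of the recursion
    contributes. *)
Lemma field_kernel_parent x y : ~ ancestor x y ->
  field_kernel x y = rho * field_kernel (parent x) y.
Proof.
move=> xy; have x0 : x != tree_root d.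
  by apply: contra_notN xy => /eqP ->; exact: root_ancestor.
by rewrite {1}/field_kernel field_step// field_coef0// mulr0 addr0.
Qed.

Let d_ge3 : 3 <= d%:R :> R. Proof. by rewrite ler_nat. Qed.

Let s_ge0 : 0 <= s. Proof. by have dge := d_ge3; rewrite divr_ge0//; lra. Qed.

Lemma field_kernel_diag x : field_kernel x x = s.
Proof.
have dge := d_ge3.
elim/tree_ind_parent: x => [|x x0 ih].
  rewrite /field_kernel field_root /field_coef field_root eqxx mulr1.
  by rewrite -expr2 sqr_sqrtr.
rewrite {1}/field_kernel field_step// -/(field_kernel _ _) field_kernelC.
rewrite field_kernel_parent ?ih; last exact: not_ancestor_parent.
rewrite /field_coef field_step// eqxx mulr1 -/(field_coef _ _).
rewrite field_coef0; last exact: not_ancestor_parent.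
rewrite mulr0 add0r -expr2 sqr_sqrtr; last by rewrite divr_ge0//; lra.
by field; apply/andP; split; apply: lt0r_neq0; lra.
Qed.

Lemma field_kernel_ancestor x y : ancestor x y ->
  field_kernel x y = rho ^+ (depth y - depth x) * s.
Proof.
elim/tree_ind_parent: y => [|y y0 ih] xy.
  have -> : x = tree_root d.
    by have := ancestor_depth xy; rewrite leqn0 depth_eq0 => /eqP.
  by rewrite field_kernel_diag subnn mul1r.
have [->|nxy] := eqVneq x y; first by rewrite field_kernel_diag subnn mul1r.
have xpy := strict_ancestor xy nxy.
rewrite field_kernelC field_kernel_parent; last first.
  move=> yx; case/eqP: nxy; apply: (ancestor_eq xy (ancestor_refl y)).
  by apply/eqP; rewrite eqn_leq !ancestor_depth.
rewrite field_kernelC ih// mulrA -exprS depth_parent; congr (_ ^+ _ * _).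
have := ancestor_depth xpy; rewrite depth_parent.
by move: y0; rewrite -depth_eq0; lia.
Qed.

(** This is the decay in [x] that [green_unique] asks for. On the ancestral line of [y] the factor
    in [depth y] compensates, and off it each step down multiplies by [rho <= 3 / 4]. *)
Lemma field_kernel_le x y : `|field_kernel x y| <=
  s * (4 / 3) ^+ depth y * (3 / 4) ^+ depth x.
Proof.
have dge := d_ge3.
have rho0 : 0 <= rho by rewrite invr_ge0; lra.
have rho1 : rho <= 3 / 4 by rewrite -[rho]mul1r ler_pdivrMr; lra.
elim/tree_ind_parent: x => [|x x0 ih].
  rewrite field_kernel_ancestor; last exact: root_ancestor.
  rewrite [(3 / 4) ^+ _](_ : _ = 1)// ger0_norm ?(mulr_ge0 (exprn_ge0 _ rho0) s_ge0)// mulr1 mulrC ler_wpM2l//.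
  apply: (@le_trans _ _ 1); first by rewrite exprn_ile1//; lra.
  by rewrite exprn_ege1//; lra.
have [xy|xy] := pselect (ancestor x y).
  rewrite field_kernel_ancestor// ger0_norm ?(mulr_ge0 (exprn_ge0 _ rho0) s_ge0)//.
  rewrite mulrC -mulrA ler_wpM2l//.
  apply: (@le_trans _ _ 1); first by rewrite exprn_ile1//; lra.
  have pow1 : (4 / 3) ^+ depth x * (3 / 4) ^+ depth x = 1 :> R.
    by rewrite -exprMn [X in X ^+ _](_ : _ = 1) ?expr1n//; lra.
  rewrite -[leLHS]pow1 ler_wpM2r ?exprn_ge0//.
  by apply: ler_weXn2l; [lra|exact: ancestor_depth].
rewrite field_kernel_parent// normrM ger0_norm//.
have -> : (3 / 4) ^+ depth x = 3 / 4 * (3 / 4) ^+ depth (parent x) :> R.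
  by rewrite depth_parent -exprS prednK// lt0n depth_eq0.
by rewrite mulrCA ler_pM.
Qed.

(** If [x] is strictly above [y], the child towards [y] carries [1 / rho] times the kernel and every
    other neighbour [rho] times it; if [x] is not an ancestor of [y], the parent plays the role of
    that child. As [1 / rho = d - 1], the sum is [d] times the kernel. If [x = y], every neighbour
    carries [rho * s], and [s - rho * s = 1]. *)
Lemma field_kernel_green x y :
  field_kernel x y = (x == y)%:R +
    srw_mean (@tree_adj d) setT (fun z => field_kernel z y) x.
Proof.
have dge := d_ge3.
have dn0 : d%:R != 0 :> R by apply: lt0r_neq0; lra.
have d1n0 : d%:R - 1 != 0 :> R by apply: lt0r_neq0; lra.
have d2n0 : d%:R - 2 != 0 :> R by apply: lt0r_neq0; lra.
rewrite tree_srw_mean// sum_tree_nbrs.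
set e : R := (x != tree_root d)%:R.
have [[xay xy]|nxy] := pselect (ancestor x y /\ x != y).
  have [z0 [z0r z0x z0y]] := next_ancestor xay xy.
  have zE z : z \in tree_children x -> field_kernel z y =
      rho * field_kernel x y + (z == z0)%:R * ((d%:R - 1 - rho) * field_kernel x y).
    rewrite mem_tree_children => /andP[zr /eqP zx].
    have [->|zz0] := eqVneq z z0.
      rewrite mul1r -mulrDl addrC subrK [in RHS]field_kernel_ancestor//.
      rewrite field_kernel_ancestor// mulrA; congr (_ * _).
      have -> : (depth y - depth x = (depth y - depth z0).+1)%N.
        have := ancestor_depth z0y; rewrite -z0x depth_parent.
        by move: z0r; rewrite -depth_eq0; lia.
      by rewrite exprS mulrA divff// mul1r.
    rewrite /= mul0r addr0 field_kernel_parent ?zx// => zy.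
    case/eqP: zz0; apply: (ancestor_eq zy z0y).
    move: zr z0r (congr1 (@depth d) zx) (congr1 (@depth d) z0x).
    by rewrite -!depth_eq0 !depth_parent; lia.
  have -> : \sum_(z <- tree_children x) field_kernel z y =
      (d%:R - e) * (rho * field_kernel x y) + (d%:R - 1 - rho) * field_kernel x y.
    rewrite (eq_big_seq _ zE) big_split /=; congr (_ + _).
      by rewrite big_const_seq count_predT iter_addr_0 -[LHS]mulr_natl size_tree_children_nat.
    rewrite (bigD1_seq z0) ?tree_children_uniq//=; last first.
      by rewrite mem_tree_children z0r z0x eqxx.
    rewrite eqxx mul1r big1 ?addr0// => z /negbTE ->.
    by rewrite mul0r.
  have -> : e * field_kernel (parent x) y = e * (rho * field_kernel x y).
    rewrite /e; case: eqP => [->|x0] /=; first by rewrite !mul0r.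
    rewrite !mul1r !field_kernel_ancestor//; last exact: parent_ancestor.
    rewrite mulrA -exprS; congr (_ ^+ _ * _); rewrite depth_parent.
    have := ancestor_depth xay; move/eqP: x0; rewrite -depth_eq0; lia.
  rewrite (negbTE xy) /= add0r; set K := field_kernel x y; set E := e; field.
  by rewrite dn0 d1n0.
have zE z : z \in tree_children x -> field_kernel z y = rho * field_kernel x y.
  rewrite mem_tree_children => /andP[zr /eqP zx].
  rewrite field_kernel_parent ?zx// => zy; apply: nxy; split.
    by rewrite -zx; exact: parent_ancestor.
  apply/eqP => E; have := ancestor_depth zy; rewrite -E -zx depth_parent.
  by move: zr; rewrite -depth_eq0; lia.
rewrite (eq_big_seq _ zE) big_const_seq count_predT iter_addr_0.
rewrite -[_ *+ size _]mulr_natl size_tree_children_nat// -/e.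
have [E|xy] := eqVneq x y.
  rewrite -E field_kernel_diag.
  have -> : e * field_kernel (parent x) x = e * (rho * s).
    rewrite /e; case: eqP => [->|x0] /=; first by rewrite !mul0r.
    rewrite !mul1r field_kernelC field_kernel_parent ?field_kernel_diag//.
    by apply: not_ancestor_parent; exact/eqP.
  rewrite [true%:R](_ : _ = 1)//; set E' := e; field.
  by rewrite dn0 d1n0 d2n0.
have nax : ~ ancestor x y by move=> xay; apply: nxy.
have -> : e = 1.
  by rewrite /e; case: eqP => // E; case: nax; rewrite E; exact: root_ancestor.
rewrite /= add0r mul1r; set K := field_kernel (parent x) y.
rewrite field_kernel_parent// -/K; field.
by rewrite dn0 d1n0.
Qed.

End tree_field.

(** * Construction of a free field *)

Section gaussian_field.
Context (R : realType) (d : nat) (disp : measure_display)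
  (Omega : measurableType disp) (P : probability Omega R).
Hypothesis d3 : (3 <= d)%N.
Implicit Type zeta : tree d -> {RV P >-> R}.

Definition gaussian_field zeta x (w : Omega) : R := field (fun z => zeta z w) x.

Lemma gaussian_field_lincomb zeta n x : (depth x <= n)%N ->
  gaussian_field zeta x = lincomb zeta (tree_ball d n) (field_coef R x).
Proof. by move=> xn; apply/funext => w; exact: field_sum. Qed.

Let measurable_gaussian_field zeta x : measurable_fun setT (gaussian_field zeta x).
Proof. by rewrite (gaussian_field_lincomb zeta (leqnn _)); exact: measurable_funPT. Qed.

HB.instance Definition _ zeta x :=
  isMeasurableFun.Build _ _ _ _ (gaussian_field zeta x) (measurable_gaussian_field zeta x).

Definition gff zeta x : {RV P >-> R} := gaussian_field zeta x.

(** The tree is countable, so a sequence of normal variables provides its noise. The same sequence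
    drives the walk of the Green function, in which only the law of the walk matters. *)
Lemma gff_is_gff (eta : nat -> {RV P >-> R}) : iid_normal eta ->
  is_gff (gff (fun x : tree d => eta (choice.pickle x))).
Proof.
move=> etaN; set zeta := fun x : tree d => _.
have zetaN : iid_normal zeta.
  exact: (iid_normal_comp (pcan_inj choice.pickleK) etaN).
split.
  move=> t a; pose n := \max_(x <- t) depth x.
  exists (Num.sqrt (\sum_(z <- tree_ball d n)
                      (\sum_(x <- t) a x * field_coef R x z) ^+ 2)).
  rewrite [X in has_normal_law P X](_ : _ =
      lincomb zeta (tree_ball d n) (fun z => \sum_(x <- t) a x * field_coef R x z)).
    by apply: lincomb_normal => //; exact: tree_ball_uniq.
  apply/funext => w; rewrite /lincomb.
  under [RHS]eq_bigr do rewrite mulr_suml.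
  rewrite exchange_big /=; apply: eq_big_seq => x xt.
  rewrite [gff _ _ _](congr1 (fun f => f w) (@gaussian_field_lincomb zeta n x _)); last first.
    exact: (leq_bigmax_seq (F := @depth d)).
  by rewrite mulr_sumr; apply: eq_bigr => z _; rewrite mulrA.
move=> x y; exists disp, Omega, P, (normal_walk (@tree_adj d) setT x eta).
have walk := normal_walk_srw (@tree_adj d) setT x etaN.
split; first exact: walk.
rewrite (green_sum walk) (green_unique d3 x
  (fun z => @field_kernel_green R d d3 z y) (fun z => @field_kernel_le R d d3 z y)).
pose n := maxn (depth x) (depth y).
rewrite [X in covariance P X _](@gaussian_field_lincomb zeta n) ?leq_maxl//.
rewrite [X in covariance P _ X](@gaussian_field_lincomb zeta n) ?leq_maxr//.
rewrite lincomb_covariance ?tree_ball_uniq//.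
by rewrite (@field_kernel_sum _ _ n)// leq_maxl.
Qed.

End gaussian_field.

(** * The dichotomy *)

Section infinite_clusters.
Context (R : realType) (d : nat).
Implicit Types (h : R) (f : tree d -> R).

Lemma level_clusterE h f : level_cluster h f = ancestral [set x | h <= f x].
Proof. exact: component_tree. Qed.

(** Balls of the tree are finite; depth turns infinity into a countable condition. *)
Lemma infinite_clusterP h f : infinite_set (level_cluster h f) <->
  forall n, exists x, level_cluster h f x /\ (n < depth x)%N.
Proof.
split=> [inf n|deep fin].
  apply: contrapT => none; apply: inf; apply: sub_finite_set (@finite_depth d n) => x Cx.
  by rewrite /= leqNgt; apply/negP => xn; apply: none; exists x.
have [x [Cx]] := deep (\max_(y <- enum_fset (fset_set (level_cluster h f))) depth y)%N.
rewrite ltnNge (leq_bigmax_seq (F := @depth d))//.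
by rewrite in_fset_set// inE.
Qed.

Lemma measurable_infinite_cluster h (disp : measure_display)
    (Omega : measurableType disp) (P : probability Omega R)
    (phi : tree d -> {RV P >-> R}) :
  measurable [set w | infinite_set (level_cluster h (fun x => phi x w))].
Proof.
pose E n (x : tree d) := [set w | level_cluster h (fun x => phi x w) x /\ (n < depth x)%N].
have mE n x : measurable (E n x).
  rewrite (_ : E n x = if (n < depth x)%N then
      \bigcap_j [set w | h <= phi (iter j (@parent d) x) w] else set0).
    case: ifP => // _; apply: bigcapT_measurable => j.
    rewrite -[X in measurable X]setTI (_ : [set w | _] =
      phi (iter j (@parent d) x) @^-1` `[h, +oo[).
      exact: measurable_funP.
    by apply/seteqP; split => w /=; rewrite in_itv /= andbT.
  apply/seteqP; split => w; rewrite /E /= level_clusterE.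
    by move=> [Cx ->] j _; exact: Cx.
  by case: ifP => // _ Cx; split => // j; exact: Cx.
rewrite (_ : [set w | _] = \bigcap_n \bigcup_k
    (if choice.unpickle k is Some x then E n x else set0)).
  apply: bigcapT_measurable => n; apply: bigcupT_measurable => k.
  by case: choice.unpickle.
apply/seteqP; split => w /=.
  move=> /infinite_clusterP deep n _; have [x xE] := deep n.
  by exists (choice.pickle x) => //; rewrite choice.pickleK.
move=> H; apply/infinite_clusterP => n; have [k _] := H n I.
by case: choice.unpickle => // x; exists x.
Qed.

(** If each of the finitely many branches died at some generation, a vertex of the cluster deeper
    than all of them would contradict this in its own branch. *)
Lemma infinite_cluster_alive (rho c h : R) f (zeta : tree d -> R) :
  (forall y, y != tree_root d -> f y = rho * f (parent y) + c * zeta y) ->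
  infinite_set (level_cluster h f) ->
  exists i0 : 'I_d, forall n,
    alive rho c h n (f (tree_root d), fun v => zeta (word_vertex i0 v)).
Proof.
move=> fE /infinite_clusterP deep; apply: contrapT => none.
have fail (i0 : 'I_d) : {n | ~~ alive rho c h n
    (f (tree_root d), fun v => zeta (word_vertex i0 v))}.
  apply: cid; apply: contrapT => al; apply: none; exists i0 => n.
  by apply: contrapT => /negP nal; apply: al; exists n.
have [x [Cx xn]] := deep (\max_i sval (fail i))%N.
have xr : x != tree_root d by rewrite -depth_eq0; case: depth xn.
have [i0 [u xE]] := word_vertex_surj xr; subst x.
rewrite depth_word ltnS in xn.
have AE v : level_cluster h f (word_vertex i0 v) <->
    level_cluster h f (parent (word_vertex i0 v)) /\ h <= f (word_vertex i0 v).
  by rewrite level_clusterE ancestralP; split=> -[].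
have := alive_word fE AE (t := u) (u := [::]).
rewrite cats0 parent_word_nil => /(_ Cx) au.
have := svalP (fail i0); apply/negP; rewrite negbK.
have al k : (k <= size u)%N -> alive rho c h k
    (f (tree_root d), fun v => zeta (word_vertex i0 v)).
  move=> ku; rewrite -(subKn ku); elim: (size u - k)%N => [|m ih].
    rewrite subn0; congr (is_true (alive _ _ _ _ (_, _))): au.
    by apply/funext => v; rewrite cats0.
  rewrite subnS; case: (size u - m)%N ih => // l; exact: aliveS.
by apply: al; apply: leq_trans xn; exact: (leq_bigmax (F := fun i => sval (fail i))).
Qed.

End infinite_clusters.

Lemma gff_no_infinite_cluster (R : realType) (d : nat) (h : R)
    (disp : measure_display) (Omega : measurableType disp)
    (P : probability Omega R) (zeta : tree d -> {RV P >-> R}) :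
  (3 <= d)%N -> iid_normal zeta ->
  (forall n, (mean_size d.-1 (d%:R - 1)^-1 (Num.sqrt (d%:R / (d%:R - 1))) h n h <= 1)%E) ->
  P [set w | infinite_set (level_cluster h (fun x => gff zeta x w))] = 0%E.
Proof.
move=> d3 zetaN small; set rho := (d%:R - 1)^-1 in small *; set c := Num.sqrt _ in small *.
(* [extinction] concerns a fixed starting value, while the root value is random. As [alive] is
   monotone in the starting value, integers [K] above it suffice, and the union of null events is
   countable. *)
pose E (i : 'I_d) (K : nat) := [set w | forall n,
  alive rho c h n (K%:R, noise_of (zeta \o word_vertex i) w)].
have mE i K : measurable (E i K).
  rewrite (_ : E i K = \bigcap_n [set w | alive rho c h n (K%:R, noise_of (zeta \o word_vertex i) w)]).
    apply: bigcapT_measurable => n; rewrite -[X in measurable X]setTI.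
    have mf : measurable_fun setT (fun w => alive rho c h n
        (K%:R : R, noise_of (zeta \o word_vertex i) w)).
      by apply: (measurableT_comp (measurable_alive rho c h n)); exact: measurable_fun_pair.
    exact: (mf measurableT [set true]).
  by apply/seteqP; split => w /= H n; [move=> _; exact: H|exact: (H n I)].
have E0 i K : P (E i K) = 0%E.
  apply: (extinction _ (tree_rho_gt0 R d3) (tree_c_gt0 R d3)) => //; first by lia.
  by apply: iid_normal_comp zetaN; exact: word_vertex_inj.
pose U := \bigcup_k (if choice.unpickle k is Some (i, K) then E i K else set0).
have mEk k : measurable (if @choice.unpickle ('I_d * nat)%type k is Some (i, K) then E i K else set0).
  by case: choice.unpickle => // -[].
have U0 : P U = 0%E.
  apply/eqP; rewrite eq_le measure_ge0 andbT.
  apply: le_trans (measure_sigma_subadditive _ _ _ (fun x Ux => Ux)) _ => //.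
  - exact: bigcupT_measurable.
  - rewrite eseries0// => k _ _; case: choice.unpickle => [[i K]|]; [exact: E0|exact: measure0].
apply/eqP; rewrite eq_le measure_ge0 andbT -U0.
apply: le_measure; rewrite ?inE; [exact: measurable_infinite_cluster|exact: bigcupT_measurable|].
move=> w /= inf.
have fE y : y != tree_root d -> gff zeta y w = rho * gff zeta (parent y) w + c * zeta y w.
  by move=> y0; exact: field_step.
have [i al] := infinite_cluster_alive fE inf.
pose K := (Num.truncn `|gff zeta (tree_root d) w|).+1.
exists (choice.pickle (i, K)) => //; rewrite choice.pickleK => n.
apply: alive_nondecreasing (al n); first exact: tree_rho_gt0.
by apply: le_trans (ler_norm _) _; apply/ltW/truncnS_gt.
Qed.

Theorem proposition1p2 (R : realType) (d : nat) (h : R) :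
  (3 <= d)%N ->
  (h%:E < hstar R d)%E ->
  exists2 delta1 : R, 0 < delta1 &
  forall delta0 : R, 0 < delta0 -> delta0 < delta1 ->
  exists2 eps : R, 0 < eps &
  forall delta : R, 0 < delta -> delta < delta0 ->
  forall a : R, h <= a ->
  forall (obar : tree d), tree_adj (tree_root d) obar ->
  forall (disp : measure_display) (Omega : measurableType disp)
         (P : probability Omega R) (phi : tree d -> {RV P >-> R}),
  is_gff_at a phi ->
  (q_prob obar h delta phi < (1 - eps)%:E)%E.
Proof.
move=> d3 hh; pose rho : R := (d%:R - 1)^-1; pose c : R := Num.sqrt (d%:R / (d%:R - 1)).
have [super|sub] := pselect (exists n, (1 < mean_size d.-1 rho c h n h)%E).
  have [n un] := mean_size_large (tree_rho_gt0 R d3) (tree_c_gt0 R d3) super.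
  pose b := conductance_bound d.-1 rho c h n.
  have b0 : 0 < b.
    by apply: conductance_bound_gt0; exact: tree_c_gt0.
  have dR : 0 < d%:R :> R by rewrite ltr0n; lia.
  (* [b / 2 / d] is the escape probability through one branch; the bound 1 serves the empty list of
     steps. *)
  exists (Num.min 1 (b / 2 / d%:R)); first by rewrite lt_min ltr01 !divr_gt0.
  (* [b / 4] in place of [b / 2] makes the final inequality strict. *)
  move=> delta0 _; rewrite lt_min => /andP[d01 d0b]; exists (b / 4); first by rewrite divr_gt0.
  move=> delta _ dd0 a ha obar robar disp Omega P phi phia.
  apply: (@le_lt_trans _ _ (1 - b / 2)%:E); last by rewrite lte_fin; lra.
  by apply: (supercritical_not_transient d3 un ha robar phia); apply/ltW/(lt_trans dd0).
(* The constants are arbitrary: once a field [phi] is given, this case contradicts [h < hstar]. *)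
exists 1 => // delta0 _ _; exists 1 => // delta _ _ a _ obar _ disp Omega P phi.
(* [phi] only supplies independent normal variables, from which a free field is
   built that does not percolate. *)
move=> [zeta [ind law _ _]]; exfalso; have small n : (mean_size d.-1 rho c h n h <= 1)%E.
  by rewrite leNgt; apply/negP => H; apply: sub; exists n.
have i0 : 'I_d by exists 0%N; lia.
have i1 : 'I_d.-1 by exists 0%N; lia.
pose eta (n : nat) := zeta (word_vertex i0 (nseq n i1)).
have etaN : iid_normal eta.
  split; last by move=> n; apply: law; exact: word_neq_root.
  apply: (independent_on_comp (iota := fun n => word_vertex i0 (nseq n i1)) _ _ ind).
    by move=> m n /word_vertex_inj /(congr1 size); rewrite !size_nseq.
  by move=> n; apply/eqP; exact: word_neq_root.
have gN : iid_normal (fun x : tree d => eta (choice.pickle x)).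
  exact: (iid_normal_comp (pcan_inj choice.pickleK) etaN).
(* The level [h'] percolates and lies above [h], so its cluster is contained in that of [h], which
   is almost surely finite for the field just built. *)
have [_ [h' perc <-] hh'] := ereal_sup_gt hh.
have := perc _ _ _ _ (gff_is_gff d3 etaN); apply/negP; rewrite -leNgt.
rewrite -(gff_no_infinite_cluster d3 gN small).
apply: le_measure; rewrite ?inE; [exact: measurable_infinite_cluster..|].
move=> w /=; apply: contra_not => fin; apply: sub_finite_set fin.
rewrite !level_clusterE => x Cx j; apply: le_trans (Cx j).
by rewrite ltW// -lte_fin.
Qed.
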